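(* Let $d\ge 1$ be an integer. (i) If $1<p<\frac{2d}{d-1}$, then there exists a constant $C(d,p)>0$ such that $$\frac{V_p(f)}{\|f\|_p^p}\cdot\frac{V_p(\hat f)}{\|\hat f\|_p^p}\ \ge\ C(d,p)\qquad\text{for every } f\in\mathcal{S}(\mathbb{R}^d)\setminus\{0\}.$$ Moreover, if $1<p\le 2$ is fixed, then $C(d,p)$ can be taken to grow like $d^p$ as $d\to\infty$, and this growth is sharp up to a dimension-free constant. That is, for each fixed $p\in(1,2]$ there exist constants $C_1(p),C_2(p)>0$ independent of $d$ such that for all sufficiently large $d$, $$C_1(p)\,d^p\ \le\ \inf_{f\in\mathcal{S}(\mathbb{R}^d)\setminus\{0\}}\frac{V_p(f)}{\|f\|_p^p}\cdot\frac{V_p(\hat f)}{\|\hat f\|_p^p}\ \le\ C_2(p)\,d^p .$$ (ii) If $\frac{2d}{d-1}<p<\infty$, then $$\inf_{f\in\mathcal{S}(\mathbb{R}^d)\setminus\{0\}}\frac{V_p(f)}{\|f\|_p^p}\cdot\frac{V_p(\hat f)}{\|\hat f\|_p^p}=0 .$$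
   Context: $\mathcal{S}(\mathbb{R}^d)$ is the Schwartz class of complex-valued functions on $\mathbb{R}^d$. The Fourier transform is normalized as $\hat f(\xi)=\int_{\mathbb{R}^d}f(x)e^{-2\pi i x\cdot\xi}\,dx$. $|x|$ is the Euclidean norm, $\|\cdot\|_p$ is the $L^p(\mathbb{R}^d)$ norm, and for $p\in(1,\infty)$, $V_p(f):=\int_{\mathbb{R}^d}|x|^p|f(x)|^p\,dx$. When $d=1$, $\frac{2d}{d-1}$ is interpreted as $+\infty$ (so that (i) covers all $1<p<\infty$ and (ii) is vacuous). *)

(* Defs.v *)
From HB Require Import structures.
From mathcomp Require Import all_boot all_order all_algebra.
From mathcomp Require Import complex.
From mathcomp Require Import all_classical all_reals all_analysis.

Set Implicit Arguments.
Unset Strict Implicit.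
Unset Printing Implicit Defensive.
Import Order.TTheory GRing.Theory Num.Theory.
Import numFieldNormedType.Exports.
Local Open Scope classical_set_scope.
Local Open Scope ring_scope.

Section LebesgueMeasureStep.
Context (R : realType) (n : nat).
Variable mu : {sigma_finite_measure set (n.-tuple R) -> \bar R}.
Local Open Scope ereal_scope.

Definition cons_pair (z : R * n.-tuple R) : n.+1.-tuple R :=
  [tuple of z.1 :: z.2].

Lemma measurable_cons_pair : measurable_fun [set: _] cons_pair.
Proof. exact: measurable_cons. Qed.

Definition lebesgue_step : set (n.+1.-tuple R) -> \bar R :=
  pushforward (@lebesgue_measure R \x mu) cons_pair.

Let lebesgue_step_measure : {measure set (n.+1.-tuple R) -> \bar R} :=
  measure_function_pushforward__canonical__measure_function_Measure
    (@lebesgue_measure R \x mu) measurable_cons_pair.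

HB.instance Definition _ := isMeasure.Build _ _ _ lebesgue_step
  (measure0 lebesgue_step_measure) (measure_ge0 lebesgue_step_measure)
  (@measure_semi_sigma_additive _ _ _ lebesgue_step_measure).

Lemma sigma_finite_lebesgue_step : sigma_finite setT lebesgue_step.
Proof.
have /sigma_finiteP[F [TF ndF Foo]] := sigma_finiteT (@lebesgue_measure R).
have /sigma_finiteP[G [TG ndG Goo]] := sigma_finiteT mu.
pose g (t : n.+1.-tuple R) := (thead t, [tuple of behead t]).
have mg : measurable_fun [set: _] g.
  apply/measurable_fun_pairP; split; last exact: measurable_behead.
  exact: measurable_tnth.
have gK : g \o cons_pair = id.
  by apply/funext => -[x t]; rewrite /g /cons_pair /=; congr pair; apply/val_inj.
exists (fun k => g @^-1` (F k `*` G k)) => [|k].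
  rewrite -preimage_bigcup -[LHS](preimage_setT g); congr (_ @^-1` _).
  rewrite -setXTT TF TG predeqE => -[x y]; split.
    move=> [/= [i _ Fix_] [j _ Gjy]]; exists (maxn i j) => //; split.
    - by move: x Fix_; exact/subsetPset/ndF/leq_maxl.
    - by move: y Gjy; exact/subsetPset/ndG/leq_maxr.
  by move=> [i _ []/= ? ?]; split; exists i.
have [mF Fk] := Foo k; have [mG Gk] := Goo k; split.
  by rewrite -[X in measurable X]setTI; apply: mg => //; exact: measurableX.
rewrite /lebesgue_step /pushforward -comp_preimage gK preimage_id.
by rewrite product_measure1E// lte_mul_pinfty// ge0_fin_numE.
Qed.

HB.instance Definition _ :=
  Measure_isSigmaFinite.Build _ _ _ lebesgue_step sigma_finite_lebesgue_step.
End LebesgueMeasureStep.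

(* Lebesgue measure on R^d, as the d-fold product of the measure on R; points
   are d-tuples because these carry the product sigma-algebra. *)
Fixpoint lebesgue_tuple (R : realType) (d : nat) :
    {sigma_finite_measure set (d.-tuple R) -> \bar R} :=
  match d with
  | 0 => \d_ ([tuple] : 0.-tuple R)
  | n.+1 => lebesgue_step (lebesgue_tuple R n)
  end.

Lemma lebesgue_tuple_box (R : realType) (d : nat) (A : 'I_d -> set R) :
  (forall i, measurable (A i)) ->
  lebesgue_tuple R d [set t | forall i, A i (tnth t i)] =
  (\prod_(i < d) @lebesgue_measure R (A i))%E.
Proof.
elim: d A => [|d IH] A mA /=.
  by rewrite big_ord0 diracE mem_set//; case.
have mB : measurable [set t : d.-tuple R | forall i, A (lift ord0 i) (tnth t i)].
  rewrite (_ : mkset _ =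
      \bigcap_(i in [set: 'I_d]) ((fun t => tnth t i) @^-1` A (lift ord0 i))).
    apply: fin_bigcap_measurable => // i _; rewrite -[X in measurable X]setTI.
    exact: measurable_tnth.
  by apply/seteqP; split => t /= At i; [move=> _|]; exact: At.
rewrite big_ord_recl -IH// -product_measure1E//.
  rewrite /lebesgue_step /pushforward; congr (_ _).
  apply/seteqP; split => [[x t] /= At|[x t] /= [Ax At] i].
    split; first by have := At ord0; rewrite tnth0.
    by move=> i; have := At (lift ord0 i); rewrite tnthS.
  by case: (unliftP ord0 i) => [j ->|->]; rewrite ?tnthS ?tnth0.
exact: mA.
Qed.

Section Schwartz.
Context (R : realType) (d : nat).
Implicit Types (x y xi : 'rV[R]_d) (f : 'rV[R]_d -> R[i]).

Definition dotrv x y : R := \sum_i x 0 i * y 0 i.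

(* The library's norm on 'rV[R]_d is the max norm, hence this definition. *)
Definition eucl_norm x : R := Num.sqrt (dotrv x x).

(* R[i] has no normed module structure over R: f is differentiated
   componentwise. *)
Definition partial (i : 'I_d) f : 'rV[R]_d -> R[i] :=
  fun x => Complex ('D_(delta_mx 0 i) (fun y => complex.Re (f y)) x)
                   ('D_(delta_mx 0 i) (fun y => complex.Im (f y)) x).

(* A word s = [:: i1; ...; ik] stands for the operator d_i1 ... d_ik; words
   cover all mixed partial derivatives of all orders. *)
Definition partials (s : seq 'I_d) f := foldr partial f s.

Definition cont_partially_derivable (g : 'rV[R]_d -> R) :=
  continuous g /\ forall (i : 'I_d) x, derivable g x (delta_mx 0 i).

Definition smooth f := forall s : seq 'I_d,
  cont_partially_derivable (fun x => complex.Re (partials s f x)) /\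
  cont_partially_derivable (fun x => complex.Im (partials s f x)).

Definition schwartz : set ('rV[R]_d -> R[i]) :=
  [set f | smooth f /\
    forall (k : nat) (s : seq 'I_d), exists M : R, forall x,
      eucl_norm x ^+ k * Normc.normc (partials s f x) <= M].

Definition rv_of_tuple (t : d.-tuple R) : 'rV[R]_d := \row_i tnth t i.

Definition cintegral f : R[i] :=
  Complex (\int[lebesgue_tuple R d]_t complex.Re (f (rv_of_tuple t)))
          (\int[lebesgue_tuple R d]_t complex.Im (f (rv_of_tuple t))).

Definition expi (theta : R) : R[i] := Complex (cos theta) (sin theta).

Definition fourier f : 'rV[R]_d -> R[i] :=
  fun xi => cintegral (fun x => f x * expi (- (2 * pi * dotrv x xi))).

Local Open Scope ereal_scope.

Definition Lp_norm (p : R) f : \bar R :=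
  'N[lebesgue_tuple R d]_(p%:E)[(fun t => (Normc.normc (f (rv_of_tuple t)))%:E)].

Definition moment (p : R) f : \bar R :=
  \int[lebesgue_tuple R d]_t
    (eucl_norm (rv_of_tuple t) `^ p * Normc.normc (f (rv_of_tuple t)) `^ p)%:E.

(* Quotients and infima are taken in the extended reals, so that no default
   value stands for an infinite integral or for the infimum of an empty set. *)
Definition uncertainty (p : R) f : \bar R :=
  (moment p f / (Lp_norm p f `^ p)) *
  (moment p (fourier f) / (Lp_norm p (fourier f) `^ p)).

Definition schwartz_neq0 : set ('rV[R]_d -> R[i]) :=
  [set f | schwartz f /\ f <> (fun=> 0%R)].

Definition inf_uncertainty (p : R) : \bar R :=
  ereal_inf [set uncertainty p f | f in schwartz_neq0].

End Schwartz.

Definition crit_exponent (R : realType) (d : nat) : \bar R :=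
  if d == 1%N then +oo%E else ((2 * d%:R) / (d%:R - 1))%:E.

(* Main.v *)
(** Write [M = V_p(f) / ||f||_p^p] and [M' = V_p(f^) / ||f^||_p^p], and think of
    [M = r^p], [M' = s^p]; the claims are about [(r s)^p].

    For [p <= 2], all but a fraction [1/K] of the mass of [|f|^p] lies in the ball of
    radius [K r], and likewise for [f^] with [K s].  Cutting [f] at that ball,
    estimating one part by L^1 -> L^infinity and the other by Hausdorff-Young gives
    [||f^||_p^p <= C ||f||_p^p * (powers of the two volumes)]; multiplying by the same
    inequality for the inverse transform cancels the norms, so the product of the two
    volumes is bounded below.  Since this product is of the form [(c r s / d)^d],
    [r s >= c' d] with [c'] independent of [d].

    For [2 < p < 2d/(d-1)], Hausdorff-Young bounds [||f^||_p] by [||f||_q] with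
    [q = p/(p-1)], and Hoelder with the weight [(r + |x|)^p] bounds [||f||_q] by
    [||f||_p]: the dual weight [(r + |x|)^(-p/(p-2))] is integrable exactly because
    [d < p/(p-2)].  This yields [||f^||_p^p <= C r^(d(p-2)) ||f||_p^p], which is again
    multiplied by its analogue for the inverse transform.

    The upper bound for [p <= 2] is attained, up to a constant, by [exp(-pi |x|^2)].
    For [p > 2d/(d-1)] the self-dual functions
    [exp(-pi a^2 |x|^2) + a^(-d) exp(-pi |x|^2 / a^2)] have their L^p norm carried by
    the narrow bump, and [M] is of order [a^(-p) + a^(2d - p(d-1))], which tends to 0
    as [a] grows. *)

Require Import Defs.
From mathcomp Require Import all_boot all_order all_algebra.
From mathcomp Require Import complex.
From mathcomp Require Import all_classical all_reals all_analysis.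
From mathcomp Require Import measurable_realfun ring lra.
Import Order.TTheory GRing.Theory Num.Theory.
Import numFieldNormedType.Exports.
Local Open Scope classical_set_scope.
Local Open Scope ring_scope.
Set Implicit Arguments.
Unset Strict Implicit.
Unset Printing Implicit Defensive.

(** * Integration on tuples *)

Section TupleIntegral.
Context {R : realType}.
Local Notation leb := (@lebesgue_measure R).
Local Notation mu := (lebesgue_tuple R).
Local Open Scope ereal_scope.

(** Two different lower-bound arguments are needed because the one for [p > 2] ends in
    [(C * C)^-1 <= (r s)^(d (p - 2))], whose exponent vanishes at [p = 2]. For [p <= 2] the bound
    stays free of the dimension because the constants met on the way are absolute ([4^p <= 16],
    [K = 1024]), while the two volumes enter only through one pure power [y^d], with [y] a multiple
    of [r s / d]: from [y^d >= 1 / K] follows [y >= 1 / K] for every [d >= 1]. This leaves room for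
    inequalities that are not sharp: Hausdorff-Young carries the factor [2^P] of an interpolation by
    truncation between L^1 and L^2, Plancherel is only an inequality, and volumes are replaced by
    exponential bounds. The inverse transform is never introduced as an operator: if [v] is the
    transform of [u], then [conj u] is the transform of [conj v], and conjugation changes neither
    norms nor moments. The decay of the transform rests on integration by parts, which is obtained
    from the translation invariance of the measure. *)

Lemma mcons_pair n : measurable_fun [set: measurableTypeR R * n.-tuple R] (@cons_pair R n).
Proof. exact: measurable_cons_pair. Qed.

Lemma integral_step n (g : n.+1.-tuple R -> \bar R) :
  measurable_fun setT g -> (forall t, 0 <= g t) ->
  \int[mu n.+1]_t g t = \int[leb \x mu n]_z g (cons_pair z).
Proof.
move=> mg g0.
rewrite (@ge0_integral_pushforward _ _ _ _ _ _ (@mcons_pair n) (leb \x mu n)) //=.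
Qed.

Lemma tonelli_step n (g : n.+1.-tuple R -> \bar R) :
  measurable_fun setT g -> (forall t, 0 <= g t) ->
  \int[mu n.+1]_t g t = \int[leb]_x \int[mu n]_t g (cons_pair (x, t)).
Proof.
move=> mg g0; rewrite integral_step//.
apply: (@fubini_tonelli1 _ _ (measurableTypeR R) (n.-tuple R) R leb (mu n) (g \o @cons_pair R n)) => /=.
- by apply: (measurableT_comp mg); exact: mcons_pair.
- by move=> z; exact: g0.
Qed.

(** The first coordinate is integrated innermost, the reverse of [tonelli_step]:
    [Rintegral_gauss_cos] has to integrate it out before the induction hypothesis applies to the
    others. *)
Lemma fubini_step2 n (g : n.+1.-tuple R -> \bar R) :
  (mu n.+1).-integrable setT g ->
  \int[mu n.+1]_t g t = \int[mu n]_t \int[leb]_x g (cons_pair (x, t)).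
Proof.
move=> ig.
have mg := measurable_int _ ig.
have ig2 : (leb \x mu n).-integrable setT (g \o @cons_pair R n).
  apply/integrableP; split; first by apply: (measurableT_comp mg); exact: mcons_pair.
  move/integrableP : ig => [_].
  by rewrite (@integral_step n (abse \o g)) //=; exact: measurableT_comp.
rewrite (@integral_pushforward _ _ _ _ _ _ (@mcons_pair n) (leb \x mu n) setT) //=.
by rewrite -(integral21_prod_meas1 ig2).
Qed.

Lemma measurable_addr (h : R) :
  measurable_fun [set: measurableTypeR R] (fun x => (x + h)%R : measurableTypeR R).
Proof.
have : measurable_fun [set: R] (fun x : R => (x + h)%R) by exact: measurable_funD.
exact.
Qed.

Lemma lebesgue_shift (h : R) (A : set R) : measurable A ->
  leb A = pushforward leb (fun x : R => (x + h)%R) A.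
Proof.
have mh := measurable_addr h.
apply: (lebesgue_measure_unique (mu := measure_function_pushforward__canonical__measure_function_Measure leb mh)).
move=> X [[a b] _ <-] /=.
rewrite /pushforward.
rewrite (_ : _ @^-1` _ = [set` Interval (BRight (a - h)%R) (BRight (b - h)%R)]); last first.
  by apply/seteqP; split => x /=; rewrite !in_itv/= ltrBlDr lerBrDr.
rewrite !lebesgue_measure_itv /= !lte_fin ltrD2r; case: ifP => // _.
by rewrite -!EFinD; congr EFin; ring.
Qed.

Lemma ge0_integral_shift (h : R) (g : R -> \bar R) :
  measurable_fun setT g -> (forall x, 0 <= g x) ->
  \int[leb]_x g (x + h)%R = \int[leb]_x g x.
Proof.
move=> mg g0.
have mh := measurable_addr h.
rewrite [RHS](eq_measure_integral (measure_function_pushforward__canonical__measure_function_Measure leb mh)); last first.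
  by move=> A mA _; exact: lebesgue_shift.
by rewrite (@ge0_integral_pushforward _ _ _ _ _ _ mh leb) //=.
Qed.

Lemma integral_pushforward_eq d (T : measurableType d) (m : {measure set T -> \bar R})
    (phi : T -> T) (mphi : measurable_fun setT phi) (g : T -> \bar R) :
  (forall A, measurable A -> m A = m (phi @^-1` A)) ->
  m.-integrable setT g -> \int[m]_x g (phi x) = \int[m]_x g x.
Proof.
move=> mE ig; rewrite [RHS](eq_measure_integral (measure_function_pushforward__canonical__measure_function_Measure m mphi)); last first.
  by move=> A mA _; exact: mE.
have mg := measurable_int _ ig.
rewrite (@integral_pushforward _ _ _ _ _ _ mphi m setT)//.
apply/integrableP; split; first exact: measurableT_comp.
move/integrableP : ig => [_]; rewrite (eq_measure_integral (measure_function_pushforward__canonical__measure_function_Measure m mphi)); last first.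
  by move=> A mA _; exact: mE.
by rewrite (@ge0_integral_pushforward _ _ _ _ _ _ mphi m setT (abse \o g))//=; exact: measurableT_comp.
Qed.

Definition tshift d (v : 'I_d -> R) (t : d.-tuple R) : d.-tuple R :=
  [tuple (tnth t i + v i)%R | i < d].

Lemma measurable_tshift d (v : 'I_d -> R) : measurable_fun setT (tshift v).
Proof.
apply/measurable_fun_tnthP => i.
rewrite (_ : _ \o _ = fun t => (tnth t i + v i)%R); last first.
  by apply/funext => t /=; rewrite tnth_mktuple.
by apply: measurable_funD => //; exact: measurable_tnth.
Qed.

Lemma tshift_cons n (v : 'I_n.+1 -> R) x (t : n.-tuple R) :
  tshift v (cons_pair (x, t)) =
  cons_pair ((x + v ord0)%R, tshift (v \o lift ord0) t).
Proof.
apply: eq_from_tnth => i; rewrite tnth_mktuple /cons_pair /=.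
case: (unliftP ord0 i) => [j ->|->]; last by rewrite !tnth0.
by rewrite !tnthS tnth_mktuple.
Qed.

Lemma ge0_integral_tshift d (v : 'I_d -> R) (g : d.-tuple R -> \bar R) :
  measurable_fun setT g -> (forall t, 0 <= g t) ->
  \int[mu d]_t g (tshift v t) = \int[mu d]_t g t.
Proof.
elim: d v g => [|n IH] v g mg g0.
  by apply: eq_integral => t _; rewrite (tuple0 t) (tuple0 (tshift _ _)).
have mgs : measurable_fun setT (fun t => g (tshift v t)).
  by apply: measurableT_comp => //; exact: measurable_tshift.
rewrite tonelli_step//.
under eq_integral => x _ do under eq_integral => t _ do rewrite tshift_cons.
under eq_integral => x _.
  rewrite (IH _ (fun t => g (cons_pair (x + v ord0, t)%R)))//; last first.
    apply: (measurableT_comp mg); apply: (measurableT_comp (@mcons_pair n)).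
    exact: measurable_pair1.
  over.
rewrite (@ge0_integral_shift (v ord0) (fun x => \int[mu n]_t g (cons_pair (x, t)))).
- by rewrite -tonelli_step.
- apply: (@measurable_fun_fubini_tonelli_F _ _ _ _ _ (mu n) (g \o @cons_pair R n)) => //.
  by apply: measurableT_comp mg _; exact: mcons_pair.
  by move=> x; exact: g0.
- by move=> x; apply: integral_ge0 => t _; exact: g0.
Qed.

(** Invariance of the measure itself is read off from the nonnegative case applied to indicators;
    pushing the measure forward then gives the signed case. *)
Lemma integral_tshift d (v : 'I_d -> R) (g : d.-tuple R -> \bar R) :
  (mu d).-integrable setT g ->
  \int[mu d]_t g (tshift v t) = \int[mu d]_t g t.
Proof.
apply: integral_pushforward_eq; first exact: measurable_tshift.
move=> A mA.
have mA' : measurable (tshift v @^-1` A).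
  by rewrite -[X in measurable X]setTI; exact: measurable_tshift.
rewrite -[A in LHS]setIT -integral_indic// -(ge0_integral_tshift v)//.
- by rewrite -[tshift v @^-1` A]setIT -integral_indic.
- by apply/measurable_EFinP; exact: measurable_indic.
Qed.

Lemma integral_shift (h : R) (g : R -> \bar R) : leb.-integrable setT g ->
  \int[leb]_x g (x + h)%R = \int[leb]_x g x.
Proof.
apply: integral_pushforward_eq; first exact: measurable_funD.
exact: lebesgue_shift.
Qed.

Lemma measurable_prod_tnth d (g : 'I_d -> R -> R) :
  (forall i, measurable_fun setT (g i)) ->
  measurable_fun setT (fun t : d.-tuple R => (\prod_i g i (tnth t i))%R).
Proof.
move=> mg; apply: measurable_prod => i _.
by apply: measurableT_comp => //; exact: measurable_tnth.
Qed.

Lemma integral_prod_tnth d (g : 'I_d -> R -> R) :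
  (forall i, measurable_fun setT (g i)) -> (forall i x, (0 <= g i x)%R) ->
  \int[mu d]_t (\prod_i g i (tnth t i))%:E = \prod_i \int[leb]_x (g i x)%:E.
Proof.
elim: d g => [|n IH] g mg g0.
  rewrite big_ord0 /= integral_dirac//.
    by rewrite diracT mul1e big_ord0.
  by apply/measurable_EFinP; exact: measurable_prod_tnth.
rewrite tonelli_step; last 2 first.
- by apply/measurable_EFinP; exact: measurable_prod_tnth.
- by move=> t; rewrite lee_fin prodr_ge0.
rewrite big_ord_recl -IH//.
rewrite -ge0_integralZr//.
- apply: eq_integral => x _; rewrite -ge0_integralZl//.
  + apply: eq_integral => t _; rewrite big_ord_recl -EFinM tnth0; congr (_ * _)%:E.
    by apply: eq_bigr => i _; rewrite tnthS.
  + apply/measurable_EFinP; exact: (measurable_prod_tnth (fun i => mg (lift ord0 i))).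
  + by move=> t _; rewrite lee_fin prodr_ge0.
  + by rewrite lee_fin.
- by apply/measurable_EFinP; exact: (mg ord0).
- by move=> x _; rewrite lee_fin.
- by apply: integral_ge0 => t _; rewrite lee_fin prodr_ge0.
Qed.

End TupleIntegral.

Section RealIntegrable.
Context {R : realType} d {T : measurableType d} {m : {measure set T -> \bar R}}.
Implicit Types f g : T -> R.

Lemma integrable_scale f (k : R) : m.-integrable setT (EFin \o f) ->
  m.-integrable setT (EFin \o (fun x => k * f x)).
Proof.
move=> fi; rewrite (_ : _ \o _ = fun x => (k%:E * (EFin \o f) x)%E).
  exact: integrableZl.
by apply/funext.
Qed.

Lemma integrable_add f g : m.-integrable setT (EFin \o f) -> m.-integrable setT (EFin \o g) ->
  m.-integrable setT (EFin \o (fun x => f x + g x)).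
Proof.
move=> fi gi; rewrite (_ : _ \o _ = (EFin \o f) \+ (EFin \o g))%E.
  exact: integrableD.
by apply/funext.
Qed.

Lemma integrable_opp f : m.-integrable setT (EFin \o f) ->
  m.-integrable setT (EFin \o (fun x => - f x)).
Proof.
move=> fi; rewrite (_ : (fun x => - f x) = (fun x => -1 * f x)); first exact: integrable_scale.
by apply/funext => x; rewrite mulN1r.
Qed.

Lemma integrable_le f g : measurable_fun setT f -> (forall x, `|f x| <= g x) ->
  m.-integrable setT (EFin \o g) -> m.-integrable setT (EFin \o f).
Proof.
move=> mf fg; apply: le_integrable => //; first exact/measurable_EFinP.
by move=> x _ /=; rewrite lee_fin (le_trans (fg x))// ler_norm.
Qed.

End RealIntegrable.

(** * Integrals of derivatives *)

Section Flow.
Context {R : realType} d {T : measurableType d} {m : {measure set T -> \bar R}}.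

(** The substitute for integration by parts. As the flow [tau] preserves the integral of [g], the
    function [h |-> \int g (tau h t)] is constant; its derivative at 0 is computed under the
    integral sign, which the majorant [D] for [|h| < 1] permits. *)
Lemma Rintegral_flow_derive0 (tau : R -> T -> T) (g : T -> R) (g' : R -> T -> R) (D : T -> R) :
  (forall t, tau 0 t = t) ->
  (forall h, `|h| < 1 -> m.-integrable setT (EFin \o (g \o tau h))) ->
  (forall h, \int[m]_t g (tau h t) = \int[m]_t g t) ->
  (forall h t, is_derive h (1 : R) (fun k : R => g (tau k t)) (g' h t)) ->
  m.-integrable setT (EFin \o D) ->
  (forall h t, `|h| < 1 -> `|g' h t| <= D t) ->
  \int[m]_t g' 0 t = 0.
Proof.
move=> tau0 ig tauE dg iD gD.
have D0 t : 0 <= D t by apply: le_trans (gD 0 t _); rewrite ?normr0.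
pose f (h : R) (t : T) := g (tau h t).
have d1f h t : partial1of2 f h t = g' h t.
  by rewrite partial1of2E; have := dg h t => -[_ ->].
have cvgF := @cvg_differentiation_under_integral R _ T m f setT measurableT
  0 (-1) 1 _ _ _ D D0 iD _.
have {}cvgF : h^-1 *: (\int[m]_t f (h + 0) t - \int[m]_t f 0 t) @[h --> 0^'] -->
   \int[m]_t partial1of2 f 0 t.
  apply: cvgF.
  - by rewrite /= in_itv /= ltrN10 ltr01.
  - by move=> h; rewrite /= in_itv /= => /andP[h1 h2]; apply: ig; rewrite ltr_norml h1 h2.
  - by move=> h t _ _; have := dg h t => -[].
  - move=> h t; rewrite /= in_itv /= => /andP[h1 h2] _; rewrite d1f; apply: gD.
    by rewrite ltr_norml h1 h2.
have E : (fun h : R => h^-1 *: (\int[m]_t f (h + 0) t - \int[m]_t f 0 t)) = fun=> 0.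
  by apply/funext => h; rewrite /f tauE (tauE 0) subrr scaler0.
rewrite E in cvgF.
transitivity (\int[m]_t partial1of2 f 0 t).
  by apply: eq_Rintegral => t _; rewrite d1f.
by apply/esym; apply: cvg_unique cvgF; [exact: norm_hausdorff|exact: cvg_cst].
Qed.

End Flow.

Lemma is_derive_line {R : realType} (V : normedModType R) (f : V -> R) (x v : V) (h l : R) :
  is_derive (h *: v + x) v f l -> is_derive h (1 : R) (fun k : R => f (k *: v + x)) l.
Proof.
move=> [df vf].
have E : (fun k : R => k^-1 *: (f ((k *: (1 : R) + h) *: v + x) - f (h *: v + x))) =
    (fun k : R => k^-1 *: (f (k *: v + (h *: v + x)) - f (h *: v + x))).
  by apply/funext => k; rewrite scalerDl addrA [k *: 1]mulr1.
by apply: DeriveDef; rewrite /derivable /derive /= E.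
Qed.

Section Weight.
Context {R : realType}.
Local Notation leb := (@lebesgue_measure R).

(** With [k = min 1 (c / (n + 1))], [k (1 + u) <= 1 + c u / (n + 1) <= expR (c u / (n + 1))]; the
    power [n + 1] of this is the bound, with one factor [1 + u >= 1] to spare. Using [n + 1] avoids
    a division by [n = 0]. *)
Lemma poly_expR_bounded (n : nat) (c : R) : 0 < c ->
  exists2 C : R, 0 < C & forall u, 0 <= u -> (1 + u) ^+ n * expR (- (c * u)) <= C.
Proof.
move=> c0; pose k : R := Num.min 1 (c / n.+1%:R).
have k0 : 0 < k by rewrite lt_min ltr01 divr_gt0.
exists (k ^- n.+1) => [|u u0]; first by rewrite invr_gt0 exprn_gt0.
have u1 : 1 <= 1 + u by rewrite lerDl.
have E : (k * (1 + u)) ^+ n.+1 <= expR (c * u).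
  have -> : c * u = (c / n.+1%:R * u) *+ n.+1.
    by rewrite -mulr_natr mulrAC divfK ?pnatr_eq0.
  rewrite -mulr_natr expRM_natr; apply: lerXn2r; rewrite ?nnegrE ?expR_ge0//.
    by rewrite mulr_ge0// ltW// (lt_le_trans ltr01).
  apply: le_trans (expR_ge1Dx _); rewrite mulrDr mulr1 lerD// ?ge_min ?lexx//.
  by rewrite ler_wpM2r// ge_min lexx orbT.
rewrite expRN ler_pdivrMr ?expR_gt0//.
rewrite exprMn in E.
apply: (@le_trans _ _ ((1 + u) ^+ n.+1)); first by rewrite ler_weXn2l.
by rewrite ler_pdivlMl ?exprn_gt0.
Qed.

(** The standard integrable majorant. Unlike a Gaussian, it is stable under bounded translations up
    to a constant factor, which the domination along a translation flow requires. *)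
Definition wt (x : R) : R := (oneDsqr x)^-1.

Lemma wt_gt0 x : 0 < wt x.
Proof. by rewrite invr_gt0. Qed.

Lemma wt_le1 x : wt x <= 1. Proof. exact: oneDsqrV_le1. Qed.

Lemma continuous_wt : continuous wt.
Proof. exact: continuous_oneDsqrV. Qed.

Lemma measurable_wt : measurable_fun setT wt.
Proof. by apply: continuous_measurable_fun; exact: continuous_wt. Qed.

Lemma integral_wt : (\int[leb]_x (wt x)%:E = pi%:E)%E.
Proof.
rewrite ge0_symfun_integralT.
- rewrite (_ : [set x | 0 <= x] = [set` Interval (BLeft 0) (BInfty _ false)]).
    rewrite integral0y_oneDsqr -EFinM; congr EFin.
    by rewrite mulrCA divff ?mulr1// pnatr_eq0.
  by rewrite set_itvcy.
- by move=> x; rewrite ltW// wt_gt0.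
- exact: continuous_wt.
- by move=> x; rewrite /wt /oneDsqr /= sqrrN.
Qed.

Lemma integrable_wt : leb.-integrable setT (EFin \o wt).
Proof.
apply/integrableP; split; first by apply/measurable_EFinP; exact: measurable_wt.
under eq_integral => x _ do rewrite /= ger0_norm ?(ltW (wt_gt0 x))//.
by rewrite integral_wt ltry.
Qed.

(** [3 (1 + (x + h)^2) - (1 + x^2) = (2 x + 3 h)^2 / 2 + 2 - 3 h^2 / 2], which is positive for
    [h^2 <= 1]. *)
Lemma wt_shift (h x : R) : `|h| <= 1 -> wt (x + h) <= 3 * wt x.
Proof.
move=> h1; rewrite /wt -ler_pdivrMl// -invfM lef_pV2 ?posrE ?mulr_gt0//.
have : h ^+ 2 <= 1 by rewrite -real_normK ?num_real// exprn_ile1.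
rewrite /oneDsqr; have := sqr_ge0 (2 * x + 3 * h); nra.
Qed.

Lemma integrable_le_wt (f : R -> R) C : measurable_fun setT f ->
  (forall x, `|f x| <= C * wt x) -> leb.-integrable setT (EFin \o f).
Proof.
move=> mf fC.
apply: (@le_integrable _ _ _ leb setT measurableT _ (EFin \o (fun x => C * wt x))).
- by apply/measurable_EFinP.
- move=> x _ /=; rewrite lee_fin (le_trans (fC x))// ler_norm//.
- rewrite (_ : _ \o _ = fun x => (C%:E * (EFin \o wt) x)%E).
    by apply: integrableZl => //; exact: integrable_wt.
  by apply/funext.
Qed.

(** The flow is translation, and [wt_shift] keeps both majorants valid along it, so no limit of [g]
    at infinity has to be computed. *)
Lemma Rintegral_derive0 (g g' : R -> R) (C : R) :
  (forall x, is_derive x (1 : R) g (g' x)) ->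
  (forall x, `|g x| <= C * wt x) -> (forall x, `|g' x| <= C * wt x) ->
  leb.-integrable setT (EFin \o g) /\ \int[leb]_x g' x = 0.
Proof.
move=> dg gC g'C.
have cg : continuous g.
  move=> x; apply/differentiable_continuous/derivable1_diffP; exact: (@ex_derive _ _ _ _ _ _ _ (dg x)).
have mg : measurable_fun setT g by exact: continuous_measurable_fun.
have ig := integrable_le_wt mg gC.
split=> //.
have C0 : 0 <= C.
  by have := le_trans (normr_ge0 _) (gC 0); rewrite pmulr_lge0// wt_gt0.
rewrite (_ : (fun x => g' x) = (fun x => g' (x + 0))); last first.
  by apply/funext => x; rewrite addr0.
apply: (@Rintegral_flow_derive0 _ _ _ leb (fun h x => x + h) g (fun h x => g' (x + h)) (fun x => C * (3 * wt x))).
- by move=> t; rewrite addr0.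
- move=> h h1; apply: (@integrable_le_wt _ (C * 3)).
    by apply: measurableT_comp => //; exact: measurable_funD.
  move=> x; apply: le_trans (gC _) _; rewrite -mulrA ler_wpM2l//.
  exact/wt_shift/ltW.
- by move=> h; rewrite /Rintegral (integral_shift h ig).
- move=> h x.
  have := @is_derive_line R R g x 1 h (g' (x + h)).
  rewrite [h *: 1]mulr1 addrC => /(_ (dg _)).
  by under eq_fun do rewrite [_ *: 1]mulr1 addrC.
- rewrite (_ : _ \o _ = fun x => ((C * 3)%:E * (EFin \o wt) x)%E).
    by apply: integrableZl => //; exact: integrable_wt.
  by apply/funext => x; rewrite /= -EFinM mulrA.
- move=> h x h1; apply: le_trans (g'C _) _; rewrite ler_wpM2l//.
  exact/wt_shift/ltW.
Qed.

End Weight.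

Section RealDerivatives.
Context {R : realType}.
Implicit Types (f g : R -> R) (x a b : R).

Lemma is_derive_mul f g x a b : is_derive x (1 : R) f a -> is_derive x (1 : R) g b ->
  is_derive x (1 : R) (fun y => f y * g y) (a * g x + f x * b).
Proof.
move=> df dg; apply: (@is_derive_eq _ _ _ (f * g)).
by rewrite /GRing.scale /= addrC [g x * a]mulrC.
Qed.

Lemma is_derive_add f g x a b : is_derive x (1 : R) f a -> is_derive x (1 : R) g b ->
  is_derive x (1 : R) (fun y => f y + g y) (a + b).
Proof. by move=> df dg; apply: (@is_derive_eq _ _ _ (f + g)). Qed.

Lemma is_derive_comp f g x a b : is_derive (g x) (1 : R) f a -> is_derive x (1 : R) g b ->
  is_derive x (1 : R) (fun y => f (g y)) (a * b).
Proof. by move=> df dg; apply: (@is_derive1_comp _ f g). Qed.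

Lemma is_derive_const x a : is_derive x (1 : R) (fun=> a) 0.
Proof. exact: is_derive_cst. Qed.

Lemma is_derive_affine x a b : is_derive x (1 : R) (fun y => a * y + b) a.
Proof.
apply: (@is_derive_eq _ _ _ _ _ _ _ (a + 0)); last by rewrite addr0.
apply: (@is_derive_add (fun y => a * y) (fun=> b)).
apply: (@is_derive_eq _ _ _ _ _ _ _ (0 * x + a * 1)); last by rewrite mul0r add0r mulr1.
exact: (@is_derive_mul (fun=> a) id).
Qed.

Lemma is_derive_sqr x a : is_derive x (1 : R) (fun y => a * y ^+ 2) (2 * a * x).
Proof.
apply: (@is_derive_eq _ _ _ _ _ _ _ (0 * x ^+ 2 + a * (1 * x + x * 1))); last by ring.
apply: (@is_derive_mul (fun=> a) (fun y => y ^+ 2)).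
exact: (@is_derive_mul id id).
Qed.

End RealDerivatives.

(** * Gaussian integrals *)

Section Gauss1.
Context {R : realType}.
Local Notation leb := (@lebesgue_measure R).

Definition ga (c x : R) : R := expR (- (c * x ^+ 2)).

Lemma ga_gt0 (c x : R) : 0 < ga c x. Proof. exact: expR_gt0. Qed.

Lemma is_derive_ga (c x : R) : is_derive x (1 : R) (ga c) (- (2 * c * x) * ga c x).
Proof.
rewrite mulrC; apply: (@is_derive_comp _ expR (fun y => - (c * y ^+ 2))).
apply: (@is_derive_eq _ _ _ _ _ _ _ (2 * (- c) * x)); last by ring.
by under eq_fun do rewrite -mulNr; exact: is_derive_sqr.
Qed.

Lemma continuous_ga (c : R) : continuous (ga c).
Proof.
move=> x; apply/differentiable_continuous/derivable1_diffP.
exact: (@ex_derive _ _ _ _ _ _ _ (is_derive_ga c x)).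
Qed.

Lemma measurable_ga (c : R) : measurable_fun setT (ga c).
Proof. by apply: continuous_measurable_fun; exact: continuous_ga. Qed.

Lemma ga_bound (n : nat) (c : R) : 0 < c ->
  exists2 C : R, 0 < C & forall x, (1 + x ^+ 2) ^+ n * ga c x <= C * wt x.
Proof.
move=> c0; have [C C0 CP] := poly_expR_bounded n.+1 c0; exists C => // x.
have := CP (x ^+ 2) (sqr_ge0 _).
by rewrite /wt ler_pdivlMr ?(lt_le_trans ltr01 (oneDsqr_ge1 _))// mulrAC -exprSr.
Qed.

Lemma integral_ga (c : R) : 0 < c -> (\int[leb]_x (ga c x)%:E = (Num.sqrt (pi / c))%:E)%E.
Proof.
(* The standard deviation [s] with [s^2 = 1 / (2 c)], for which the normal density is a multiple of
   [ga c]. *)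
move=> c0; pose s : R := Num.sqrt ((c *+ 2)^-1).
have c20 : 0 < (c *+ 2)^-1 by rewrite invr_gt0 mulrn_wgt0.
have s2 : s ^+ 2 = (c *+ 2)^-1 by rewrite sqr_sqrtr// ltW.
have s0 : s != 0 by rewrite gt_eqF// sqrtr_gt0.
have := @integral_normal_pdf R 0 s; rewrite normal_pdfE//.
have E x : normal_peak s * normal_fun 0 s x = (Num.sqrt (pi / c))^-1 * ga c x.
  rewrite /normal_peak /normal_fun /ga subr0 s2; congr (_^-1 * expR _).
    congr Num.sqrt; rewrite -[c *+ 2]mulr_natr invfM mulrAC -mulr_natr -!mulrA.
    by rewrite mulVf ?pnatr_eq0// mulr1 mulrC.
  have -> : (c *+ 2)^-1 *+ 2 = c^-1.
    by rewrite -[LHS]mulr_natr -[c *+ 2]mulr_natr invfM divfK ?pnatr_eq0.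
  by rewrite invrK mulNr mulrC.
under eq_integral => x _ do rewrite E EFinM.
have k0 : 0 < Num.sqrt (pi / c) by rewrite sqrtr_gt0 divr_gt0// pi_gt0.
rewrite ge0_integralZl//=; last 2 first.
- by apply/measurable_EFinP; exact: measurable_ga.
- by move=> x _; rewrite lee_fin ltW// ga_gt0.
move=> /(congr1 (fun x => (Num.sqrt (pi / c))%:E * x)%E).
by rewrite muleA -EFinM divff ?gt_eqF// mul1e mule1.
Qed.

Lemma integral_ga_center (c m : R) : 0 < c ->
  (\int[leb]_x (ga c (x - m))%:E = (Num.sqrt (pi / c))%:E)%E.
Proof.
move=> c0; rewrite (@ge0_integral_shift _ (- m) (fun x => (ga c x)%:E)) ?integral_ga//.
- by apply/measurable_EFinP; exact: measurable_ga.
- by move=> x; rewrite lee_fin ltW// ga_gt0.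
Qed.

Lemma integrable_le_ga (f : R -> R) (n : nat) (K c : R) : 0 < c -> measurable_fun setT f ->
  (forall x, `|f x| <= K * ((1 + x ^+ 2) ^+ n * ga c x)) -> leb.-integrable setT (EFin \o f).
Proof.
move=> c0 mf fK; have [C C0 CP] := ga_bound n c0.
apply: (@integrable_le_wt _ _ (`|K| * C)) => // x.
apply: le_trans (fK x) _; rewrite -mulrA; apply: le_trans (_ : `|K| * ((1 + x ^+ 2) ^+ n * ga c x) <= _).
  by rewrite ler_wpM2r ?ler_norm// mulr_ge0 ?(ltW (ga_gt0 _ _))// exprn_ge0// addr_ge0// sqr_ge0.
by rewrite ler_wpM2l.
Qed.

Lemma integrable_ga (c : R) : 0 < c -> leb.-integrable setT (EFin \o ga c).
Proof.
move=> c0; apply: (@integrable_le_ga _ 0 1 c) => // [|x]; first exact: measurable_ga.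
by rewrite expr0 !mul1r ger0_norm// ltW// ga_gt0.
Qed.

Lemma Rintegral_ga (c : R) : 0 < c -> \int[leb]_x (ga c x) = Num.sqrt (pi / c).
Proof. by move=> c0; rewrite /Rintegral integral_ga. Qed.

Lemma integrable_ga2 (c : R) : 0 < c -> leb.-integrable setT (EFin \o (fun x => x ^+ 2 * ga c x)).
Proof.
move=> c0; apply: (@integrable_le_ga _ 1 1 c) => // [|x].
  by apply: measurable_funM; [exact: exprn_measurable|exact: measurable_ga].
rewrite expr1 !mul1r ger0_norm; last by rewrite mulr_ge0 ?sqr_ge0// ltW// ga_gt0.
by rewrite ler_pM2r ?ga_gt0// lerDr.
Qed.

(** The function [ga c x - 2 c x^2 ga c x] is the derivative of [x * ga c x], hence has integral
    0. *)
Lemma Rintegral_ga2 (c : R) : 0 < c ->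
  \int[leb]_x (x ^+ 2 * ga c x) = Num.sqrt (pi / c) / (2 * c).
Proof.
move=> c0; have [C C0 CP] := ga_bound 1 c0.
have c20 : 0 < 2 * c by rewrite mulr_gt0.
have b1 x : 0 <= ga c x by rewrite ltW// ga_gt0.
have CP' x : (1 + x ^+ 2) * ga c x <= C * wt x by have := CP x; rewrite expr1.
have xb (x : R) : `|x| <= 1 + x ^+ 2.
  by rewrite ler_norml; have := sqr_ge0 (x - 1); have := sqr_ge0 (x + 1); nra.
have [] := @Rintegral_derive0 _ (fun x => x * ga c x)
  (fun x => ga c x - 2 * c * (x ^+ 2 * ga c x)) ((1 + 2 * c) * C).
- move=> x; apply: (@is_derive_eq _ _ _ _ _ _ _ (1 * ga c x + x * (- (2 * c * x) * ga c x))); last by ring.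
  by apply: (@is_derive_mul _ id (ga c)); exact: is_derive_ga.
- move=> x; rewrite normrM (ger0_norm (b1 x)) -mulrA.
  apply: (@le_trans _ _ (1 * ((1 + x ^+ 2) * ga c x))).
    by rewrite mul1r ler_wpM2r.
  by apply: ler_pM => //; rewrite ?mulr_ge0 ?addr_ge0 ?sqr_ge0// lerDl ltW.
- move=> x; rewrite -[leRHS]mulrA.
  apply: (@le_trans _ _ ((1 + 2 * c) * ((1 + x ^+ 2) * ga c x))); last first.
    by rewrite ler_wpM2l// addr_ge0// ltW.
  rewrite ler_norml; have := b1 x; have := sqr_ge0 x => h1 h2.
  have h3 : 0 <= x ^+ 2 * ga c x by exact: mulr_ge0.
  have h4 : 0 <= c * (x ^+ 2 * ga c x) by apply: mulr_ge0 => //; exact: ltW.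
  have h5 : 0 <= c * ga c x by apply: mulr_ge0 => //; exact: ltW.
  by nra.
move=> _.
rewrite RintegralB//; first last.
- by apply: integrable_scale; exact: integrable_ga2.
- exact: integrable_ga.
rewrite RintegralZl//; last exact: integrable_ga2.
rewrite Rintegral_ga// => /eqP; rewrite subr_eq0 => /eqP ->.
by rewrite mulrC mulKf// gt_eqF.
Qed.

Lemma measurable_cos_affine (x a : R) : measurable_fun setT (fun t : R => cos (x * t + a)).
Proof.
apply: continuous_measurable_fun => t.
apply: (@continuous_comp _ _ _ (fun t => x * t + a) (@cos R)); last exact: continuous_cos.
by apply: cvgD; [apply: mulrl_continuous|exact: cvg_cst].
Qed.

Lemma measurable_sin_affine (x a : R) : measurable_fun setT (fun t : R => sin (x * t + a)).
Proof.
apply: continuous_measurable_fun => t.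
apply: (@continuous_comp _ _ _ (fun t => x * t + a) (@sin R)); last exact: continuous_sin.
by apply: cvgD; [apply: mulrl_continuous|exact: cvg_cst].
Qed.

Lemma integrable_ga_cos (c x a : R) : 0 < c ->
  leb.-integrable setT (EFin \o (fun t => ga c t * cos (x * t + a))).
Proof.
move=> c0; apply: (@integrable_le_ga _ 0 1 c) => // [|t].
  by apply: measurable_funM; [exact: measurable_ga|exact: measurable_cos_affine].
rewrite expr0 !mul1r normrM ger0_norm ?(ltW (ga_gt0 _ _))// ler_piMr ?(ltW (ga_gt0 _ _))//.
by rewrite ler_norml cos_geN1 cos_le1.
Qed.

(* Both sides of the identity in x solve y' = - x / (2 c) y. *)
Lemma Rintegral_ga_cos (c x a : R) : 0 < c ->
  \int[leb]_t (ga c t * cos (x * t + a)) =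
  cos a * Num.sqrt (pi / c) * expR (- (x ^+ 2 / (4 * c))).
Proof.
move=> c0.
pose phi x := \int[leb]_t (ga c t * cos (x * t + a)).
have b1 t : 0 <= ga c t by rewrite ltW// ga_gt0.
have xb (t : R) : `|t| <= 1 + t ^+ 2.
  by rewrite ler_norml; have := sqr_ge0 (t - 1); have := sqr_ge0 (t + 1); nra.
have c1 (t : R) : `|cos t| <= 1 by rewrite ler_norml cos_geN1 cos_le1.
have s1 (t : R) : `|sin t| <= 1 by rewrite ler_norml sin_geN1 sin_le1.
have isin y : leb.-integrable setT (EFin \o (fun t => t * ga c t * sin (y * t + a))).
  apply: (@integrable_le_ga _ 1 1 c) => // [|t].
    apply: measurable_funM; last exact: measurable_sin_affine.
    by apply: measurable_funM => //; exact: measurable_ga.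
  rewrite expr1 mul1r !normrM (ger0_norm (b1 t)) -[leRHS]mulr1.
  by apply: ler_pM => //; rewrite ?mulr_ge0// ler_wpM2r.
have dphi y : is_derive y (1 : R) phi (- (y / (2 * c)) * phi y).
  have d1 : is_derive y (1 : R) phi (\int[leb]_t (- (t * ga c t * sin (y * t + a)))).
    pose f (y t : R) : R := ga c t * cos (y * t + a).
    pose G (t : R) : R := `|t| * ga c t.
    have d1f u t : is_derive u (1 : R) (f ^~ t) (- (t * ga c t * sin (u * t + a))).
      apply: (@is_derive_eq _ _ _ _ _ _ _ (0 * cos (u * t + a) + ga c t * (- sin (u * t + a) * t))); last by ring.
      apply: (@is_derive_mul _ (fun=> ga c t) (fun u => cos (u * t + a))).
      apply: (@is_derive_comp _ (@cos R) (fun u => u * t + a)).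
      under eq_fun do rewrite mulrC; exact: is_derive_affine.
    have p1 u t : partial1of2 f u t = - (t * ga c t * sin (u * t + a)).
      by rewrite partial1of2E; have := d1f u t => -[_ ->].
    have Iy : [set` `]y - 1, y + 1[ ] y by rewrite /= in_itv /=; lra.
    have H1 : forall u, [set` `]y - 1, y + 1[ ] u -> leb.-integrable setT (EFin \o f u).
      by move=> u _; exact: integrable_ga_cos.
    have H2 : forall u t, [set` `]y - 1, y + 1[ ] u -> setT t -> derivable (f ^~ t) u 1.
      by move=> u t _ _; have := d1f u t => -[].
    have G0 t : 0 <= G t by rewrite mulr_ge0.
    have iG : leb.-integrable setT (EFin \o G).
      apply: (@integrable_le_ga _ 1 1 c) => // [|t].
        by apply: measurable_funM; [exact: normr_measurable|exact: measurable_ga].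
      by rewrite expr1 mul1r (ger0_norm (G0 t)) ler_wpM2r.
    have H3 : forall u t, [set` `]y - 1, y + 1[ ] u -> setT t -> `|partial1of2 f u t| <= G t.
      move=> u t _ _; rewrite p1 normrN !normrM (ger0_norm (b1 t)) -[leRHS]mulr1.
      by rewrite ler_wpM2l// mulr_ge0.
    apply: DeriveDef.
      exact: (@derivable_under_integral R _ _ leb f setT measurableT y (y - 1) (y + 1) Iy H1 H2 G G0 iG H3).
    rewrite -derive1E (@differentiation_under_integral R _ _ leb f setT measurableT y (y - 1) (y + 1) Iy H1 H2 G G0 iG H3).
    by apply: eq_Rintegral => t _; rewrite p1.
  apply: (@is_derive_eq _ _ _ phi y 1 _ _ d1).
  have [C C0 CP] := ga_bound 1 c0.
  have CP' t : (1 + t ^+ 2) * ga c t <= C * wt t by have := CP t; rewrite expr1.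
  (* The derivative of [ga c t * sin (y t + a)] in [t] has integral 0, which reads
     [2 c phi' + y phi = 0]. *)
  have [|||_] := @Rintegral_derive0 _ (fun t => ga c t * sin (y * t + a))
    (fun t => 2 * c * (- (t * ga c t * sin (y * t + a))) + y * (ga c t * cos (y * t + a)))
    ((1 + 2 * c + `|y|) * C).
  - move=> t; apply: (@is_derive_eq _ _ _ _ _ _ _ (- (2 * c * t) * ga c t * sin (y * t + a) + ga c t * (cos (y * t + a) * y))); last by ring.
    apply: (@is_derive_mul _ (ga c) (fun t => sin (y * t + a))); first exact: is_derive_ga.
    by apply: (@is_derive_comp _ (@sin R) (fun t => y * t + a)); exact: is_derive_affine.
  - move=> t; rewrite normrM (ger0_norm (b1 t)).
    apply: (@le_trans _ _ (ga c t)); first by rewrite ler_piMr.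
    apply: (@le_trans _ _ ((1 + t ^+ 2) * ga c t)).
      by rewrite ler_peMl// lerDl sqr_ge0.
    apply: le_trans (CP' t) _; rewrite -mulrA ler_peMl ?mulr_ge0 ?(ltW C0) ?(ltW (wt_gt0 t))//.
    by rewrite -addrA lerDl addr_ge0// mulr_ge0// ltW.
  - move=> t; apply: le_trans (ler_normD _ _) _.
    rewrite !normrM normrN !normrM (ger0_norm (b1 t)) (ger0_norm (ltW c0)) ger0_norm//.
    apply: (@le_trans _ _ ((2 * c + `|y|) * ((1 + t ^+ 2) * ga c t))).
      rewrite [leRHS]mulrDl; apply: lerD.
        rewrite ler_wpM2l ?mulr_ge0 ?(ltW c0)//.
        by rewrite -[leRHS]mulr1; apply: ler_pM => //; rewrite ?mulr_ge0// ler_wpM2r.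
      rewrite ler_wpM2l// -[leRHS]mulr1; apply: ler_pM => //.
      by rewrite ler_peMl// lerDl sqr_ge0.
    rewrite -[leRHS]mulrA; apply: ler_pM => //.
    + by rewrite addr_ge0// mulr_ge0// ltW.
    + by rewrite mulr_ge0// addr_ge0// sqr_ge0.
    + by rewrite -addrA lerDr.
  rewrite RintegralD//; last 2 first.
  - by apply: integrable_scale; apply: integrable_opp.
  - by apply: integrable_scale; exact: integrable_ga_cos.
  rewrite !RintegralZl//; last 2 first.
  - exact: integrable_ga_cos.
  - exact: integrable_opp.
  rewrite -/(phi y) => /eqP; rewrite addr_eq0 => /eqP h.
  by apply: (@mulfI _ (2 * c)); rewrite ?gt_eqF ?mulr_gt0// h mulrA mulrN mulrCA divff ?mulr1 ?mulNr// gt_eqF// mulr_gt0.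
(* The integrating factor makes the product constant in [x], and at [x = 0] the integral is a plain
   Gaussian one. *)
suff : phi x * expR (x ^+ 2 / (4 * c)) = phi 0 * expR (0 ^+ 2 / (4 * c)).
  rewrite expr0n /= mul0r expR0 mulr1 /phi => h.
  apply: (@mulIf _ (expR (x ^+ 2 / (4 * c)))); first by rewrite gt_eqF// expR_gt0.
  rewrite h -[RHS]mulrA -expRD addNr expR0 mulr1.
  under eq_Rintegral do rewrite mul0r add0r mulrC.
  by rewrite RintegralZl//; [rewrite Rintegral_ga|exact: integrable_ga].
apply: (@is_derive_0_is_cst _ (fun x => phi x * expR (x ^+ 2 / (4 * c)))) => y.
have dE : is_derive y (1 : R) (fun y => expR (y ^+ 2 / (4 * c)))
    (expR (y ^+ 2 / (4 * c)) * (2 * (4 * c)^-1 * y)).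
  apply: (@is_derive_comp _ expR (fun y => y ^+ 2 / (4 * c))).
  by under eq_fun do rewrite mulrC; exact: is_derive_sqr.
have := is_derive_mul (dphi y) dE; set l := (X in is_derive _ _ _ X) => /is_derive_eq; apply; rewrite /l.
by field; rewrite gt_eqF.
Qed.

End Gauss1.

Lemma integral_EFin_Rintegral {R : realType} d {T : measurableType d}
    {m : {measure set T -> \bar R}} (f : T -> R) :
  m.-integrable setT (EFin \o f) -> (\int[m]_x (f x)%:E = (\int[m]_x f x)%:E)%E.
Proof. by move=> fi; rewrite /Rintegral fineK//; exact: integrable_fin_num. Qed.

Lemma integrable_ge0 {R : realType} d {T : measurableType d}
    {m : {measure set T -> \bar R}} (f : T -> R) : measurable_fun setT f ->
  (forall x, 0 <= f x) -> (\int[m]_x (f x)%:E < +oo)%E -> m.-integrable setT (EFin \o f).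
Proof.
move=> mf f0 foo; apply/integrableP; split; first exact/measurable_EFinP.
by under eq_integral => x _ do rewrite /= ger0_norm//.
Qed.

Section GaussN.
Context {R : realType}.
Local Notation leb := (@lebesgue_measure R).
Local Notation mu := (lebesgue_tuple R).

Lemma leb_EFin (f : R -> R) : leb.-integrable setT (EFin \o f) ->
  (\int[leb]_x (f x)%:E = (\int[leb]_x f x)%:E)%E.
Proof. exact: integral_EFin_Rintegral. Qed.

Lemma measurable_tnthR d (i : 'I_d) : measurable_fun [set: d.-tuple R] (fun t => tnth t i).
Proof. exact: measurable_tnth. Qed.

Lemma measurable_compR d (f : R -> R) (g : d.-tuple R -> R) :
  measurable_fun setT f -> measurable_fun setT g -> measurable_fun setT (fun t => f (g t)).
Proof. by move=> mf mg; exact: measurableT_comp mf mg. Qed.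

Lemma integrable_prod_tnth d (g : 'I_d -> R -> R) :
  (forall i, leb.-integrable setT (EFin \o g i)) -> (forall i x, 0 <= g i x) ->
  (mu d).-integrable setT (EFin \o (fun t => \prod_i g i (tnth t i))).
Proof.
move=> ig g0.
have mg i : measurable_fun setT (g i) by have := measurable_int _ (ig i) => /measurable_EFinP.
apply: integrable_ge0.
- exact: measurable_prod_tnth.
- by move=> t; exact: prodr_ge0.
- rewrite integral_prod_tnth//.
  rewrite (eq_bigr (fun i => (\int[leb]_x g i x)%:E)); last by move=> i _; exact: leb_EFin (ig i).
  by rewrite prodEFin ltry.
Qed.

Lemma Rintegral_prod_tnth d (g : 'I_d -> R -> R) :
  (forall i, leb.-integrable setT (EFin \o g i)) -> (forall i x, 0 <= g i x) ->
  \int[mu d]_t \prod_i g i (tnth t i) = \prod_i \int[leb]_x g i x.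
Proof.
move=> ig g0.
have mg i : measurable_fun setT (g i) by have := measurable_int _ (ig i) => /measurable_EFinP.
rewrite {1}/Rintegral integral_prod_tnth//.
rewrite (eq_bigr (fun i => (\int[leb]_x g i x)%:E)); last by move=> i _; exact: leb_EFin (ig i).
by rewrite prodEFin.
Qed.

(** A product of one-dimensional weights rather than a power of the Euclidean norm: it is integrable
    by Tonelli, and a bounded shift costs only the factor [3^d]. *)
Definition Wt d (t : d.-tuple R) : R := \prod_i wt (tnth t i).

Lemma Wt_gt0 d (t : d.-tuple R) : 0 < Wt t.
Proof. by apply: prodr_gt0 => i _; exact: wt_gt0. Qed.

Lemma Wt_le1 d (t : d.-tuple R) : Wt t <= 1.
Proof. by apply: prodr_ile1 => i _; rewrite (ltW (wt_gt0 _)) wt_le1. Qed.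

Lemma integrable_Wt d : (mu d).-integrable setT (EFin \o @Wt d).
Proof.
apply: (@integrable_prod_tnth d (fun=> wt)) => [i|i x]; first exact: integrable_wt.
exact/ltW/wt_gt0.
Qed.

Lemma integrable_le_Wt d (f : d.-tuple R -> R) (C : R) : measurable_fun setT f ->
  (forall t, `|f t| <= C * Wt t) -> (mu d).-integrable setT (EFin \o f).
Proof.
move=> mf fC; apply: (integrable_le mf fC).
exact/integrable_scale/integrable_Wt.
Qed.

Lemma Wt_shift d (v : 'I_d -> R) t : (forall i, `|v i| <= 1) ->
  Wt (tshift v t) <= 3 ^+ d * Wt t.
Proof.
move=> v1; rewrite -[d in 3 ^+ d]card_ord -prodr_const -big_split /=.
apply: ler_prod => i _; rewrite (ltW (wt_gt0 _)) tnth_mktuple.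
exact: wt_shift.
Qed.

(** A product, so that integrals factor over the coordinates; [gaussE] gives the radial form. *)
Definition gauss d (c : R) (m : 'I_d -> R) (t : d.-tuple R) : R :=
  \prod_i ga c (tnth t i - m i).

Definition gaussK (c : R) : R := Num.sqrt (pi / c).

Lemma gaussK_gt0 (c : R) : 0 < c -> 0 < gaussK c.
Proof. by move=> c0; rewrite sqrtr_gt0 divr_gt0// pi_gt0. Qed.

Lemma gauss_gt0 d (c : R) (m : 'I_d -> R) t : 0 < gauss c m t.
Proof. by apply: prodr_gt0 => i _; exact: ga_gt0. Qed.

Lemma gaussE d (c : R) (m : 'I_d -> R) (t : d.-tuple R) :
  gauss c m t = expR (- (c * \sum_i (tnth t i - m i) ^+ 2)).
Proof. by rewrite mulr_sumr -sumrN expR_sum. Qed.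

Lemma gauss_le1 d (c : R) (m : 'I_d -> R) t : 0 < c -> gauss c m t <= 1.
Proof.
move=> c0; rewrite gaussE -expR0 ler_expR oppr_le0 mulr_ge0 ?(ltW c0)//.
by apply: sumr_ge0 => i _; exact: sqr_ge0.
Qed.

Lemma measurable_gauss d (c : R) (m : 'I_d -> R) : measurable_fun setT (gauss c m).
Proof.
apply: (measurable_prod_tnth (g := fun i x => ga c (x - m i))) => i.
by apply: measurableT_comp; [exact: measurable_ga|exact: measurable_funB].
Qed.

Lemma integrable_ga_shift (c m : R) : 0 < c -> leb.-integrable setT (EFin \o (fun x => ga c (x - m))).
Proof.
move=> c0; apply: integrable_ge0.
- by apply: measurableT_comp; [exact: measurable_ga|exact: measurable_funB].
- by move=> x; exact/ltW/ga_gt0.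
- by rewrite integral_ga_center// ltry.
Qed.

Lemma integrable_gauss d (c : R) (m : 'I_d -> R) : 0 < c ->
  (mu d).-integrable setT (EFin \o gauss c m).
Proof.
move=> c0; apply: (@integrable_prod_tnth d (fun i x => ga c (x - m i))) => [i|i x].
  exact: integrable_ga_shift.
exact/ltW/ga_gt0.
Qed.

Lemma Rintegral_gauss d (c : R) (m : 'I_d -> R) : 0 < c ->
  \int[mu d]_t gauss c m t = gaussK c ^+ d.
Proof.
move=> c0; rewrite (@Rintegral_prod_tnth d (fun i x => ga c (x - m i))) => [||i x].
- under eq_bigr => i _ do rewrite /Rintegral integral_ga_center//=.
  by rewrite prodr_const card_ord.
- by move=> i; exact: integrable_ga_shift.
- exact/ltW/ga_gt0.
Qed.

(** The summand of index [i] is itself a product over the coordinates, with a second moment in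
    coordinate [i] and a plain Gaussian in each of the others; this is the family [g i]. *)
Lemma gauss_moment2 d (c : R) (m : 'I_d -> R) : 0 < c ->
  (mu d).-integrable setT (EFin \o (fun t => \sum_i (tnth t i - m i) ^+ 2 * gauss c m t)) /\
  \int[mu d]_t (\sum_i (tnth t i - m i) ^+ 2 * gauss c m t) = d%:R * gaussK c ^+ d / (2 * c).
Proof.
move=> c0.
pose g (i j : 'I_d) x := (if j == i then (x - m j) ^+ 2 else 1) * ga c (x - m j).
have i2 x : leb.-integrable setT (EFin \o (fun y => (y - x) ^+ 2 * ga c (y - x))).
  have mg : measurable_fun setT (fun y : R => y ^+ 2 * ga c y).
    by apply: measurable_funM; [exact: exprn_measurable|exact: measurable_ga].
  apply: integrable_ge0.
  - by apply: (measurableT_comp mg); exact: measurable_funB.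
  - by move=> y; rewrite mulr_ge0 ?sqr_ge0// ltW// ga_gt0.
  - rewrite (@ge0_integral_shift _ (- x) (fun y => (y ^+ 2 * ga c y)%:E)).
    + by have -> := leb_EFin (integrable_ga2 c0); rewrite ltry.
    + exact/measurable_EFinP.
    + by move=> y; rewrite lee_fin mulr_ge0 ?sqr_ge0// ltW// ga_gt0.
have gi i j : leb.-integrable setT (EFin \o g i j).
  rewrite /g; case: (j == i); first exact: i2.
  by under eq_fun do rewrite mul1r; exact: integrable_ga_shift.
have g0 i j x : 0 <= g i j x.
  by rewrite /g mulr_ge0 ?(ltW (ga_gt0 _ _))//; case: ifP => // _; exact: sqr_ge0.
have gE i t : (tnth t i - m i) ^+ 2 * gauss c m t = \prod_j g i j (tnth t j).
  rewrite /g big_split /=; congr (_ * _).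
  by rewrite (bigD1 i)//= eqxx big1 ?mulr1// => j /negPf ->.
have ggi i := integrable_prod_tnth (gi i) (g0 i).
have E : (fun t => \sum_i (tnth t i - m i) ^+ 2 * gauss c m t) =
         (fun t => \sum_i \prod_j g i j (tnth t j)).
  by apply/funext => t; apply: eq_bigr => i _.
rewrite E.
have sI : (mu d).-integrable setT (EFin \o (fun t => \sum_i \prod_j g i j (tnth t j))).
  rewrite (_ : _ \o _ = fun t => (\sum_i (\prod_j g i j (tnth t j))%:E)%E).
    by apply: integrable_sum => // i _; exact: ggi.
  by apply/funext => t /=; rewrite sumEFin.
split => //.
have -> : \int[mu d]_t (\sum_i \prod_j g i j (tnth t j)) =
    \sum_i \int[mu d]_t (\prod_j g i j (tnth t j)).
  rewrite {1}/Rintegral; under eq_integral => t _ do rewrite -sumEFin.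
  rewrite integral_sum//.
  rewrite (eq_bigr (fun i => (\int[mu d]_t (\prod_j g i j (tnth t j)))%:E)) ?sumEFin//.
  by move=> i _; exact: integral_EFin_Rintegral (ggi i).
transitivity (\sum_(i < d) (gaussK c ^+ d / (2 * c))); last first.
  by rewrite sumr_const card_ord -[LHS]mulr_natl mulrA.
apply: eq_bigr => i _; rewrite Rintegral_prod_tnth// (bigD1 i)//=.
have -> : \int[leb]_x g i i x = gaussK c / (2 * c).
  transitivity (\int[leb]_x (x ^+ 2 * ga c x)); last exact: Rintegral_ga2.
  rewrite /Rintegral.
  under eq_integral => y _ do rewrite /g eqxx.
  rewrite (@integral_shift _ (- m i) (fun y => (y ^+ 2 * ga c y)%:E))//.
  exact: integrable_ga2.
rewrite mulrAC; congr (_ / _).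
rewrite -[in RHS](card_ord d) -prodr_const [in RHS](bigD1 i)//=; congr (_ * _).
apply: eq_bigr => j /negPf ji.
rewrite /g ji; under eq_Rintegral do rewrite mul1r.
by rewrite /Rintegral integral_ga_center.
Qed.

Lemma integrable_gauss_cos d (c a : R) (x : 'I_d -> R) : 0 < c ->
  (mu d).-integrable setT (EFin \o (fun t => gauss c (fun=> 0) t * cos (\sum_i x i * tnth t i + a))).
Proof.
move=> c0; apply: (@integrable_le _ _ _ _ _ (gauss c (fun=> 0))).
- apply: measurable_funM; first exact: measurable_gauss.
  apply: (measurable_compR (f := @cos R)).
    by apply: continuous_measurable_fun; exact: continuous_cos.
  apply: measurable_funD => //; apply: measurable_sum => i.
  by apply: measurable_funM => //; exact: measurable_tnthR.
- move=> t; rewrite normrM ger0_norm ?(ltW (gauss_gt0 _ _ _))// ler_piMr ?(ltW (gauss_gt0 _ _ _))//.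
  by rewrite ler_norml cos_geN1 cos_le1.
- exact: integrable_gauss.
Qed.

Lemma gauss_cons n (c : R) (m : 'I_n.+1 -> R) y (t : n.-tuple R) :
  gauss c m (cons_pair (y, t)) = ga c (y - m ord0) * gauss c (m \o lift ord0) t.
Proof.
rewrite /gauss big_ord_recl tnth0; congr (_ * _).
by apply: eq_bigr => i _; rewrite tnthS.
Qed.

(* The phase a makes the formula stable under integration in one variable. *)
Lemma Rintegral_gauss_cos d (c a : R) (x : 'I_d -> R) : 0 < c ->
  \int[mu d]_t (gauss c (fun=> 0) t * cos (\sum_i x i * tnth t i + a)) =
  cos a * gaussK c ^+ d * expR (- ((\sum_i x i ^+ 2) / (4 * c))).
Proof.
move=> c0; elim: d x a => [|n IH] x a.
  rewrite /Rintegral /= integral_dirac//.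
    by rewrite diracT mul1e /gauss !big_ord0 mul0r oppr0 expR0 expr0 !mul1r !mulr1 add0r.
  by have := measurable_int _ (@integrable_gauss_cos 0 c a x c0).
rewrite {1}/Rintegral fubini_step2; last exact: integrable_gauss_cos.
have E t : (\int[leb]_y (gauss c (fun=> 0) (cons_pair (y, t)) *
    cos (\sum_i x i * tnth (cons_pair (y, t)) i + a))%:E)%E =
  (gaussK c * expR (- (x ord0 ^+ 2 / (4 * c))) *
  (gauss c (fun=> 0) t * cos (\sum_i (x \o lift ord0) i * tnth t i + a)))%:E.
  pose b := \sum_i (x \o lift ord0) i * tnth t i + a.
  have iF := integrable_ga_cos (x ord0) b c0.
  transitivity (\int[leb]_y (gauss c (fun=> 0) t * (ga c y * cos (x ord0 * y + b)))%:E)%E.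
    apply: eq_integral => y _; rewrite gauss_cons subr0 big_ord_recl tnth0; congr EFin.
    under eq_bigr => i _ do rewrite tnthS.
    by rewrite -[X in cos X]addrA -/b mulrAC mulrC.
  have -> := leb_EFin (integrable_scale (gauss c (fun=> 0) t) iF).
  have -> := RintegralZl (gauss c (fun=> 0) t) measurableT iF.
  rewrite Rintegral_ga_cos//; congr EFin; rewrite /gaussK /b.
  by move: (expR _) (gauss _ _ _) (cos _) (Num.sqrt _) => e g k s; ring.
under eq_integral => t _ do rewrite E.
have iG := integrable_gauss_cos a (x \o lift ord0) c0.
rewrite -/(Rintegral _ _ _) RintegralZl// IH.
have -> : expR (- ((\sum_i x i ^+ 2) / (4 * c))) = expR (- (x ord0 ^+ 2 / (4 * c))) *
    expR (- ((\sum_i (x \o lift ord0) i ^+ 2) / (4 * c))).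
  by rewrite -expRD -opprD -mulrDl big_ord_recl.
by move: (expR _) (expR _) (gaussK c) (cos a) => e e' k s; rewrite [k ^+ n.+1]exprS; ring.
Qed.

End GaussN.

Notation nrm := Normc.normc.

(** * Complex-valued integrals *)

Section ComplexFacts.
Context {R : realType}.
Implicit Types z w : R[i].

Lemma cReM z w : complex.Re (z * w) = complex.Re z * complex.Re w - complex.Im z * complex.Im w.
Proof. by case: z w => [a b] [c d]. Qed.

Lemma cImM z w : complex.Im (z * w) = complex.Re z * complex.Im w + complex.Im z * complex.Re w.
Proof. by case: z w => [a b] [c d]. Qed.

Lemma cReD z w : complex.Re (z + w) = complex.Re z + complex.Re w.
Proof. by case: z w => [a b] [c d]. Qed.

Lemma cImD z w : complex.Im (z + w) = complex.Im z + complex.Im w.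
Proof. by case: z w => [a b] [c d]. Qed.

Lemma nrm_ge0 z : 0 <= nrm z.
Proof. by case: z => a b; exact: sqrtr_ge0. Qed.

Lemma nrm_sqr z : nrm z ^+ 2 = complex.Re z ^+ 2 + complex.Im z ^+ 2.
Proof. by case: z => a b /=; rewrite sqr_sqrtr// addr_ge0// sqr_ge0. Qed.

Lemma nrm_Re z : `|complex.Re z| <= nrm z.
Proof.
by case: z => a b /=; rewrite -sqrtr_sqr ler_wsqrtr// lerDl sqr_ge0.
Qed.

Lemma nrm_Im z : `|complex.Im z| <= nrm z.
Proof.
by case: z => a b /=; rewrite -sqrtr_sqr ler_wsqrtr// lerDr sqr_ge0.
Qed.

Lemma nrm_le_ReIm z : nrm z <= `|complex.Re z| + `|complex.Im z|.
Proof.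
rewrite -(@ler_pXn2r _ 2)// ?nnegrE ?nrm_ge0 ?addr_ge0//.
rewrite nrm_sqr sqrrD !real_normK ?num_real// addrAC lerDl.
by rewrite mulrn_wge0// mulr_ge0.
Qed.

Lemma nrm_conj z : nrm (conjc z) = nrm z.
Proof. by case: z => a b /=; rewrite sqrrN. Qed.

Lemma nrm_real (a : R) : nrm (Complex a 0) = `|a|.
Proof. by rewrite /= expr0n addr0 sqrtr_sqr. Qed.

Lemma nrm_expi (a : R) : nrm (expi a) = 1.
Proof. by rewrite /= cos2Dsin2 sqrtr1. Qed.

Lemma expiD (a b : R) : expi (a + b) = expi a * expi b.
Proof. by rewrite /expi cosD sinD; congr Complex; rewrite addrC [cos a * _]mulrC. Qed.

Lemma conj_expi (a : R) : conjc (expi a) = expi (- a).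
Proof. by rewrite /expi cosN sinN. Qed.

Lemma mul_conj z : z * conjc z = Complex (nrm z ^+ 2) 0.
Proof.
rewrite nrm_sqr; case: z => a b /=; congr Complex; rewrite /=; ring.
Qed.

Lemma nrm_eq0 z : nrm z = 0 -> z = 0.
Proof. exact: Normc.eq0_normc. Qed.

End ComplexFacts.

Section ComplexIntegral.
Context {R : realType} d {T : measurableType d} (m : {measure set T -> \bar R}).
Implicit Types u v : T -> R[i].

Definition cint u : R[i] :=
  Complex (\int[m]_t complex.Re (u t)) (\int[m]_t complex.Im (u t)).

Definition cmeas u := measurable_fun setT (fun t => complex.Re (u t)) /\
  measurable_fun setT (fun t => complex.Im (u t)).

Definition cintegrable u := m.-integrable setT (EFin \o (fun t => complex.Re (u t))) /\
  m.-integrable setT (EFin \o (fun t => complex.Im (u t))).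

Lemma cmeas_nrm u : cmeas u -> measurable_fun setT (fun t => nrm (u t)).
Proof.
move=> [mr mi].
rewrite (_ : (fun t => _) = (fun t => Num.sqrt (complex.Re (u t) ^+ 2 + complex.Im (u t) ^+ 2))).
  apply: (measurableT_comp (f := @Num.sqrt R)).
    by apply: continuous_measurable_fun; exact: sqrt_continuous.
  by apply: measurable_funD; exact: measurable_funX.
by apply/funext => t; case: (u t).
Qed.

Lemma cmeas_mul u v : cmeas u -> cmeas v -> cmeas (fun t => u t * v t).
Proof.
move=> [ur ui] [vr vi]; split.
  under eq_fun do rewrite cReM.
  by apply: measurable_funB; exact: measurable_funM.
under eq_fun do rewrite cImM.
by apply: measurable_funD; exact: measurable_funM.
Qed.

Lemma cmeas_conj u : cmeas u -> cmeas (fun t => conjc (u t)).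
Proof.
move=> [ur ui]; split.
  by rewrite (_ : (fun t => _) = (fun t => complex.Re (u t)))//; apply/funext => t; case: (u t).
rewrite (_ : (fun t => _) = (fun t => - complex.Im (u t))); last by apply/funext => t; case: (u t).
exact: measurableT_comp.
Qed.

Lemma cmeas_real (f : T -> R) : measurable_fun setT f -> cmeas (fun t => Complex (f t) 0).
Proof. by move=> mf; split => //=; exact: measurable_cst. Qed.

Lemma cmeas_expi (f : T -> R) : measurable_fun setT f -> cmeas (fun t => expi (f t)).
Proof.
move=> mf; split => /=.
  apply: (measurableT_comp (f := @cos R)) => //.
  by apply: continuous_measurable_fun; exact: continuous_cos.
apply: (measurableT_comp (f := @sin R)) => //.
by apply: continuous_measurable_fun; exact: continuous_sin.
Qed.

Lemma cintegrable_meas u : cintegrable u -> cmeas u.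
Proof. by move=> [ur ui]; split; [have := measurable_int _ ur|have := measurable_int _ ui] => /measurable_EFinP. Qed.

Lemma cintegrableP u : cintegrable u <->
  cmeas u /\ m.-integrable setT (EFin \o (fun t => nrm (u t))).
Proof.
split=> [iu|[mu iu]].
  have mu := cintegrable_meas iu; split => //; case: iu => ur ui.
  apply: (@integrable_le _ _ _ _ _ (fun t => `|complex.Re (u t)| + `|complex.Im (u t)|)).
  - exact: cmeas_nrm.
  - by move=> t; rewrite ger0_norm ?nrm_ge0// nrm_le_ReIm.
  - by apply: integrable_add; exact: integrable_norm.
case: mu => mr mi; split.
  by apply: integrable_le iu => // t; exact: nrm_Re.
by apply: integrable_le iu => // t; exact: nrm_Im.
Qed.

Lemma cintegrable_le u (f : T -> R) : cmeas u -> (forall t, nrm (u t) <= f t) ->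
  m.-integrable setT (EFin \o f) -> cintegrable u.
Proof.
move=> mu uf fi; apply/cintegrableP; split => //.
apply: (integrable_le _ _ fi); first exact: cmeas_nrm.
by move=> t; rewrite ger0_norm ?nrm_ge0.
Qed.

Lemma eq_cint u v : u =1 v -> cint u = cint v.
Proof. by move=> uv; congr cint; apply/funext. Qed.

Lemma cintD u v : cintegrable u -> cintegrable v ->
  cint (fun t => u t + v t) = cint u + cint v.
Proof.
move=> [ur ui] [vr vi]; rewrite /cint; congr Complex.
  by under eq_Rintegral do rewrite cReD; rewrite RintegralD.
by under eq_Rintegral do rewrite cImD; rewrite RintegralD.
Qed.

Lemma complex_eqP (z w : R[i]) : complex.Re z = complex.Re w -> complex.Im z = complex.Im w -> z = w.
Proof. by case: z w => [a b] [c e] /= -> ->. Qed.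

Lemma cintZ (c : R[i]) u : cintegrable u -> cint (fun t => c * u t) = c * cint u.
Proof.
move=> [ur ui]; apply: complex_eqP.
  rewrite cReM /=; under eq_Rintegral do rewrite cReM.
  by rewrite RintegralB ?RintegralZl//; exact: integrable_scale.
rewrite cImM /=; under eq_Rintegral do rewrite cImM.
by rewrite RintegralD ?RintegralZl//; exact: integrable_scale.
Qed.

Lemma cint_conj u : cintegrable u -> cint (fun t => conjc (u t)) = conjc (cint u).
Proof.
move=> [ur ui]; apply: complex_eqP => /=.
  by apply: eq_Rintegral => t _; case: (u t).
transitivity (\int[m]_t (-1 * complex.Im (u t))).
  by apply: eq_Rintegral => t _; case: (u t) => a b /=; rewrite mulN1r.
by rewrite RintegralZl// mulN1r.
Qed.

Lemma cintegrable_scale (c : R[i]) u : cintegrable u -> cintegrable (fun t => c * u t).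
Proof.
move=> /cintegrableP[mu iu]; apply/cintegrableP; split.
  by apply: cmeas_mul => //; split => /=; exact: measurable_cst.
by under eq_fun do rewrite Normc.normcM; exact: integrable_scale.
Qed.

(* Rotate so that the integral becomes real, then only its real part matters. *)
Lemma nrm_cint_le u : cintegrable u -> nrm (cint u) <= \int[m]_t nrm (u t).
Proof.
move=> iu; have [_ inu] := (cintegrableP u).1 iu.
have [->|n0] := eqVneq (nrm (cint u)) 0.
  by apply: Rintegral_ge0 => t _; exact: nrm_ge0.
have npos : 0 < nrm (cint u) by rewrite lt_neqAle eq_sym n0 nrm_ge0.
rewrite -(ler_pM2l npos) -expr2.
have -> : nrm (cint u) ^+ 2 = complex.Re (conjc (cint u) * cint u).
  by rewrite mulrC mul_conj.
rewrite -(nrm_conj (cint u)); move: (conjc (cint u)) => c.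
rewrite -cintZ// /= -RintegralZl//.
have [iR _] := cintegrable_scale c iu.
apply: le_Rintegral => //; first exact: integrable_scale.
move=> t _; apply: le_trans (ler_norm _) _; apply: le_trans (nrm_Re _) _.
by rewrite Normc.normcM.
Qed.

Lemma cintegrable_bounded_mul u v (B : R) : cmeas v -> (forall t, nrm (v t) <= B) ->
  cintegrable u -> cintegrable (fun t => u t * v t).
Proof.
move=> mv vB /cintegrableP[mu iu].
apply: (@cintegrable_le _ (fun t => B * nrm (u t))).
- exact: cmeas_mul.
- by move=> t; rewrite Normc.normcM mulrC ler_wpM2r ?nrm_ge0.
- exact: integrable_scale.
Qed.

End ComplexIntegral.

Section ComplexFubini.
Context {R : realType} d1 d2 {T1 : measurableType d1} {T2 : measurableType d2}.
Context (m1 : {sigma_finite_measure set T1 -> \bar R}) (m2 : {sigma_finite_measure set T2 -> \bar R}).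

Lemma measurable_Rintegral_section (f : T1 * T2 -> R) : measurable_fun setT f ->
  measurable_fun setT (fun x => \int[m2]_y f (x, y)).
Proof.
move=> mf.
have mE : measurable_fun setT (EFin \o f) by exact/measurable_EFinP.
rewrite /Rintegral; apply: (measurableT_comp (f := fine)) => //.
rewrite (_ : (fun x => _) = (fun x => (\int[m2]_y (EFin \o f)^\+ (x, y) - \int[m2]_y (EFin \o f)^\- (x, y))%E)).
  apply: emeasurable_funB.
    apply: (@measurable_fun_fubini_tonelli_F _ _ _ _ _ m2 (EFin \o f)^\+%E) => //.
    exact: measurable_funepos.
  apply: (@measurable_fun_fubini_tonelli_F _ _ _ _ _ m2 (EFin \o f)^\-%E) => //.
  exact: measurable_funeneg.
apply/funext => x; rewrite integralE; congr (_ - _)%E.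
  by apply: eq_integral => y _; rewrite !funeposE.
by apply: eq_integral => y _; rewrite !funenegE.
Qed.

(** All sections, not only almost all, are assumed integrable, so that each inner integral is finite
    and passing from extended to real values loses nothing at any point. *)
Lemma Rfubini (f : T1 * T2 -> R) : (m1 \x m2)%E.-integrable setT (EFin \o f) ->
  (forall x, m2.-integrable setT (EFin \o (fun y => f (x, y)))) ->
  (forall y, m1.-integrable setT (EFin \o (fun x => f (x, y)))) ->
  \int[m1]_x \int[m2]_y f (x, y) = \int[m2]_y \int[m1]_x f (x, y).
Proof.
move=> fi f1 f2.
transitivity (fine (\int[m1]_x \int[m2]_y (f (x, y))%:E)%E).
  by congr fine; apply: eq_integral => x _; rewrite (integral_EFin_Rintegral (f1 x)).
have /= -> := Fubini fi.
by congr fine; apply: eq_integral => y _; rewrite -(integral_EFin_Rintegral (f2 y)).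
Qed.

Lemma integrable_prod2 (f : T1 -> R) (g : T2 -> R) :
  m1.-integrable setT (EFin \o f) -> m2.-integrable setT (EFin \o g) ->
  (m1 \x m2)%E.-integrable setT (EFin \o (fun z => f z.1 * g z.2)).
Proof.
move=> fi gi.
have mf := measurable_int _ fi; have mg := measurable_int _ gi.
have mfr : measurable_fun setT f by move/measurable_EFinP : mf.
have mgr : measurable_fun setT g by move/measurable_EFinP : mg.
have mfg : measurable_fun setT (fun z : T1 * T2 => f z.1 * g z.2).
  apply: measurable_funM.
    by apply: (measurableT_comp mfr); exact: measurable_fst.
  by apply: (measurableT_comp mgr); exact: measurable_snd.
apply/integrable12ltyP; first exact/measurable_EFinP.
have ig := integrable_norm gi.
pose G := \int[m2]_y `|g y|.
rewrite [X in (X < _)%E](_ : _ = (\int[m1]_x (G * `|f x|)%:E)%E); last first.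
  apply: eq_integral => x _ /=.
  rewrite mulrC -(RintegralZl `|f x| measurableT ig).
  rewrite -(integral_EFin_Rintegral (integrable_scale `|f x| ig)).
  by apply: eq_integral => y _; rewrite normrM.
have i2 := integrable_scale G (integrable_norm fi).
by rewrite (integral_EFin_Rintegral i2) ltry.
Qed.

(** The multiplication formula for a bounded kernel: [nrm (u x) * nrm (v y)] is an integrable
    majorant on the product. With [K] the Fourier kernel it moves the transform from [u] to [v]. *)
Lemma cint_transpose (u : T1 -> R[i]) (v : T2 -> R[i]) (K : T1 * T2 -> R[i]) :
  cintegrable m1 u -> cintegrable m2 v -> cmeas K -> (forall z, nrm (K z) <= 1) ->
  cint m2 (fun y => cint m1 (fun x => u x * K (x, y)) * v y) =
  cint m1 (fun x => u x * cint m2 (fun y => K (x, y) * v y)).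
Proof.
move=> iu iv mK K1.
have [mu inu] := (cintegrableP m1 u).1 iu; have [mv inv] := (cintegrableP m2 v).1 iv.
pose H z := u z.1 * K z * v z.2.
have mu' : cmeas (fun z : T1 * T2 => u z.1).
  by split; [apply: (measurableT_comp mu.1)|apply: (measurableT_comp mu.2)]; exact: measurable_fst.
have mv' : cmeas (fun z : T1 * T2 => v z.2).
  by split; [apply: (measurableT_comp mv.1)|apply: (measurableT_comp mv.2)]; exact: measurable_snd.
have mH : cmeas H by apply: cmeas_mul => //; exact: cmeas_mul.
have iH : cintegrable (m1 \x m2)%E H.
  apply: (cintegrable_le mH _ (integrable_prod2 inu inv)) => z.
  rewrite /H !Normc.normcM ler_wpM2r ?nrm_ge0//.
  by rewrite ler_piMr ?nrm_ge0.
have mK1 x : cmeas (fun y => K (x, y)).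
  by split; [apply: (measurableT_comp mK.1)|apply: (measurableT_comp mK.2)]; exact: measurable_pair1.
have mK2 y : cmeas (fun x => K (x, y)).
  by split; [apply: (measurableT_comp mK.1)|apply: (measurableT_comp mK.2)]; exact: measurable_pair2.
have i2 y : cintegrable m1 (fun x => u x * K (x, y)).
  exact: (@cintegrable_bounded_mul _ _ _ _ _ _ 1).
have i1 x : cintegrable m2 (fun y => K (x, y) * v y).
  under eq_fun do rewrite mulrC.
  exact: (@cintegrable_bounded_mul _ _ _ _ _ _ 1).
have H1 x : cintegrable m2 (fun y => H (x, y)).
  by rewrite /H /=; under eq_fun do rewrite -mulrA; exact: cintegrable_scale.
have H2 y : cintegrable m1 (fun x => H (x, y)).
  by rewrite /H /=; under eq_fun do rewrite mulrC; exact: cintegrable_scale.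
transitivity (cint m2 (fun y => cint m1 (fun x => H (x, y)))).
  apply: eq_cint => y; rewrite mulrC -cintZ//.
  by apply: eq_cint => x; rewrite mulrC.
transitivity (cint m1 (fun x => cint m2 (fun y => H (x, y)))); last first.
  apply: eq_cint => x; rewrite -cintZ//.
  by apply: eq_cint => y; rewrite mulrA.
rewrite /cint /=; congr Complex.
  apply/esym; apply: (Rfubini iH.1) => [x|y]; [exact: (H1 x).1|exact: (H2 y).1].
apply/esym; apply: (Rfubini iH.2) => [x|y]; [exact: (H1 x).2|exact: (H2 y).2].
Qed.

End ComplexFubini.

(** * Plancherel inequality and Fourier inversion *)

Section FourierTuple.
Context {R : realType} {d : nat}.
Local Notation mu := (lebesgue_tuple R d).
Local Notation T := (d.-tuple R).
Implicit Types (x y xi : T) (u v : T -> R[i]) (c : R).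

Definition dott x y : R := \sum_i tnth x i * tnth y i.

Definition fker (z : T * T) : R[i] := expi (- (2 * pi * dott z.1 z.2)).

Definition ft u xi : R[i] := cint mu (fun x => u x * fker (x, xi)).

Lemma dottC x y : dott x y = dott y x.
Proof. by apply: eq_bigr => i _; rewrite mulrC. Qed.

Lemma measurable_dott : measurable_fun setT (fun z : T * T => dott z.1 z.2).
Proof.
apply: measurable_sum => i; apply: measurable_funM.
  by apply: (measurableT_comp (measurable_tnthR i)); exact: measurable_fst.
by apply: (measurableT_comp (measurable_tnthR i)); exact: measurable_snd.
Qed.

Lemma cmeas_fker : cmeas fker.
Proof.
apply: cmeas_expi; apply: measurableT_comp => //.
by apply: measurable_funM => //; exact: measurable_dott.
Qed.

Lemma cmeas_fker1 xi : cmeas (fun x => fker (x, xi)).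
Proof.
have [m1 m2] := cmeas_fker.
by split; [apply: (measurableT_comp m1)|apply: (measurableT_comp m2)]; exact: measurable_pair2.
Qed.

Lemma nrm_fker z : nrm (fker z) = 1. Proof. exact: nrm_expi. Qed.

Lemma cintegrable_fker u xi : cintegrable mu u -> cintegrable mu (fun x => u x * fker (x, xi)).
Proof.
move=> iu; apply: (@cintegrable_bounded_mul _ _ _ _ _ _ 1) => //; first exact: cmeas_fker1.
by move=> x; rewrite nrm_fker.
Qed.

Lemma cmeas_ft u : cmeas u -> cmeas (ft u).
Proof.
move=> mu'.
have mH : cmeas (fun z : T * T => u z.2 * fker (z.2, z.1)).
  apply: cmeas_mul.
    by split; [apply: (measurableT_comp mu'.1)|apply: (measurableT_comp mu'.2)]; exact: measurable_snd.
  have [m1 m2] := cmeas_fker; have ms : measurable_fun setT (fun z : T * T => (z.2, z.1)).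
    by apply: measurable_fun_pair; [exact: measurable_snd|exact: measurable_fst].
  by split; [apply: (measurableT_comp m1)|apply: (measurableT_comp m2)].
have h1 := @measurable_Rintegral_section _ _ _ _ _ mu _ mH.1.
have h2 := @measurable_Rintegral_section _ _ _ _ _ mu _ mH.2.
by split; [exact: h1|exact: h2].
Qed.

Lemma nrm_ft_le u xi : cintegrable mu u -> nrm (ft u xi) <= \int[mu]_x nrm (u x).
Proof.
move=> iu; apply: le_trans (nrm_cint_le (cintegrable_fker xi iu)) _.
by under eq_Rintegral do rewrite Normc.normcM nrm_fker mulr1.
Qed.

Lemma cint_gauss_expi c (th : 'I_d -> R) : 0 < c ->
  cint mu (fun xi => Complex (gauss c (fun=> 0) xi) 0 * expi (\sum_i th i * tnth xi i)) =
  Complex (gaussK c ^+ d * expR (- ((\sum_i th i ^+ 2) / (4 * c)))) 0.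
Proof.
move=> c0; apply: complex_eqP => /=.
  under eq_Rintegral do rewrite mul0r subr0 -[X in cos X]addr0.
  by rewrite Rintegral_gauss_cos// cos0 mul1r.
(* The imaginary part is the cosine integral with phase [- pi / 2], and [cos (- pi / 2) = 0]. *)
under eq_Rintegral do rewrite mul0r addr0 -cosBpihalf.
rewrite Rintegral_gauss_cos//.
by rewrite cosN cos_pihalf !mul0r.
Qed.

Lemma expR_gaussE c (m : 'I_d -> R) y : 0 < c ->
  expR (- ((\sum_i (2 * pi * (m i - tnth y i)) ^+ 2) / (4 * c))) = gauss (pi ^+ 2 / c) m y.
Proof.
move=> c0; rewrite gaussE; congr (expR (- _)).
rewrite mulr_suml mulr_sumr; apply: eq_bigr => i _.
by move: (pi) (m i) (tnth y i) => p a b; field; rewrite gt_eqF.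
Qed.

(** The heat kernel at a time proportional to [c]: the Fourier integral of the Gaussian cut-off
    [gauss c], centred at [x]. It has mass 1 and concentrates at [x] as [c] tends to 0. *)
Definition heat c (x y : T) : R := gaussK c ^+ d * gauss (pi ^+ 2 / c) (tnth x) y.

Lemma cintegrable_gauss_expi c (f : T -> R) : 0 < c -> measurable_fun setT f ->
  cintegrable mu (fun xi => Complex (gauss c (fun=> 0) xi) 0 * expi (f xi)).
Proof.
move=> c0 mf; apply: (cintegrable_le _ _ (integrable_gauss (fun=> 0) c0)).
  by apply: cmeas_mul; [apply: cmeas_real; exact: measurable_gauss|exact: cmeas_expi].
move=> xi; rewrite Normc.normcM nrm_expi mulr1 nrm_real ger0_norm//.
exact/ltW/gauss_gt0.
Qed.

Lemma measurable_dott2 x : measurable_fun setT (fun xi => 2 * pi * dott x xi).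
Proof.
apply: measurable_funM => //.
exact: (measurableT_comp measurable_dott (measurable_pair1 x)).
Qed.

(* Gaussian summation of the inverse Fourier integral is convolution with the heat kernel. *)
Lemma ft_gauss_mean u x c : 0 < c -> cintegrable mu u ->
  cint mu (fun xi => ft u xi * (Complex (gauss c (fun=> 0) xi) 0 * expi (2 * pi * dott x xi))) =
  cint mu (fun y => u y * Complex (heat c x y) 0).
Proof.
move=> c0 iu.
have iv := cintegrable_gauss_expi c0 (measurable_dott2 x).
have fker1 (z : T * T) : nrm (fker z) <= 1 by rewrite nrm_fker.
rewrite (cint_transpose iu iv cmeas_fker fker1).
apply: eq_cint => y; congr (_ * _).
under eq_cint => xi.
  rewrite mulrCA /fker -expiD.
  have -> : - (2 * pi * dott (y, xi).1 (y, xi).2) + 2 * pi * dott x xi =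
    \sum_i (2 * pi * (tnth x i - tnth y i)) * tnth xi i.
    rewrite /dott /= !mulr_sumr -sumrN -big_split /=; apply: eq_bigr => i _; ring.
  over.
by rewrite cint_gauss_expi// expR_gaussE.
Qed.

Lemma heat_ge0 c x y : 0 < c -> 0 <= heat c x y.
Proof. by move=> c0; rewrite mulr_ge0 ?(ltW (gauss_gt0 _ _ _))// exprn_ge0// ltW// gaussK_gt0. Qed.

Lemma heatC c x y : heat c x y = heat c y x.
Proof.
rewrite /heat !gaussE; congr (_ * expR (- (_ * _))).
by apply: eq_bigr => i _; rewrite -sqrrN opprB.
Qed.

Lemma pi2c_gt0 c : 0 < c -> 0 < (pi : R) ^+ 2 / c.
Proof. by move=> c0; rewrite divr_gt0// exprn_gt0// pi_gt0. Qed.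

Lemma gaussKM c : 0 < c -> gaussK c * gaussK (pi ^+ 2 / c) = 1.
Proof.
move=> c0; rewrite /gaussK -sqrtrM; last by rewrite ltW// divr_gt0// pi_gt0.
rewrite -[RHS]sqrtr1; congr Num.sqrt; have := pi_gt0 R; move: (pi) => p p0.
by field; rewrite !gt_eqF.
Qed.

Lemma measurable_heat c x : measurable_fun setT (heat c x).
Proof. by apply: measurable_funM => //; exact: measurable_gauss. Qed.

Lemma integrable_heat c x : 0 < c -> mu.-integrable setT (EFin \o heat c x).
Proof. by move=> c0; apply: integrable_scale; apply: integrable_gauss; exact: pi2c_gt0. Qed.

Lemma Rintegral_heat c x : 0 < c -> \int[mu]_y heat c x y = 1.
Proof.
move=> c0; have ig := integrable_gauss (tnth x) (pi2c_gt0 c0).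
rewrite RintegralZl// Rintegral_gauss; last exact: pi2c_gt0.
by rewrite -exprMn gaussKM// expr1n.
Qed.

Lemma integral_heat c x : 0 < c -> (\int[mu]_y (heat c x y)%:E = 1)%E.
Proof. by move=> c0; rewrite (integral_EFin_Rintegral (integrable_heat x c0)) Rintegral_heat. Qed.

Lemma heat_moment2 c x : 0 < c ->
  mu.-integrable setT (EFin \o (fun y => \sum_i (tnth y i - tnth x i) ^+ 2 * heat c x y)) /\
  \int[mu]_y (\sum_i (tnth y i - tnth x i) ^+ 2 * heat c x y) = d%:R * c / (2 * pi ^+ 2).
Proof.
move=> c0; have [im em] := gauss_moment2 (tnth x) (pi2c_gt0 c0).
have E : (fun y => \sum_i (tnth y i - tnth x i) ^+ 2 * heat c x y) =
   (fun y => gaussK c ^+ d * \sum_i (tnth y i - tnth x i) ^+ 2 * gauss (pi ^+ 2 / c) (tnth x) y).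
  by apply/funext => y; rewrite mulr_sumr; apply: eq_bigr => i _; rewrite mulrCA.
rewrite E; split; first exact: integrable_scale.
rewrite RintegralZl// em.
have -> : gaussK c ^+ d * (d%:R * gaussK (pi ^+ 2 / c) ^+ d / (2 * (pi ^+ 2 / c))) =
  (gaussK c ^+ d * gaussK (pi ^+ 2 / c) ^+ d) * (d%:R / (2 * (pi ^+ 2 / c))) by ring.
rewrite -exprMn gaussKM// expr1n mul1r; have := pi_gt0 R; move: (pi) => p p0.
by field; rewrite !gt_eqF.
Qed.

Lemma measurable_heat2 c : measurable_fun setT (fun z : T * T => heat c z.1 z.2).
Proof.
apply: measurable_funM => //.
under eq_fun do rewrite gaussE.
apply: (measurableT_comp (f := @expR R)) => //.
apply: measurableT_comp => //; apply: measurable_funM => //.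
apply: measurable_sum => i; apply: measurable_funX; apply: measurable_funB.
  by apply: (measurableT_comp (measurable_tnthR i)); exact: measurable_snd.
by apply: (measurableT_comp (measurable_tnthR i)); exact: measurable_fst.
Qed.

End FourierTuple.

Lemma ge0_integral_scale {R : realType} d {T : measurableType d}
    {m : {measure set T -> \bar R}} (k : R) (f : T -> R) : measurable_fun setT f ->
  0 <= k -> (forall x, 0 <= f x) ->
  (\int[m]_x (k * f x)%:E = k%:E * \int[m]_x (f x)%:E)%E.
Proof.
move=> mf k0 f0; under eq_integral => x _ do rewrite EFinM.
by apply: ge0_integralZl => //; [exact/measurable_EFinP|move=> x _; rewrite lee_fin].
Qed.

Lemma cint_real {R : realType} d {T : measurableType d}
    {m : {measure set T -> \bar R}} (f : T -> R) :
  cint m (fun x => Complex (f x) 0) = Complex (\int[m]_x f x) 0.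
Proof. by rewrite /cint /=; congr Complex; rewrite /Rintegral integral0. Qed.

Lemma conjM {R : realType} (z w : R[i]) : conjc (z * w) = conjc z * conjc w.
Proof. exact: rmorphM. Qed.

Lemma conj_real {R : realType} (a : R) : conjc (Complex a 0) = Complex a 0.
Proof. by rewrite /= oppr0. Qed.

Section Plancherel.
Context {R : realType} {d : nat}.
Local Notation mu := (lebesgue_tuple R d).
Local Notation T := (d.-tuple R).
Implicit Types (x y xi : T) (u v : T -> R[i]) (c : R).

Lemma heat_le c x y : 0 < c -> heat c x y <= gaussK c ^+ d.
Proof.
move=> c0; rewrite /heat ler_piMr//; first by rewrite exprn_ge0// ltW// gaussK_gt0.
by apply: gauss_le1; exact: pi2c_gt0.
Qed.

Lemma cmeas_gauss_expi c (f : T -> R) : measurable_fun setT f ->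
  cmeas (fun xi => Complex (gauss c (fun=> 0) xi) 0 * expi (f xi)).
Proof.
move=> mf; apply: cmeas_mul; last exact: cmeas_expi.
by apply: cmeas_real; exact: measurable_gauss.
Qed.

(** Schur's test: [a b <= (a^2 + b^2) / 2] under the integral, and the kernel is symmetric with mass
    1 in each variable, so both halves give half of the right-hand side. *)
Lemma integral_heat_young u c : 0 < c -> cmeas u ->
  (\int[mu]_x \int[mu]_y (nrm (u x) * (nrm (u y) * heat c x y))%:E <=
   \int[mu]_x (nrm (u x) ^+ 2)%:E)%E.
Proof.
move=> c0 mu'; have mn := cmeas_nrm mu'.
have mn1 : measurable_fun setT (fun z : T * T => nrm (u z.1)).
  by apply: (measurableT_comp mn); exact: measurable_fst.
have mn2 : measurable_fun setT (fun z : T * T => nrm (u z.2)).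
  by apply: (measurableT_comp mn); exact: measurable_snd.
have mh := @measurable_heat2 R d c.
pose F (z : T * T) := 2^-1 * nrm (u z.1) ^+ 2 * heat c z.1 z.2.
pose G (z : T * T) := 2^-1 * nrm (u z.2) ^+ 2 * heat c z.1 z.2.
have mF : measurable_fun setT F.
  by apply: measurable_funM => //; apply: measurable_funM => //; exact: measurable_funX.
have mG : measurable_fun setT G.
  by apply: measurable_funM => //; apply: measurable_funM => //; exact: measurable_funX.
have F0 z : 0 <= F z by rewrite /F mulr_ge0 ?heat_ge0// mulr_ge0 ?sqr_ge0// invr_ge0.
have G0 z : 0 <= G z by rewrite /G mulr_ge0 ?heat_ge0// mulr_ge0 ?sqr_ge0// invr_ge0.
have mEF : measurable_fun setT (EFin \o F) by exact/measurable_EFinP.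
have mEG : measurable_fun setT (EFin \o G) by exact/measurable_EFinP.
have m1 x : measurable_fun setT (fun y => (F (x, y))%:E).
  by apply: (measurableT_comp mEF); exact: measurable_pair1.
have m2 x : measurable_fun setT (fun y => (G (x, y))%:E).
  by apply: (measurableT_comp mEG); exact: measurable_pair1.
have mh1 x : measurable_fun setT (fun y => (heat c x y)%:E).
  by apply/measurable_EFinP; exact: measurable_heat.
have half : (\int[mu]_x (2^-1 * nrm (u x) ^+ 2)%:E = 2^-1%:E * \int[mu]_x (nrm (u x) ^+ 2)%:E)%E.
  by apply: ge0_integral_scale; [exact: measurable_funX|rewrite invr_ge0|move=> x; exact: sqr_ge0].
have inner (k : R) x : 0 <= k -> (\int[mu]_y (k * heat c x y)%:E = k%:E)%E.
  move=> k0; rewrite ge0_integral_scale ?integral_heat ?mule1//; first exact: measurable_heat.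
  by move=> y; exact: heat_ge0.
have k0 x : 0 <= 2^-1 * nrm (u x) ^+ 2 by rewrite mulr_ge0 ?sqr_ge0// invr_ge0.
have EF : (\int[mu]_x \int[mu]_y (F (x, y))%:E = 2^-1%:E * \int[mu]_x (nrm (u x) ^+ 2)%:E)%E.
  by rewrite -half; apply: eq_integral => x _; exact: (inner _ x (k0 x)).
have EG : (\int[mu]_x \int[mu]_y (G (x, y))%:E = 2^-1%:E * \int[mu]_x (nrm (u x) ^+ 2)%:E)%E.
  have -> := @fubini_tonelli _ _ _ _ _ mu mu (EFin \o G) mEG (fun z => G0 z).
  rewrite -half; apply: eq_integral => x _.
  under eq_integral => y _ do rewrite /= /G /= heatC.
  exact: (inner _ x (k0 x)).
have S : (\int[mu]_x (\int[mu]_y (F (x, y))%:E + \int[mu]_y (G (x, y))%:E) =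
   \int[mu]_x (nrm (u x) ^+ 2)%:E)%E.
  rewrite ge0_integralD//; first last.
  - exact: (@measurable_fun_fubini_tonelli_F _ _ _ _ _ mu (EFin \o G) mEG (fun z => G0 z)).
  - by move=> x _; apply: integral_ge0 => y _; rewrite lee_fin.
  - exact: (@measurable_fun_fubini_tonelli_F _ _ _ _ _ mu (EFin \o F) mEF (fun z => F0 z)).
  - by move=> x _; apply: integral_ge0 => y _; rewrite lee_fin.
  rewrite EF EG -ge0_muleDl ?lee_fin ?invr_ge0// -EFinD.
  have -> : 2^-1 + 2^-1 = 1 :> R by field.
  by rewrite mul1e.
rewrite -S; apply: ge0_le_integral => //.
- by move=> x _; apply: integral_ge0 => y _; rewrite lee_fin mulr_ge0 ?nrm_ge0// mulr_ge0 ?nrm_ge0// heat_ge0.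
- apply: (@measurable_fun_fubini_tonelli_F _ _ _ _ _ mu (fun z => (nrm (u z.1) * (nrm (u z.2) * heat c z.1 z.2))%:E)).
    by apply/measurable_EFinP; apply: measurable_funM => //; exact: measurable_funM.
  by move=> z; rewrite lee_fin mulr_ge0 ?nrm_ge0// mulr_ge0 ?nrm_ge0// heat_ge0.
- apply: emeasurable_funD.
    exact: (@measurable_fun_fubini_tonelli_F _ _ _ _ _ mu (EFin \o F) mEF (fun z => F0 z)).
  exact: (@measurable_fun_fubini_tonelli_F _ _ _ _ _ mu (EFin \o G) mEG (fun z => G0 z)).
move=> x _; rewrite -ge0_integralD//; first last.
- by move=> y _; rewrite lee_fin.
- by move=> y _; rewrite lee_fin.
apply: ge0_le_integral => //.
- by move=> y _; rewrite lee_fin mulr_ge0 ?nrm_ge0// mulr_ge0 ?nrm_ge0// heat_ge0.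
- apply/measurable_EFinP; apply: measurable_funM => //; apply: measurable_funM => //.
  exact: measurable_heat.
- exact: emeasurable_funD.
move=> y _; rewrite -EFinD lee_fin /F /G /=.
have := heat_ge0 x y c0; have := sqr_ge0 (nrm (u x) - nrm (u y)).
move: (heat c x y) (nrm (u x)) (nrm (u y)) => h a b ab h0.
have := mulr_ge0 ab h0; nra.
Qed.

(** Moving the transform from [u] to [v = conj (ft u) * gauss c] turns the left-hand side into the
    pairing of [u] with the conjugate of its heat average [M], which Schur's test bounds. The
    Gaussian factor makes every integral in this exchange absolutely convergent. *)
Lemma ft_gauss_sqr_le u c : 0 < c -> cintegrable mu u ->
  mu.-integrable setT (EFin \o (fun x => nrm (u x) ^+ 2)) ->
  (\int[mu]_xi (nrm (ft u xi) ^+ 2 * gauss c (fun=> 0) xi)%:E <= \int[mu]_x (nrm (u x) ^+ 2)%:E)%E.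
Proof.
move=> c0 iu iu2.
have [mu' inu] := (cintegrableP mu u).1 iu.
have mft := cmeas_ft mu'.
pose B := \int[mu]_x nrm (u x).
have ftB xi : nrm (ft u xi) <= B by exact: nrm_ft_le.
pose g xi := gauss c (fun=> 0) xi : R.
pose v xi := conjc (ft u xi) * Complex (g xi) 0.
have mg : cmeas (fun xi => Complex (g xi) 0).
  by apply: cmeas_real; exact: measurable_gauss.
have ig : cintegrable mu (fun xi => Complex (g xi) 0).
  apply: (cintegrable_le mg _ (integrable_gauss (fun=> 0) c0)) => xi.
  by rewrite nrm_real ger0_norm// ltW// gauss_gt0.
have iv : cintegrable mu v.
  rewrite /v; under eq_fun do rewrite mulrC.
  apply: (@cintegrable_bounded_mul _ _ _ _ _ _ B) => //; first exact: cmeas_conj.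
  by move=> xi; rewrite nrm_conj.
have fker1 (z : T * T) : nrm (fker z) <= 1 by rewrite nrm_fker.
have iN : mu.-integrable setT (EFin \o (fun xi => nrm (ft u xi) ^+ 2 * g xi)).
  apply: (@integrable_le _ _ _ _ _ (fun xi => B ^+ 2 * g xi)).
  - by apply: measurable_funM; [apply: measurable_funX; exact: cmeas_nrm|exact: measurable_gauss].
  - move=> xi; rewrite ger0_norm; last by rewrite mulr_ge0 ?sqr_ge0// ltW// gauss_gt0.
    rewrite ler_wpM2r ?(ltW (gauss_gt0 _ _ _))// lerXn2r ?nnegrE ?nrm_ge0//.
    by apply: Rintegral_ge0 => x _; exact: nrm_ge0.
  - by apply: integrable_scale; exact: integrable_gauss.
pose M x := cint mu (fun y => u y * Complex (heat c x y) 0).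
have E : Complex (\int[mu]_xi (nrm (ft u xi) ^+ 2 * g xi)) 0 =
    cint mu (fun x => u x * conjc (M x)).
  transitivity (cint mu (fun xi => ft u xi * v xi)).
    rewrite -cint_real; apply: eq_cint => xi; rewrite /v mulrA mul_conj.
    by apply: complex_eqP; rewrite ?cReM ?cImM /=; ring.
  rewrite (cint_transpose iu iv cmeas_fker fker1).
  apply: eq_cint => x; congr (_ * _).
  rewrite /M -ft_gauss_mean// -cint_conj; last first.
    under eq_fun do rewrite mulrC.
    apply: (@cintegrable_bounded_mul _ _ _ _ _ _ B) => //.
    exact: cintegrable_gauss_expi c0 (measurable_dott2 x).
  apply: eq_cint => xi; by rewrite /v !conjM conj_real conj_expi mulrC -[LHS]mulrA.
have hint x : cintegrable mu (fun y => u y * Complex (heat c x y) 0).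
  apply: (@cintegrable_bounded_mul _ _ _ _ _ _ (gaussK c ^+ d)) => //.
    by apply: cmeas_real; exact: measurable_heat.
  move=> y; rewrite nrm_real ger0_norm ?heat_ge0//.
  exact: heat_le.
have Mle x : nrm (M x) <= \int[mu]_y (nrm (u y) * heat c x y).
  apply: le_trans (nrm_cint_le (hint x)) _; rewrite le_eqVlt; apply/orP; left; apply/eqP.
  apply: eq_Rintegral => y _; rewrite Normc.normcM nrm_real ger0_norm//.
  exact: heat_ge0.
have hint' x : mu.-integrable setT (EFin \o (fun y => nrm (u y) * heat c x y)).
  have [_] := (cintegrableP mu _).1 (hint x).
  by under eq_fun do rewrite Normc.normcM nrm_real ger0_norm ?heat_ge0//.
apply: le_trans (integral_heat_young c0 mu').
rewrite (integral_EFin_Rintegral iN).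
have -> : \int[mu]_x (nrm (ft u x) ^+ 2 * gauss c (fun=> 0) x) =
   nrm (cint mu (fun x => u x * conjc (M x))).
  rewrite -E nrm_real ger0_norm//; apply: Rintegral_ge0 => xi _.
  by rewrite mulr_ge0 ?sqr_ge0// ltW// gauss_gt0.
have mM : cmeas M.
  have mH : cmeas (fun z : T * T => u z.2 * Complex (heat c z.1 z.2) 0).
    apply: cmeas_mul; last by apply: cmeas_real; exact: measurable_heat2.
    by split; [apply: (measurableT_comp mu'.1)|apply: (measurableT_comp mu'.2)]; exact: measurable_snd.
  have h1 := @measurable_Rintegral_section _ _ _ _ _ mu _ mH.1.
  have h2 := @measurable_Rintegral_section _ _ _ _ _ mu _ mH.2.
  by split; [exact: h1|exact: h2].
have mI : measurable_fun setT (fun x => \int[mu]_y (nrm (u y) * heat c x y)).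
  apply: (@measurable_Rintegral_section _ _ _ _ _ mu (fun z => nrm (u z.2) * heat c z.1 z.2)).
  apply: measurable_funM; last exact: measurable_heat2.
  by apply: (measurableT_comp (cmeas_nrm mu')); exact: measurable_snd.
have MB x : nrm (M x) <= gaussK c ^+ d * B.
  apply: le_trans (Mle x) _; rewrite -RintegralZl//.
  apply: le_Rintegral => //; first exact: integrable_scale.
  move=> y _; rewrite mulrC ler_wpM2r ?nrm_ge0//.
  exact: heat_le.
have iuM : cintegrable mu (fun x => u x * conjc (M x)).
  apply: (@cintegrable_bounded_mul _ _ _ _ _ _ (gaussK c ^+ d * B)) => //.
    exact: cmeas_conj.
  by move=> x; rewrite nrm_conj.
apply: (@le_trans _ _ (\int[mu]_x nrm (u x * conjc (M x)))%:E).
  by rewrite lee_fin nrm_cint_le.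
have [_ iuM'] := (cintegrableP mu _).1 iuM.
rewrite -(integral_EFin_Rintegral iuM').
apply: ge0_le_integral => //.
- by move=> x _; rewrite lee_fin nrm_ge0.
- by have := measurable_int _ iuM'.
- apply: (@measurable_fun_fubini_tonelli_F _ _ _ _ _ mu (fun z => (nrm (u z.1) * (nrm (u z.2) * heat c z.1 z.2))%:E)).
    apply/measurable_EFinP; apply: measurable_funM.
      by apply: (measurableT_comp (cmeas_nrm mu')); exact: measurable_fst.
    apply: measurable_funM; last exact: measurable_heat2.
    by apply: (measurableT_comp (cmeas_nrm mu')); exact: measurable_snd.
  by move=> z; rewrite lee_fin mulr_ge0 ?nrm_ge0// mulr_ge0 ?nrm_ge0// heat_ge0.
move=> x _; rewrite (integral_EFin_Rintegral (integrable_scale (nrm (u x)) (hint' x))).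
rewrite RintegralZl// lee_fin Normc.normcM nrm_conj.
by rewrite ler_wpM2l ?nrm_ge0.
Qed.

End Plancherel.

Section Inversion.
Context {R : realType} {d : nat}.
Local Notation mu := (lebesgue_tuple R d).
Local Notation T := (d.-tuple R).
Implicit Types (x y xi : T) (u v : T -> R[i]) (c : R).

Lemma cvg_gauss_harmonic xi : gauss (harmonic n : R) (fun=> 0) xi @[n --> \oo] --> (1 : R).
Proof.
under eq_fun do rewrite gaussE; rewrite -(@expR0 R).
pose q := \sum_i (tnth xi i - 0) ^+ 2.
apply: (@continuous_cvg _ _ _ _ _ (fun n => - (harmonic n * q)) (@expR R)).
  exact: continuous_expR.
rewrite -oppr0; apply: cvgN; rewrite -[X in _ --> X](mul0r q).
by apply: cvgM; [exact: cvg_harmonic|exact: cvg_cst].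
Qed.

Lemma harmonic_pos n : 0 < (harmonic n : R).
Proof. by rewrite /harmonic /= invr_gt0. Qed.

(** The Gaussian cut-offs with parameter [1 / (n + 1)] increase to 1, so the damped inequality
    passes to the limit by monotone convergence, without knowing in advance that the transform is
    square integrable. *)
Lemma plancherel_le u : cintegrable mu u ->
  mu.-integrable setT (EFin \o (fun x => nrm (u x) ^+ 2)) ->
  (\int[mu]_xi (nrm (ft u xi) ^+ 2)%:E <= \int[mu]_x (nrm (u x) ^+ 2)%:E)%E.
Proof.
move=> iu iu2; have [mu' _] := (cintegrableP mu u).1 iu.
have mft := cmeas_nrm (cmeas_ft mu').
pose g n xi := (nrm (ft u xi) ^+ 2 * gauss (harmonic n : R) (fun=> 0) xi)%:E.
have gl xi : limn (g ^~ xi) = (nrm (ft u xi) ^+ 2)%:E.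
  apply/cvg_lim => //; rewrite /g -[X in _ --> X%:E]mulr1.
  apply: cvg_EFin; first exact: nearW.
  by apply: cvgM; [exact: cvg_cst|exact: cvg_gauss_harmonic].
have := @cvg_monotone_convergence _ _ _ mu setT measurableT g.
under eq_integral => xi _ do rewrite gl.
move=> h.
have {}h : (\int[mu]_(x in setT) g n x)%E @[n \oo] --> (\int[mu]_xi (nrm (ft u xi) ^+ 2)%:E)%E.
  apply: h.
  - by move=> n; apply/measurable_EFinP; apply: measurable_funM; [exact: measurable_funX|exact: measurable_gauss].
  - by move=> n x _; rewrite lee_fin mulr_ge0 ?sqr_ge0// ltW// gauss_gt0.
  - move=> x _ a b ab; rewrite lee_fin ler_wpM2l ?sqr_ge0// !gaussE ler_expR lerN2.
    rewrite ler_wpM2r//; first by apply: sumr_ge0 => i _; exact: sqr_ge0.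
    by rewrite /harmonic /= lef_pV2 ?posrE// ler_nat ltnS.
rewrite -(cvg_lim _ h)//; apply: lime_le; first by apply/cvg_ex; eexists; exact: h.
by apply: nearW => n; exact: (ft_gauss_sqr_le (harmonic_pos n)).
Qed.

Lemma Rdominated_cvg (f_ : (T -> R)^nat) (f g : T -> R) :
  (forall n, measurable_fun setT (f_ n)) -> (forall x, f_ n x @[n --> \oo] --> f x) ->
  mu.-integrable setT (EFin \o g) -> (forall n x, `|f_ n x| <= g x) ->
  \int[mu]_x f_ n x @[n --> \oo] --> \int[mu]_x f x.
Proof.
move=> mf ff ig fg; apply: fine_cvg.
have mlim : measurable_fun setT f by apply: (measurable_fun_cvg mf) => x _; exact: ff.
have i_f : mu.-integrable setT (EFin \o f).
  apply: (integrable_le mlim _ ig) => x.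
  have h : `|f_ n x| @[n --> \oo] --> `|f x| by apply: cvg_norm; exact: ff.
  rewrite -(cvg_lim _ h)//.
  apply: limr_le; first by apply/cvg_ex; eexists; exact: h.
  by apply: nearW => n; exact: fg.
rewrite fineK; last exact: integrable_fin_num.
apply: (@dominated_cvg _ _ _ mu setT measurableT (fun n x => (f_ n x)%:E) (EFin \o f) (EFin \o g)) => //.
- by move=> n; exact/measurable_EFinP.
- by move=> x _; apply: cvg_EFin; [exact: nearW|exact: ff].
- by move=> n x _ /=; rewrite lee_fin.
Qed.

Lemma nrm_sub_cint (u : T -> R[i]) x c : 0 < c -> cintegrable mu u ->
  nrm (cint mu (fun y => u y * Complex (heat c x y) 0) - u x) <=
  \int[mu]_y (nrm (u y - u x) * heat c x y).
Proof.
move=> c0 iu; have [mu' inu] := (cintegrableP mu u).1 iu.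
have mh : cmeas (fun y => Complex (heat c x y) 0) by apply: cmeas_real; exact: measurable_heat.
have ih : cintegrable mu (fun y => Complex (heat c x y) 0).
  apply: (cintegrable_le mh _ (integrable_heat x c0)) => y.
  by rewrite nrm_real ger0_norm// heat_ge0.
have iuh : cintegrable mu (fun y => u y * Complex (heat c x y) 0).
  apply: (@cintegrable_bounded_mul _ _ _ _ _ _ (gaussK c ^+ d)) => // y.
  by rewrite nrm_real ger0_norm ?heat_ge0// heat_le.
have E : cint mu (fun y => u y * Complex (heat c x y) 0) - u x =
    cint mu (fun y => (u y - u x) * Complex (heat c x y) 0).
  under [RHS]eq_cint do rewrite mulrBl -mulNr.
  rewrite cintD//; last exact: cintegrable_scale.
  rewrite cintZ// cint_real Rintegral_heat//.
  by congr (_ + _); rewrite -[LHS]mulr1.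
rewrite E; apply: le_trans (nrm_cint_le _) _.
  under eq_fun do rewrite mulrBl -mulNr.
  apply/cintegrableP.
  have [m1 i1] := (cintegrableP mu _).1 iuh.
  have [m2 i2] := (cintegrableP mu _).1 (cintegrable_scale (- u x) ih).
  have m12 : cmeas (fun y => u y * Complex (heat c x y) 0 + - u x * Complex (heat c x y) 0).
    split.
      by under eq_fun do rewrite cReD; apply: measurable_funD; [exact: m1.1|exact: m2.1].
    by under eq_fun do rewrite cImD; apply: measurable_funD; [exact: m1.2|exact: m2.2].
  split => //; apply: (integrable_le (cmeas_nrm m12) _ (integrable_add i1 i2)) => y.
  by rewrite ger0_norm ?nrm_ge0//; exact: le_normcD.
rewrite le_eqVlt; apply/orP; left; apply/eqP; apply: eq_Rintegral => y _.
by rewrite Normc.normcM nrm_real ger0_norm// heat_ge0.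
Qed.

(* Chebyshev: outside the delta-neighbourhood of x, |u - u x| <= 2 B |y - x|^2 / delta^2. *)
Lemma heat_approx (u : T -> R[i]) x c (B eps delta : R) : 0 < c -> cmeas u -> 0 <= eps -> 0 < delta ->
  (forall y, nrm (u y) <= B) ->
  (forall y, (forall i, `|tnth y i - tnth x i| < delta) -> nrm (u y - u x) <= eps) ->
  \int[mu]_y (nrm (u y - u x) * heat c x y) <=
  eps + 2 * B / delta ^+ 2 * (d%:R * c / (2 * pi ^+ 2)).
Proof.
move=> c0 mu' e0 d0 uB uc.
have [im em] := heat_moment2 x c0.
have B0 : 0 <= B by exact: le_trans (nrm_ge0 _) (uB x).
have K0 : 0 <= 2 * B / delta ^+ 2 by rewrite divr_ge0 ?sqr_ge0// mulr_ge0.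
pose q y := \sum_i (tnth y i - tnth x i) ^+ 2.
have q0 y : 0 <= q y by apply: sumr_ge0 => i _; exact: sqr_ge0.
have key y : nrm (u y - u x) <= eps + 2 * B / delta ^+ 2 * q y.
  have [yx|/existsNP[i /negP yxi]] := pselect (forall i, `|tnth y i - tnth x i| < delta).
    by apply: le_trans (uc y yx) _; rewrite lerDl mulr_ge0.
  rewrite -leNgt in yxi.
  have h : nrm (u y - u x) <= 2 * B.
    apply: le_trans (le_normcD _ _) _; rewrite normcN.
    by have := uB x; have := uB y; lra.
  apply: (le_trans h); apply: (@le_trans _ _ (2 * B / delta ^+ 2 * q y)); last by rewrite lerDr.
  have d2 : 0 < delta ^+ 2 by exact: exprn_gt0.
  rewrite -mulrA ler_peMr ?mulr_ge0// mulrC ler_pdivlMr// mul1r.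
  rewrite /q (bigD1 i)//= -[leLHS]addr0 lerD//.
    by rewrite -[leRHS]real_normK ?num_real// lerXn2r ?nnegrE// ltW.
  by apply: sumr_ge0 => j _; exact: sqr_ge0.
have iR : mu.-integrable setT (EFin \o (fun y => eps * heat c x y +
    2 * B / delta ^+ 2 * \sum_i (tnth y i - tnth x i) ^+ 2 * heat c x y)).
  apply: integrable_add; last exact: integrable_scale.
  by apply: integrable_scale; exact: integrable_heat.
have mB : cmeas (fun y => u y - u x).
  split.
    under eq_fun do rewrite cReD; apply: measurable_funD => //; exact: mu'.1.
  under eq_fun do rewrite cImD; apply: measurable_funD => //; exact: mu'.2.
have key2 y : nrm (u y - u x) * heat c x y <= eps * heat c x y +
    2 * B / delta ^+ 2 * \sum_i (tnth y i - tnth x i) ^+ 2 * heat c x y.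
  by rewrite -mulr_suml mulrA -mulrDl ler_wpM2r ?heat_ge0//; exact: key.
have nh0 y : 0 <= nrm (u y - u x) * heat c x y by rewrite mulr_ge0 ?nrm_ge0// heat_ge0.
apply: (@le_trans _ _ (\int[mu]_y (eps * heat c x y +
    2 * B / delta ^+ 2 * \sum_i (tnth y i - tnth x i) ^+ 2 * heat c x y))).
  apply: le_Rintegral => //.
  apply: (integrable_le _ _ iR).
    by apply: measurable_funM; [exact: cmeas_nrm|exact: measurable_heat].
  by move=> y; rewrite ger0_norm.
rewrite RintegralD//; last 2 first.
- by apply: integrable_scale; exact: integrable_heat.
- exact: integrable_scale.
have -> := RintegralZl eps measurableT (integrable_heat x c0).
have -> := RintegralZl (2 * B / delta ^+ 2) measurableT im.
by rewrite Rintegral_heat// mulr1 em.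
Qed.

(** [Lc n] is the inversion integral damped by a Gaussian and also a heat average of [u]. In the
    first form it tends to [L] by dominated convergence, in the second to [u x] by continuity at
    [x]; the three errors are each kept below [e / 3]. *)
Lemma fourier_inversion u x (B : R) : cintegrable mu u -> (forall y, nrm (u y) <= B) ->
  (forall eps, 0 < eps -> exists2 delta, 0 < delta &
    forall y, (forall i, `|tnth y i - tnth x i| < delta) -> nrm (u y - u x) <= eps) ->
  cintegrable mu (ft u) ->
  cint mu (fun xi => ft u xi * expi (2 * pi * dott x xi)) = u x.
Proof.
move=> iu uB uc ift.
have [mu' inu] := (cintegrableP mu u).1 iu.
have [mft inft] := (cintegrableP mu _).1 ift.
set L := cint mu _; apply/eqP; rewrite -subr_eq0; apply/eqP; apply: nrm_eq0.
apply/eqP; rewrite eq_le nrm_ge0 andbT; apply/ler_addgt0Pl => e e0; rewrite addr0.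
have B0 : 0 <= B by exact: le_trans (nrm_ge0 _) (uB x).
pose h n : R := harmonic n.
pose Lc n := cint mu (fun y => u y * Complex (heat (h n) x y) 0).
have me : cmeas (fun xi => expi (2 * pi * dott x xi)) by apply: cmeas_expi; exact: measurable_dott2.
have d1 n : nrm (L - Lc n) <= \int[mu]_xi (nrm (ft u xi) * (1 - gauss (h n) (fun=> 0) xi)).
  have hn := harmonic_pos n.
  rewrite /Lc -ft_gauss_mean// /L.
  have i1 : cintegrable mu (fun xi => ft u xi * expi (2 * pi * dott x xi)).
    by apply: (@cintegrable_bounded_mul _ _ _ _ _ _ 1) => // xi; rewrite nrm_expi.
  have i2 : cintegrable mu (fun xi => ft u xi * (Complex (gauss (h n) (fun=> 0) xi) 0 * expi (2 * pi * dott x xi))).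
    apply: (@cintegrable_bounded_mul _ _ _ _ _ _ 1) => //.
      by apply: cmeas_gauss_expi; exact: measurable_dott2.
    by move=> xi; rewrite Normc.normcM nrm_expi mulr1 nrm_real ger0_norm ?gauss_le1// ltW// gauss_gt0.
  rewrite -mulN1r -cintZ// -cintD//; last exact: cintegrable_scale.
  have E xi : ft u xi * expi (2 * pi * dott x xi) + -1 * (ft u xi * (Complex (gauss (h n) (fun=> 0) xi) 0 * expi (2 * pi * dott x xi))) =
    (ft u xi * Complex (1 - gauss (h n) (fun=> 0) xi) 0) * expi (2 * pi * dott x xi).
    have -> : Complex (1 - gauss (h n) (fun=> 0) xi) 0 = 1 - Complex (gauss (h n) (fun=> 0) xi) 0.
      by apply: complex_eqP; rewrite ?cReD ?cImD /= ?oppr0 ?addr0.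
    ring.
  under eq_cint do rewrite E.
  apply: le_trans (nrm_cint_le _) _.
    apply: (@cintegrable_bounded_mul _ _ _ _ _ _ 1) => //; first by move=> xi; rewrite nrm_expi.
    apply: (@cintegrable_bounded_mul _ _ _ _ _ _ 1) => //.
      by apply: cmeas_real; apply: measurable_funB => //; exact: measurable_gauss.
    move=> xi; rewrite nrm_real ger0_norm; last by rewrite subr_ge0 gauss_le1.
    by rewrite lerBlDr lerDl ltW// gauss_gt0.
  rewrite le_eqVlt; apply/orP; left; apply/eqP; apply: eq_Rintegral => xi _.
  rewrite !Normc.normcM nrm_expi mulr1 nrm_real ger0_norm//.
  by rewrite subr_ge0 gauss_le1.
have d1c : \int[mu]_xi (nrm (ft u xi) * (1 - gauss (h n) (fun=> 0) xi)) @[n --> \oo] --> (0 : R).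
  rewrite [X in _ --> X](_ : _ = \int[mu]_xi (0 : R)); last by rewrite Rintegral_cst// mul0r.
  apply: (@Rdominated_cvg _ _ (fun xi => nrm (ft u xi))) => //.
  - move=> n; apply: measurable_funM; first exact: cmeas_nrm.
    by apply: measurable_funB => //; exact: measurable_gauss.
  - move=> xi.
    have h1 : (1 - gauss (h n) (fun=> 0) xi) @[n --> \oo] --> (1 - 1 : R).
      by apply: cvgB; [exact: cvg_cst|exact: cvg_gauss_harmonic].
    rewrite subrr in h1; rewrite -[X in _ --> X](mulr0 (nrm (ft u xi))).
    by apply: cvgM; [exact: cvg_cst|exact: h1].
  - move=> n xi; rewrite ger0_norm; last first.
      by rewrite mulr_ge0 ?nrm_ge0// subr_ge0 gauss_le1// harmonic_pos.
    rewrite ler_piMr ?nrm_ge0//.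
    by rewrite lerBlDr lerDl ltW// gauss_gt0.
have e3 : 0 < e / 3 by rewrite divr_gt0.
have [delta delta0 ud] := uc _ e3.
pose K := 2 * B / delta ^+ 2 * (d%:R / (2 * pi ^+ 2)).
have d2 n : nrm (Lc n - u x) <= e / 3 + K * h n.
  apply: le_trans (nrm_sub_cint x (harmonic_pos n) iu) _.
  apply: le_trans (heat_approx (harmonic_pos n) mu' (ltW e3) delta0 uB ud) _.
  by rewrite lerD2l /K -!mulrA [_^-1 * h n]mulrC.
have d2c : K * h n @[n --> \oo] --> (0 : R).
  rewrite -(mulr0 K); apply: cvgM; [exact: cvg_cst|exact: cvg_harmonic].
have [n1 _ N1] := @cvgr_lt _ _ _ _ _ _ d1c (e / 3) e3.
have [n2 _ N2] := @cvgr_lt _ _ _ _ _ _ d2c (e / 3) e3.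
pose n := maxn n1 n2.
have l1 := N1 n (leq_maxl _ _); have l2 := N2 n (leq_maxr _ _).
have -> : L - u x = (L - Lc n) + (Lc n - u x) by rewrite addrA subrK.
apply: le_trans (le_normcD _ _) _.
have := d1 n; have := d2 n; move: l1 l2 => /=; lra.
Qed.

End Inversion.

Lemma integral_powR_eq0 {R : realType} d {T : measurableType d} {m : {measure set T -> \bar R}}
    (f : T -> R) (q : R) : measurable_fun setT f -> (forall x, 0 <= f x) -> 0 < q ->
  (\int[m]_x (f x `^ q)%:E = 0)%E -> (\int[m]_x (f x)%:E = 0)%E.
Proof.
move=> mf f0 q0 h.
have mq : measurable_fun setT (fun x => (f x `^ q)%:E).
  by apply/measurable_EFinP; apply: (measurableT_comp (measurable_powR q)).
have ae1 : ae_eq m setT (fun x => (f x `^ q)%:E) (cst 0%E).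
  apply/(ae_eq_integral_abs m measurableT mq); rewrite -[RHS]h.
  by apply: eq_integral => x _; rewrite gee0_abs// lee_fin powR_ge0.
have ae2 : ae_eq m setT (fun x => (f x)%:E) (cst 0%E).
  move: ae1; apply: filterS => x /= /(_ I) [] /powR_eq0_eq0 -> //.
rewrite (ae_eq_integral (cst 0%E)) ?integral0//.
exact/measurable_EFinP.
Qed.

(** * Hausdorff-Young inequality *)

Section IntervalSlices.
Context {R : realType}.
Local Notation leb := (@lebesgue_measure R).

(** The slices of a layer-cake integral: the open end serves the strict level sets of the transform,
    its closed variant the truncation set of [u]. *)
Lemma integral_if_itvoo (a k : R) : 0 <= a ->
  (\int[leb]_v (if (0 < v) && (v < a) then k else 0)%:E = (k * a)%:E)%E.
Proof.
move=> a0; rewrite (_ : (fun v => _) = (fun v => k%:E * (\1_`]0, a[%classic v)%:E)%E); last first.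
  apply/funext => v; rewrite indicE /= -EFinM; congr EFin.
  by rewrite mem_setE in_itv /=; case: ifP => _; rewrite ?mulr1 ?mulr0.
rewrite integralZl//; last first.
  apply: (@integrable_indic_itv R 0 a false true).
rewrite integral_indic//= setIT lebesgue_measure_itv /= lte_fin.
by case: ltgtP a0 => // [a0 _|<- _]; rewrite ?sube0 ?mule0 ?mulr0.
Qed.

Lemma integral_if_itvoc (a k : R) : 0 <= a ->
  (\int[leb]_v (if (0 < v) && (v <= a) then k else 0)%:E = (k * a)%:E)%E.
Proof.
move=> a0; rewrite (_ : (fun v => _) = (fun v => k%:E * (\1_`]0, a]%classic v)%:E)%E); last first.
  apply/funext => v; rewrite indicE /= -EFinM; congr EFin.
  by rewrite mem_setE in_itv /=; case: ifP => _; rewrite ?mulr1 ?mulr0.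
rewrite integralZl//; last first.
  apply: (@integrable_indic_itv R 0 a false false).
rewrite integral_indic//= setIT lebesgue_measure_itv /= lte_fin.
by case: ltgtP a0 => // [a0 _|<- _]; rewrite ?sube0 ?mule0 ?mulr0.
Qed.

End IntervalSlices.

Section HausdorffYoung.
Context {R : realType} {d : nat}.
Local Notation leb := (@lebesgue_measure R).
Local Notation mu := (lebesgue_tuple R d).
Local Notation T := (d.-tuple R).
Implicit Types (x y xi : T) (u : T -> R[i]).

Lemma cmeas_if (b : T -> bool) (u v : T -> R[i]) : measurable_fun setT b -> cmeas u -> cmeas v ->
  cmeas (fun x => if b x then u x else v x).
Proof.
move=> mb [ur ui] [vr vi]; split.
  rewrite (_ : (fun x => _) = (fun x => if b x then complex.Re (u x) else complex.Re (v x))).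
    exact: measurable_fun_ifT.
  by apply/funext => x; case: (b x).
rewrite (_ : (fun x => _) = (fun x => if b x then complex.Im (u x) else complex.Im (v x))).
  exact: measurable_fun_ifT.
by apply/funext => x; case: (b x).
Qed.

Lemma cmeas0 : cmeas (fun _ : T => 0 : R[i]).
Proof. by split; exact: measurable_cst. Qed.

Lemma ft_split (b : T -> bool) u xi : measurable_fun setT b -> cintegrable mu u ->
  ft u xi = ft (fun x => if b x then u x else 0) xi + ft (fun x => if b x then 0 else u x) xi.
Proof.
move=> mb iu; have [mu' inu] := (cintegrableP mu u).1 iu.
have i1 : cintegrable mu (fun x => if b x then u x else 0).
  apply: (cintegrable_le _ _ inu); first exact: (cmeas_if mb mu' cmeas0).
  by move=> x; case: (b x); rewrite ?Normc.normc0 ?nrm_ge0.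
have i2 : cintegrable mu (fun x => if b x then 0 else u x).
  apply: (cintegrable_le _ _ inu); first exact: (cmeas_if mb cmeas0 mu').
  by move=> x; case: (b x); rewrite ?Normc.normc0 ?nrm_ge0.
rewrite /ft -cintD; [|exact: cintegrable_fker..].
by apply: eq_cint => x; case: (b x); rewrite mul0r ?addr0 ?add0r.
Qed.

(* Marcinkiewicz interpolation: for each level v, the part of u where nrm u is
   large has transform at most v^(1/(P-2))/2 in sup norm by the L^1 bound, so that
   {nrm (ft u)^(P-2) > v} is controlled by Plancherel for the rest; then integrate
   in v. *)
Section Truncation.
Context (u : T -> R[i]) (q S : R).
Context (q1 : 1 < q) (q2 : q < 2) (iu : cintegrable mu u) (S0 : 0 < S).
Context (iq : mu.-integrable setT (EFin \o (fun x => nrm (u x) `^ q))).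
Context (Sq : \int[mu]_x nrm (u x) `^ q = S).

Let P := q / (q - 1).
Let q10 : 0 < q - 1. Proof. by rewrite subr_gt0. Qed.
Let P2E : P - 2 = (2 - q) / (q - 1).
Proof. by rewrite /P; field; rewrite gt_eqF. Qed.
Let P20 : 0 < P - 2. Proof. by rewrite P2E divr_gt0// subr_gt0. Qed.
(** The threshold is tuned to [ft_high]. Off [E v], raising [v * nrm (u x)^(2 - q) > A] to the power
    [1 / (P - 2)] gives [2 S < v^(1 / (P - 2)) * nrm (u x)^(q - 1)], so that the high part has L^1
    norm at most [v^(1 / (P - 2)) / 2]. *)
Let A := (2 * S) `^ (P - 2).
Let A0 : 0 < A. Proof. by rewrite powR_gt0// mulr_gt0. Qed.
Let E (v : R) x := v * nrm (u x) `^ (2 - q) <= A.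
Let mu' : cmeas u. Proof. exact: cintegrable_meas iu. Qed.
Let mpow (r : R) : measurable_fun setT (fun x => nrm (u x) `^ r).
Proof. by apply: (measurableT_comp (measurable_powR r)); exact: cmeas_nrm. Qed.
Let mE v : measurable_fun setT (E v).
Proof. by apply: measurable_fun_ler => //; exact: measurable_funM. Qed.

Let low v x : R[i] := if E v x then u x else 0.
Let high v x : R[i] := if E v x then 0 else u x.

Let i_low v : cintegrable mu (low v).
Proof.
have [_ inu] := (cintegrableP mu u).1 iu.
apply: (cintegrable_le _ _ inu); first exact: (cmeas_if (mE v) mu' cmeas0).
by move=> x; rewrite /low; case: ifP; rewrite ?Normc.normc0 ?nrm_ge0.
Qed.

Let i_high v : cintegrable mu (high v).
Proof.
have [_ inu] := (cintegrableP mu u).1 iu.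
apply: (cintegrable_le _ _ inu); first exact: (cmeas_if (mE v) cmeas0 mu').
by move=> x; rewrite /high; case: ifP; rewrite ?Normc.normc0 ?nrm_ge0.
Qed.

Let high_le v x : 0 < v ->
  nrm (high v x) <= v `^ (P - 2)^-1 / (2 * S) * nrm (u x) `^ q.
Proof.
move=> v0; rewrite /high; case: ifP => [_|/negbT].
  by rewrite Normc.normc0 mulr_ge0 ?powR_ge0// divr_ge0 ?powR_ge0// mulr_ge0// ltW.
rewrite -ltNge; set g := nrm (u x) => Eg.
have g0 : 0 < g.
  rewrite lt_neqAle nrm_ge0 andbT; apply/eqP => g0; move: Eg.
  by rewrite -g0 powR0 ?mulr0 ?ltNge ?(ltW A0)// subr_eq0 gt_eqF.
have S20 : 0 < 2 * S by rewrite mulr_gt0.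
have key : 2 * S <= v `^ (P - 2)^-1 * g `^ (q - 1).
  have P2i : (P - 2)^-1 >= 0 by rewrite invr_ge0 ltW.
  have := ge0_ler_powR P2i _ _ (ltW Eg).
  rewrite !nnegrE => /(_ (ltW A0)); rewrite mulr_ge0 ?powR_ge0 ?(ltW v0)// => /(_ isT).
  rewrite /A -powRrM divff ?gt_eqF// powRr1 ?(ltW S20)//.
  rewrite powRM ?powR_ge0 ?(ltW v0)// -powRrM.
  by have -> : (2 - q) * (P - 2)^-1 = q - 1; first by rewrite P2E; field; rewrite !gt_eqF// subr_gt0.
rewrite mulrAC ler_pdivlMr//.
have -> : g `^ q = g * g `^ (q - 1) by rewrite mulr_powRB1 ?(ltW g0)// (lt_trans ltr01).
by rewrite [leRHS]mulrCA ler_wpM2l// ltW.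
Qed.

Let ft_high v xi : 0 < v -> nrm (ft (high v) xi) <= v `^ (P - 2)^-1 / 2.
Proof.
move=> v0; apply: le_trans (nrm_ft_le xi (i_high v)) _.
have [_ ih] := (cintegrableP mu _).1 (i_high v).
apply: (@le_trans _ _ (\int[mu]_x (v `^ (P - 2)^-1 / (2 * S) * nrm (u x) `^ q))).
  apply: le_Rintegral => //; first exact: integrable_scale.
  by move=> x _; exact: high_le.
by rewrite RintegralZl// Sq invfM mulrA divfK ?gt_eqF.
Qed.

Let low_sqr v x : 0 < v -> nrm (low v x) ^+ 2 <= A / v * nrm (u x) `^ q.
Proof.
move=> v0; rewrite /low; case: ifP => [|_]; last first.
  by rewrite Normc.normc0 expr0n mulr_ge0 ?powR_ge0// divr_ge0// ltW.
rewrite /E => h.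
have -> : nrm (u x) ^+ 2 = nrm (u x) `^ (2 - q) * nrm (u x) `^ q.
  rewrite -powR_mulrn ?nrm_ge0// -powRD ?subrK//.
  by rewrite pnatr_eq0.
by rewrite ler_wpM2r ?powR_ge0// ler_pdivlMr// mulrC.
Qed.

Let i_low2 v : 0 < v -> mu.-integrable setT (EFin \o (fun x => nrm (low v x) ^+ 2)).
Proof.
move=> v0; apply: (@integrable_le _ _ _ _ _ (fun x => A / v * nrm (u x) `^ q)).
- by apply: measurable_funX; apply: cmeas_nrm; exact: cintegrable_meas.
- by move=> x; rewrite ger0_norm ?sqr_ge0//; exact: low_sqr.
- exact: integrable_scale.
Qed.

(** At such a level [nrm (ft u xi)] is at least [v^(1 / (P - 2))], twice the bound on the high part,
    so the low part accounts for at least half of it. *)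
Let ft_low v xi : 0 < v -> v < nrm (ft u xi) `^ (P - 2) ->
  nrm (ft u xi) ^+ 2 <= 4 * nrm (ft (low v) xi) ^+ 2.
Proof.
move=> v0 vlt.
have h1 : nrm (ft u xi) <= nrm (ft (low v) xi) + nrm (ft (high v) xi).
  by rewrite (ft_split xi (mE v) iu); exact: le_normcD.
have h2 : v `^ (P - 2)^-1 <= nrm (ft u xi).
  have P2i : (P - 2)^-1 >= 0 by rewrite invr_ge0 ltW.
  have := ge0_ler_powR P2i _ _ (ltW vlt).
  rewrite !nnegrE (ltW v0) powR_ge0 -powRrM divff ?gt_eqF// powRr1 ?nrm_ge0//.
  by apply.
have h3 := ft_high xi v0; have := nrm_ge0 (ft u xi).
move: h1 h2 h3; move: (nrm (ft u xi)) (nrm (ft (low v) xi)) (nrm (ft (high v) xi)) (v `^ _).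
move=> a b c e h1 h2 h3 a0; have h : a <= 2 * b by lra.
by have : a ^+ 2 <= (2 * b) ^+ 2; [rewrite lerXn2r ?nnegrE//; lra|rewrite exprMn; lra].
Qed.

Lemma hausdorff_young_trunc :
  (\int[mu]_xi (nrm (ft u xi) `^ P)%:E <= (2 `^ P * S `^ (P - 1))%:E)%E.
Proof.
have mft := cmeas_nrm (cmeas_ft mu').
have mgu := cmeas_nrm mu'.
(* Integrating [F] in [v] produces the missing power [P - 2] of [nrm (ft u xi)]; for fixed [v > 0],
   [ft_low] and Plancherel bound the integral of [F] by that of [G]. *)
pose F (z : R * T) := if (0 < z.1) && (z.1 < nrm (ft u z.2) `^ (P - 2)) then nrm (ft u z.2) ^+ 2 else 0.
pose G (z : R * T) := if (0 < z.1) && E z.1 z.2 then 4 * nrm (u z.2) ^+ 2 else 0.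
have m1 : measurable_fun [set: measurableTypeR R * T] (fun z => z.1 : R) by exact: measurable_fst.
have m2 (f : T -> R) : measurable_fun setT f -> measurable_fun [set: measurableTypeR R * T] (fun z => f z.2).
  by move=> mf; apply: (measurableT_comp mf); exact: measurable_snd.
have mF : measurable_fun [set: measurableTypeR R * T] (EFin \o F).
  apply/measurable_EFinP; apply: measurable_fun_ifT => //.
    apply: measurable_and; apply: measurable_fun_ltr => //.
    by apply: (m2 (fun xi => nrm (ft u xi) `^ (P - 2))); apply: (measurableT_comp (measurable_powR _)).
  by apply: (m2 (fun xi => nrm (ft u xi) ^+ 2)); exact: measurable_funX.
have mG : measurable_fun [set: measurableTypeR R * T] (EFin \o G).
  apply/measurable_EFinP; apply: measurable_fun_ifT => //.
    apply: measurable_and; first exact: measurable_fun_ltr.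
    apply: measurable_fun_ler => //; apply: measurable_funM => //.
    exact: (m2 (fun x => nrm (u x) `^ (2 - q))).
  by apply: (m2 (fun x => 4 * nrm (u x) ^+ 2)); apply: measurable_funM => //; exact: measurable_funX.
have F0 z : (0 <= (EFin \o F) z)%E by rewrite lee_fin /F; case: ifP => // _; exact: sqr_ge0.
have G0 z : (0 <= (EFin \o G) z)%E by rewrite lee_fin /G; case: ifP => // _; rewrite mulr_ge0// sqr_ge0.
have P0 : P != 0 by rewrite gt_eqF//; move: P20; lra.
have EF : (\int[mu]_xi (nrm (ft u xi) `^ P)%:E = \int[mu]_xi \int[leb]_v (F (v, xi))%:E)%E.
  apply: eq_integral => xi _; rewrite /F /= integral_if_itvoo ?powR_ge0//; congr EFin.
  rewrite -[X in _ = X * _](@powR_mulrn _ _ 2) ?nrm_ge0// -powRD; first by rewrite subrKC.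
  by rewrite subrKC (negPf P0).
(* Where [u x] is not 0, the levels with [E v x] form []0, A / nrm (u x)^(2 - q)]], which leaves
   [4 A nrm (u x)^q]; finally [4 A S = 2^P S^(P - 1)]. *)
have EG : (\int[mu]_x \int[leb]_v (G (v, x))%:E = (2 `^ P * S `^ (P - 1))%:E)%E.
  transitivity (\int[mu]_x (4 * A * nrm (u x) `^ q)%:E)%E.
    apply: eq_integral => x _; rewrite /G /E /=; set g := nrm (u x).
    have [g0|g0] := eqVneq g 0.
      have qn : 0 `^ q = 0 :> R by rewrite powR0// gt_eqF// (lt_trans ltr01).
      rewrite g0 expr0n mulr0 qn mulr0.
      by under eq_integral do rewrite if_same; rewrite integral0.
    have gpos : 0 < g by rewrite lt_neqAle eq_sym g0 nrm_ge0.
    under eq_integral => v _ do rewrite -ler_pdivlMr ?powR_gt0//.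
    rewrite integral_if_itvoc; last by rewrite divr_ge0 ?powR_ge0// ltW.
    congr EFin; rewrite -powR_mulrn ?(ltW gpos)//.
    have -> : g `^ 2%:R = g `^ q * g `^ (2 - q).
      by rewrite -powRD ?subrKC// g0 implybT.
    have gn0 : g `^ (2 - q) != 0 by rewrite gt_eqF// powR_gt0.
    by field.
  rewrite (integral_EFin_Rintegral (integrable_scale (4 * A) iq)) RintegralZl// Sq; congr EFin.
  rewrite /A powRM ?(ltW S0)//.
  have -> : S `^ (P - 1) = S `^ (P - 2) * S.
    rewrite -[X in _ * X]powRr1 ?(ltW S0)// -powRD; first by congr (_ `^ _); ring.
    by rewrite (gt_eqF S0) implybT.
  have -> : (2 : R) `^ P = 4 * 2 `^ (P - 2).
    have -> : 4 = 2 `^ 2%:R :> R by rewrite powR_mulrn//; ring.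
    by rewrite -powRD ?subrKC// pnatr_eq0 implybT.
  by ring.
have swap1 : (\int[mu]_xi \int[leb]_v (F (v, xi))%:E = \int[leb]_v \int[mu]_xi (F (v, xi))%:E)%E.
  by apply/esym; exact: (@fubini_tonelli _ _ (measurableTypeR R) T R leb mu (EFin \o F) mF F0).
have swap2 : (\int[mu]_xi \int[leb]_v (G (v, xi))%:E = \int[leb]_v \int[mu]_xi (G (v, xi))%:E)%E.
  by apply/esym; exact: (@fubini_tonelli _ _ (measurableTypeR R) T R leb mu (EFin \o G) mG G0).
rewrite EF swap1 -EG swap2.
apply: ge0_le_integral => //.
- by move=> v _; apply: integral_ge0 => xi _; exact: (F0 (v, xi)).
- exact: (@measurable_fun_fubini_tonelli_F _ _ (measurableTypeR R) T R mu (EFin \o F) mF F0).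
- exact: (@measurable_fun_fubini_tonelli_F _ _ (measurableTypeR R) T R mu (EFin \o G) mG G0).
move=> v _; have [v0|v0] := ltP 0 v; last first.
  rewrite /F /G /=; under eq_integral do rewrite ltNge v0 /=.
  by under [leRHS]eq_integral do rewrite ltNge v0 /=.
apply: (@le_trans _ _ (\int[mu]_xi (4 * nrm (ft (low v) xi) ^+ 2)%:E)%E).
  apply: ge0_le_integral => //.
  - by move=> xi _; exact: (F0 (v, xi)).
  - by apply: (measurableT_comp mF); exact: measurable_pair1.
  - apply/measurable_EFinP; apply: measurable_funM => //; apply: measurable_funX.
    by apply: cmeas_nrm; apply: cmeas_ft; exact: cintegrable_meas.
  - move=> xi _; rewrite lee_fin /F v0 /=; case: ifP => [h|_]; first exact: ft_low.
    by rewrite mulr_ge0// sqr_ge0.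
rewrite ge0_integral_scale//; last 2 first.
- by apply: measurable_funX; apply: cmeas_nrm; apply: cmeas_ft; exact: cintegrable_meas.
- by move=> x; exact: sqr_ge0.
apply: (@le_trans _ _ (4%:E * \int[mu]_x (nrm (low v x) ^+ 2)%:E)%E).
  by rewrite lee_pmul2l// plancherel_le//; exact: i_low2.
rewrite -ge0_integral_scale//; last 2 first.
- by apply: measurable_funX; apply: cmeas_nrm; exact: cintegrable_meas.
- by move=> x; exact: sqr_ge0.
rewrite le_eqVlt; apply/orP; left; apply/eqP; apply: eq_integral => x _.
rewrite /G /low v0 /=; case: ifP => // _.
by rewrite Normc.normc0 expr0n mulr0.
Qed.

End Truncation.

(** Two degenerate cases complete the truncation argument: for [S = 0] the threshold would vanish,
    but then [ft u] is 0; for [q = 2] the exponent [P - 2] is 0, and the claim is Plancherel with a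
    factor to spare. *)
Lemma hausdorff_young u (q S : R) : 1 < q -> q <= 2 -> cintegrable mu u ->
  mu.-integrable setT (EFin \o (fun x => nrm (u x) `^ q)) ->
  \int[mu]_x nrm (u x) `^ q = S ->
  (\int[mu]_xi (nrm (ft u xi) `^ (q / (q - 1)))%:E <=
   (2 `^ (q / (q - 1)) * S `^ (q / (q - 1) - 1))%:E)%E.
Proof.
move=> q1 q2 iu iq Sq.
have [mu' inu] := (cintegrableP mu u).1 iu.
have q0 : 0 < q by rewrite (lt_trans ltr01).
have q10 : 0 < q - 1 by rewrite subr_gt0.
have P0 : 0 < q / (q - 1) by rewrite divr_gt0.
have Sge : 0 <= S by rewrite -Sq; apply: Rintegral_ge0 => x _; exact: powR_ge0.
have [S0|S0] := eqVneq S 0.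
  have h : (\int[mu]_x (nrm (u x))%:E = 0)%E.
    apply: (integral_powR_eq0 (q := q)) => //; [exact: cmeas_nrm|move=> x; exact: nrm_ge0|].
    by rewrite (integral_EFin_Rintegral iq) Sq S0.
  have h0 xi : nrm (ft u xi) = 0.
    apply/eqP; rewrite eq_le nrm_ge0 andbT; apply: le_trans (nrm_ft_le xi iu) _.
    by rewrite /Rintegral h.
  under eq_integral do rewrite h0 powR0 ?gt_eqF//.
  by rewrite integral0 lee_fin mulr_ge0 ?powR_ge0.
have Spos : 0 < S by rewrite lt_neqAle eq_sym S0.
move: q2; rewrite le_eqVlt => /orP[/eqP q2|q2]; last first.
  exact: hausdorff_young_trunc.
subst q; have -> : 2 / (2 - 1) = 2%:R :> R by field.
have -> : 2%:R - 1 = 1 :> R by ring.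
have E z : nrm z `^ 2%:R = nrm z ^+ 2 :> R by rewrite powR_mulrn// nrm_ge0.
rewrite powRr1//; under eq_integral do rewrite E.
have Ef : (fun x => nrm (u x) `^ 2) = (fun x => nrm (u x) ^+ 2) by apply/funext => x; rewrite E.
rewrite Ef in iq Sq.
apply: le_trans (plancherel_le iu iq) _.
rewrite (integral_EFin_Rintegral iq) Sq lee_fin ler_peMl// powR_mulrn//.
lra.
Qed.

End HausdorffYoung.

(** * Schwartz functions *)

Section ContinuousMeasurable.
Context {R : realType} {d : nat}.
Local Notation mu := (lebesgue_tuple R d).
Local Notation T := (d.-tuple R).
Local Notation rv := (@rv_of_tuple R d).
Implicit Types (x y xi t : T).

Lemma continuous_rv (f : 'rV[R]_d -> R) (a : 'rV[R]_d) : {for a, continuous f} ->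
  forall eps : R, 0 < eps -> exists2 delta : R, 0 < delta &
    forall b : 'rV[R]_d, (forall i, `|b 0 i - a 0 i| < delta) -> `|f b - f a| < eps.
Proof.
move=> cf eps e0.
have /cvgrPdist_lt/(_ _ e0) := cf => /nbhs_ballP[delta /= d0 h].
exists delta => // b ba; rewrite distrC; apply: h => /=.
split => // i j; rewrite /ball /= ord1 distrC; exact: ba.
Qed.

Definition grid (n : nat) (t : T) : d.-tuple int := [tuple Num.floor (tnth t i * n.+1%:R) | i < d].

Lemma measurable_grid n (z : d.-tuple int) : measurable [set t | grid n t = z].
Proof.
rewrite (_ : [set t | _] = \bigcap_(i in [set: 'I_d])
   ((fun t : T => tnth t i * n.+1%:R) @^-1` `[(tnth z i)%:~R, (tnth z i + 1)%:~R[%classic)).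
  apply: fin_bigcap_measurable => // i _; rewrite -[X in measurable X]setTI.
  apply: (measurable_funM (measurable_tnthR i) (measurable_cst _)) => //.
apply/seteqP; split => t /=.
  move=> <- i _; rewrite /= in_itv /= /grid tnth_mktuple; exact: floor_itv.
move=> h; apply: eq_from_tnth => i; rewrite tnth_mktuple; apply/eqP.
by rewrite floor_eq; have := h i I; rewrite /= in_itv.
Qed.

(** The sigma-algebra lives on tuples and the topology on row vectors, so continuity does not give
    measurability at once. Instead [f] is the pointwise limit of its values at the lower corners of
    ever finer grids, functions that factor through the countable type of integer tuples. *)
Lemma measurable_rv (f : 'rV[R]_d -> R) : continuous f -> measurable_fun setT (fun t : T => f (rv t)).
Proof.
move=> cf.
pose h n (z : d.-tuple int) : R := f (\row_i ((tnth z i)%:~R / n.+1%:R)).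
apply: (@measurable_fun_cvg _ _ _ _ (fun n t => h n (grid n t))).
  move=> n _ Y mY; rewrite setTI.
  rewrite (_ : _ @^-1` Y = \bigcup_(z : d.-tuple int) ([set t | grid n t = z] `&` [set t | Y (h n z)])).
    apply: countable_bigcupT_measurable; first exact: countableP.
    move=> z; apply: measurableI; first exact: measurable_grid.
    have [Yz|Yz] := pselect (Y (h n z)).
      by rewrite (_ : [set t | _] = setT)//; apply/seteqP; split.
    by rewrite (_ : [set t | _] = set0)//; apply/seteqP; split.
  apply/seteqP; split => t /=; first by move=> Yt; exists (grid n t).
  by move=> [z _ [/= -> ]].
move=> t _; apply/cvgrPdist_lt => eps e0.
have [delta d0 hd] := @continuous_rv f (rv t) (cf _) eps e0.
have := @cvgr_lt _ _ _ _ _ _ (@cvg_harmonic R) delta d0.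
move=> [N _ hN]; exists N => // n /hN /= hn; rewrite /= distrC; apply: hd => i.
rewrite !mxE /grid tnth_mktuple distrC.
have n0 : 0 < n.+1%:R :> R by [].
have /andP[] := floor_itv (tnth t i * n.+1%:R); set z := Num.floor _.
rewrite -ler_pdivrMr// intrD -ltr_pdivlMr// mulrDl => h1 h2.
rewrite ger0_norm ?subr_ge0//; apply: le_lt_trans hn.
by rewrite /harmonic /= lerBlDl ltW//; move: h2; rewrite mul1r.
Qed.

End ContinuousMeasurable.

Section Rapid.
Context {R : realType} {d : nat}.
Local Notation mu := (lebesgue_tuple R d).
Local Notation T := (d.-tuple R).
Local Notation rv := (@rv_of_tuple R d).
Implicit Types (x y xi t : T) (u v : T -> R[i]).

Definition en t : R := Num.sqrt (\sum_i tnth t i ^+ 2).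

Lemma en_ge0 t : 0 <= en t. Proof. exact: sqrtr_ge0. Qed.

Lemma en_sqr t : en t ^+ 2 = \sum_i tnth t i ^+ 2.
Proof. by rewrite sqr_sqrtr//; apply: sumr_ge0 => i _; exact: sqr_ge0. Qed.

Lemma eucl_norm_rv t : eucl_norm (rv t) = en t.
Proof. by rewrite /eucl_norm /dotrv; congr Num.sqrt; apply: eq_bigr => i _; rewrite !mxE. Qed.

Lemma dotrv_rv x y : dotrv (rv x) (rv y) = dott x y.
Proof. by apply: eq_bigr => i _; rewrite !mxE. Qed.

Lemma measurable_en : measurable_fun setT en.
Proof.
apply: (measurableT_comp (f := @Num.sqrt R)).
  by apply: continuous_measurable_fun; exact: sqrt_continuous.
by apply: measurable_sum => i; apply: measurable_funX; exact: measurable_tnthR.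
Qed.

Definition rapid v := forall k : nat, exists M : R, forall t, en t ^+ k * nrm (v t) <= M.

Lemma WtV_le t : (Wt t)^-1 <= (1 + en t ^+ 2) ^+ d.
Proof.
rewrite /Wt -prodfV -[d in X in _ <= X]card_ord -prodr_const.
apply: ler_prod => i _; rewrite /wt invrK en_sqr; apply/andP; split.
  by apply: le_trans (oneDsqr_ge1 _); exact: ler01.
rewrite /oneDsqr lerD2l (bigD1 i)//= lerDl.
by apply: sumr_ge0 => j _; exact: sqr_ge0.
Qed.

(** [1 / Wt t] is at most [(1 + |t|^2)^d], hence at most [2^d] in the unit ball and at most
    [2^d |t|^(2 d)] outside; [M0] covers the first case and [M1] the second. *)
Lemma le_Wt (g : T -> R) (M0 M1 : R) : (forall t, 0 <= g t) -> (forall t, g t <= M0) ->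
  (forall t, en t ^+ (2 * d) * g t <= M1) ->
  forall t, g t <= 2 ^+ d * (M0 + M1) * Wt t.
Proof.
move=> g0 gM0 gM1 t; have W0 := Wt_gt0 t.
rewrite -ler_pdivrMr//; apply: (@le_trans _ _ (g t * (1 + en t ^+ 2) ^+ d)).
  by rewrite ler_wpM2l//; exact: WtV_le.
have h0 : 0 <= en t ^+ 2 by exact: sqr_ge0.
have [h1|h1] := leP (en t ^+ 2) 1.
  apply: (@le_trans _ _ (g t * 2 ^+ d)).
    by rewrite ler_wpM2l// lerXn2r ?nnegrE//; move: h0 h1; set e := en t ^+ 2 => h0 h1; lra.
  rewrite mulrC ler_wpM2l ?exprn_ge0//.
  apply: le_trans (gM0 t) _; rewrite lerDl; apply: le_trans (gM1 t).
  by rewrite mulr_ge0// exprn_ge0// en_ge0.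
apply: (@le_trans _ _ (g t * (2 * en t ^+ 2) ^+ d)).
  by rewrite ler_wpM2l// lerXn2r ?nnegrE//; move: h0 h1; set e := en t ^+ 2 => h0 h1; lra.
rewrite exprMn mulrCA -exprM ler_wpM2l ?exprn_ge0// mulrC.
by apply: le_trans (gM1 t) _; rewrite lerDr; apply: le_trans (gM0 t).
Qed.

Lemma rapid_Wt v : rapid v -> exists C, forall t, nrm (v t) <= C * Wt t.
Proof.
move=> rv; have [M0 h0] := rv 0%N; have [M1 h1] := rv (2 * d)%N.
exists (2 ^+ d * (M0 + M1)); apply: le_Wt => // t; first exact: nrm_ge0.
by have := h0 t; rewrite expr0 mul1r.
Qed.

Lemma rapid_en_Wt v : rapid v -> exists C, forall t, en t * nrm (v t) <= C * Wt t.
Proof.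
move=> rv; have [M0 h0] := rv 1%N; have [M1 h1] := rv (2 * d).+1.
exists (2 ^+ d * (M0 + M1)); apply: (@le_Wt (fun t => en t * nrm (v t))) => t.
- by rewrite mulr_ge0 ?en_ge0 ?nrm_ge0.
- by have := h0 t; rewrite expr1.
- by have := h1 t; rewrite exprSr mulrA.
Qed.

Lemma rapid_conj v : rapid v -> rapid (fun t => conjc (v t)).
Proof. by move=> rv k; have [M h] := rv k; exists M => t; rewrite nrm_conj. Qed.

Lemma rapid_cintegrable v : cmeas v -> rapid v -> cintegrable mu v.
Proof.
move=> mv /rapid_Wt[C h]; apply: (cintegrable_le mv h).
exact/integrable_scale/integrable_Wt.
Qed.

Lemma rapid_bounded v : rapid v -> exists B, forall t, nrm (v t) <= B.
Proof. by move=> rv; have [M h] := rv 0%N; exists M => t; have := h t; rewrite expr0 mul1r. Qed.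

Lemma sum_expn_le (a : 'I_d -> R) (k : nat) : (0 < k)%N -> (forall i, 0 <= a i) ->
  (\sum_i a i) ^+ k <= d%:R ^+ k * \sum_i a i ^+ k.
Proof.
move=> k0 a0; have [d0|d0] := posnP d.
  rewrite !big1 ?mulr0 => [|i _|i _]; first by rewrite expr0n gtn_eqF.
    by move: (ltn_ord i); rewrite {2}d0.
  by move: (ltn_ord i); rewrite {2}d0.
pose i0 := [arg max_(i > Ordinal d0) a i]%O.
have am i : a i <= a i0 by rewrite /i0; case: arg_maxP => // j _ /(_ i isT).
apply: (@le_trans _ _ ((d%:R * a i0) ^+ k)).
  rewrite lerXn2r ?nnegrE ?mulr_ge0 ?sumr_ge0//.
  rewrite -[d in d%:R]card_ord mulr_natl -sumr_const; exact: ler_sum.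
rewrite exprMn ler_wpM2l ?exprn_ge0// (bigD1 i0)//= lerDl.
by apply: sumr_ge0 => i _; exact: exprn_ge0.
Qed.

(** Derivatives give the decay of a transform one coordinate at a time. Even powers of the Euclidean
    norm are controlled by sums of even powers of the coordinates; a general power [k] is at most 1
    in the unit ball and at most the power [2 (k + 1)] outside. *)
Lemma rapid_coord v : (exists M, forall t, nrm (v t) <= M) ->
  (forall (i : 'I_d) (k : nat), exists M, forall t, `|tnth t i| ^+ k * nrm (v t) <= M) -> rapid v.
Proof.
move=> [M0 h0] h.
have even k : (0 < k)%N -> exists M, forall t, en t ^+ (2 * k) * nrm (v t) <= M.
  move=> k0; have /choice[M hM] : forall i, exists M, forall t, `|tnth t i| ^+ (2 * k) * nrm (v t) <= M.
    by move=> i; exact: h.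
  exists (d%:R ^+ k * \sum_i M i) => t; rewrite exprM en_sqr.
  apply: (@le_trans _ _ (d%:R ^+ k * (\sum_i (tnth t i ^+ 2) ^+ k) * nrm (v t))).
    by rewrite ler_wpM2r ?nrm_ge0//; apply: sum_expn_le => // i; exact: sqr_ge0.
  rewrite -mulrA ler_wpM2l ?exprn_ge0// mulr_suml; apply: ler_sum => i _.
  by have := hM i t; rewrite -exprM !exprM real_normK ?num_real.
move=> k; have [M1 h1] := even k.+1 isT.
exists (M0 + M1) => t; have e0 := en_ge0 t.
have Mt : 0 <= M1 by apply: le_trans (h1 t); rewrite mulr_ge0 ?nrm_ge0// exprn_ge0.
have Mt0 : 0 <= M0 by apply: le_trans (h0 t); exact: nrm_ge0.
have [h2|h2] := leP (en t) 1.
  apply: (@le_trans _ _ (1 * nrm (v t))).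
    by rewrite ler_wpM2r ?nrm_ge0// exprn_ile1.
  by rewrite mul1r (le_trans (h0 t))// lerDl.
apply: (@le_trans _ _ (en t ^+ (2 * k.+1) * nrm (v t))).
  rewrite ler_wpM2r ?nrm_ge0// ler_weXn2l ?(ltW h2)//.
  by rewrite mulnS mul2n -addnn addnA leq_addl.
by rewrite (le_trans (h1 t))// lerDr.
Qed.

End Rapid.

Lemma is_derive_sub {R : realType} (f g : R -> R) x a b : is_derive x (1 : R) f a ->
  is_derive x (1 : R) g b -> is_derive x (1 : R) (fun y => f y - g y) (a - b).
Proof. by move=> df dg; apply: (@is_derive_eq _ _ _ (f - g)). Qed.

Section SchwartzPair.
Context {R : realType} {d : nat}.
Local Notation mu := (lebesgue_tuple R d).
Local Notation T := (d.-tuple R).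
Local Notation rv := (@rv_of_tuple R d).
Implicit Types (x y xi t : T) (u v : T -> R[i]) (f : 'rV[R]_d -> R[i]).

Lemma schwartz_partial i f : schwartz f -> schwartz (partial i f).
Proof.
have E s : partials s (partial i f) = partials (rcons s i) f by rewrite /partials foldr_rcons.
by move=> [sf df]; split => [s|k s]; rewrite E; [exact: sf|exact: df].
Qed.

Lemma schwartz_cmeas f : schwartz f -> cmeas (fun t => f (rv t)).
Proof.
move=> [sf _]; have [[c1 _] [c2 _]] := sf [::].
by split; [exact: (measurable_rv c1)|exact: (measurable_rv c2)].
Qed.

Lemma schwartz_rapid f : schwartz f -> rapid (fun t => f (rv t)).
Proof.
move=> [_ df] k; have [M h] := df k [::].
by exists M => t; rewrite -eucl_norm_rv; exact: h.
Qed.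

Lemma schwartz_cintegrable f : schwartz f -> cintegrable mu (fun t => f (rv t)).
Proof. by move=> sf; apply: rapid_cintegrable; [exact: schwartz_cmeas|exact: schwartz_rapid]. Qed.

Lemma fourier_rv f xi : fourier f (rv xi) = ft (fun t => f (rv t)) xi.
Proof.
rewrite /fourier /cintegral /ft /cint; congr Complex; apply: eq_Rintegral => t _;
  by rewrite dotrv_rv.
Qed.

Definition cshift (i : 'I_d) (h : R) : 'I_d -> R := fun j => h * (j == i)%:R.

Lemma rv_cshift i h t : rv (tshift (cshift i h) t) = h *: delta_mx 0 i + rv t.
Proof. by apply/rowP => j; rewrite !mxE tnth_mktuple /cshift eqxx /= addrC. Qed.

Lemma dott_cshift i h t xi : dott (tshift (cshift i h) t) xi = dott t xi + h * tnth xi i.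
Proof.
rewrite /dott; under eq_bigr do rewrite tnth_mktuple mulrDl.
rewrite big_split /=; congr (_ + _); rewrite (bigD1 i)//= big1 ?addr0.
  by rewrite /cshift eqxx mulr1.
by move=> j /negPf ji; rewrite /cshift ji mulr0 mul0r.
Qed.

Lemma tshift_cshift0 i t : tshift (cshift i 0) t = t.
Proof. by apply: eq_from_tnth => j; rewrite tnth_mktuple /cshift mul0r addr0. Qed.

Lemma measurable_tshift_fun (g : T -> R) (v : 'I_d -> R) : measurable_fun setT g ->
  measurable_fun setT (fun t => g (tshift v t)).
Proof. by move=> mg; apply: (measurableT_comp mg); exact: measurable_tshift. Qed.

Lemma Wt_cshift i h t : `|h| < 1 -> Wt (tshift (cshift i h) t) <= 3 ^+ d * Wt t.
Proof.
move=> h1; apply: Wt_shift => j; rewrite /cshift; case: (j == i).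
  by rewrite mulr1 ltW.
by rewrite mulr0 normr0.
Qed.

Lemma Rintegral_coord_derive0 (i : 'I_d) (g g' : T -> R) (C C' : R) :
  measurable_fun setT g -> measurable_fun setT g' ->
  (forall t, `|g t| <= C * Wt t) -> (forall t, `|g' t| <= C' * Wt t) ->
  (forall h t, is_derive h (1 : R) (fun k => g (tshift (cshift i k) t)) (g' (tshift (cshift i h) t))) ->
  \int[mu]_t g' t = 0.
Proof.
move=> mg mg' gC gC' dg.
have C'0 : 0 <= C'.
  by have := le_trans (normr_ge0 _) (gC' [tuple 0 | i < d]); rewrite pmulr_lge0// Wt_gt0.
have C0 : 0 <= C.
  by have := le_trans (normr_ge0 _) (gC [tuple 0 | i < d]); rewrite pmulr_lge0// Wt_gt0.
have ig := integrable_le_Wt mg gC.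
have ig' := integrable_le_Wt mg' gC'.
transitivity (\int[mu]_t g' (tshift (cshift i 0) t)).
  by apply: eq_Rintegral => t _; rewrite tshift_cshift0.
apply: (@Rintegral_flow_derive0 _ _ _ mu (fun h t => tshift (cshift i h) t) g
  (fun h t => g' (tshift (cshift i h) t)) (fun t => C' * (3 ^+ d * Wt t))).
- by move=> t; rewrite tshift_cshift0.
- move=> h h1; apply: (@integrable_le_Wt _ _ _ (C * 3 ^+ d)).
    exact: measurable_tshift_fun.
  move=> t; apply: le_trans (gC _) _; rewrite -mulrA ler_wpM2l//.
  exact: Wt_cshift.
- by move=> h; rewrite /Rintegral (integral_tshift (cshift i h) ig).
- by apply: integrable_scale; apply: integrable_scale; exact: integrable_Wt.
- move=> h t h1; apply: le_trans (gC' _) _; rewrite ler_wpM2l//.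
  exact: Wt_cshift.
Qed.

Lemma partial_line (g : 'rV[R]_d -> R) i h t :
  (forall a, derivable g a (delta_mx 0 i)) ->
  is_derive h (1 : R) (fun k => g (rv (tshift (cshift i k) t)))
    ('D_(delta_mx 0 i) g (rv (tshift (cshift i h) t))).
Proof.
move=> dg; under eq_fun do rewrite rv_cshift.
rewrite rv_cshift; apply: is_derive_line; apply/derivableP; exact: dg.
Qed.

Lemma ft_partial i f xi : schwartz f ->
  nrm (ft (fun t => partial i f (rv t)) xi) =
  `|2 * pi * tnth xi i| * nrm (ft (fun t => f (rv t)) xi).
Proof.
move=> sf; have spf := schwartz_partial i sf.
set u := fun t => f (rv t); set w := fun t => partial i f (rv t).
have mu' : cmeas u := schwartz_cmeas sf.
have mw : cmeas w := schwartz_cmeas spf.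
have [C hC] := rapid_Wt (schwartz_rapid sf).
(* Both integrands are dominated by multiples of [Wt]. *)
have [C' hC'] := rapid_Wt (schwartz_rapid spf).
pose c := - (2 * pi * tnth xi i).
have mF := @cmeas_fker1 R d xi.
have mue : cmeas (fun t => u t * fker (t, xi)) by exact: cmeas_mul.
have mwe : cmeas (fun t => w t * fker (t, xi)) by exact: cmeas_mul.
have iue := cintegrable_fker xi (schwartz_cintegrable sf).
have iwe := cintegrable_fker xi (schwartz_cintegrable spf).
have nue t : nrm (u t * fker (t, xi)) <= C * Wt t by rewrite Normc.normcM nrm_fker mulr1; exact: hC.
have nwe t : nrm (w t * fker (t, xi)) <= C' * Wt t by rewrite Normc.normcM nrm_fker mulr1; exact: hC'.
have dth h t : is_derive h (1 : R) (fun k => - (2 * pi * dott (tshift (cshift i k) t) xi)) c.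
  under eq_fun => k.
    rewrite dott_cshift; have -> : - (2 * pi * (dott t xi + k * tnth xi i)) = c * k + - (2 * pi * dott t xi).
      by rewrite /c; move: (pi) => p; ring.
    over.
  exact: is_derive_affine.
have [[_ dre] [_ dim]] := sf.1 [::].
have dur h t := @partial_line _ i h t (dre i).
have dui h t := @partial_line _ i h t (dim i).
have dcos h t := @is_derive_comp R (@cos R) (fun k => - (2 * pi * dott (tshift (cshift i k) t) xi)) h _ _ (is_derive_cos _) (dth h t).
have dsin h t := @is_derive_comp R (@sin R) (fun k => - (2 * pi * dott (tshift (cshift i k) t) xi)) h _ _ (is_derive_sin _) (dth h t).
have re0 : \int[mu]_t (complex.Re (w t * fker (t, xi)) + (- c) * complex.Im (u t * fker (t, xi))) = 0.
  apply: (@Rintegral_coord_derive0 i (fun t => complex.Re (u t * fker (t, xi))) _ C (C' + `|c| * C)).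
  - exact: mue.1.
  - by apply: measurable_funD; [exact: mwe.1|apply: measurable_funM => //; exact: mue.2].
  - by move=> t; apply: le_trans (nue t); exact: nrm_Re.
  - move=> t; apply: le_trans (ler_normD _ _) _; rewrite normrM normrN mulrDl -mulrA lerD//.
      by apply: le_trans (nwe t); exact: nrm_Re.
    by rewrite ler_wpM2l//; apply: le_trans (nue t); exact: nrm_Im.
  - move=> h t.
    have D := is_derive_sub (is_derive_mul (dur h t) (dcos h t)) (is_derive_mul (dui h t) (dsin h t)).
    have E : (fun k => complex.Re (u (tshift (cshift i k) t) * fker (tshift (cshift i k) t, xi))) =
      (fun k => complex.Re (f (rv (tshift (cshift i k) t))) * cos (- (2 * pi * dott (tshift (cshift i k) t) xi)) -
       complex.Im (f (rv (tshift (cshift i k) t))) * sin (- (2 * pi * dott (tshift (cshift i k) t) xi))).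
      by apply/funext => k; rewrite cReM.
    rewrite E; apply: (is_derive_eq D).
    by rewrite cReM cImM /fker /w /u /=; ring.
have im0 : \int[mu]_t (complex.Im (w t * fker (t, xi)) + c * complex.Re (u t * fker (t, xi))) = 0.
  apply: (@Rintegral_coord_derive0 i (fun t => complex.Im (u t * fker (t, xi))) _ C (C' + `|c| * C)).
  - exact: mue.2.
  - by apply: measurable_funD; [exact: mwe.2|apply: measurable_funM => //; exact: mue.1].
  - by move=> t; apply: le_trans (nue t); exact: nrm_Im.
  - move=> t; apply: le_trans (ler_normD _ _) _; rewrite normrM mulrDl -mulrA lerD//.
      by apply: le_trans (nwe t); exact: nrm_Im.
    by rewrite ler_wpM2l//; apply: le_trans (nue t); exact: nrm_Re.
  - move=> h t.
    have D := is_derive_add (is_derive_mul (dur h t) (dsin h t)) (is_derive_mul (dui h t) (dcos h t)).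
    have E : (fun k => complex.Im (u (tshift (cshift i k) t) * fker (tshift (cshift i k) t, xi))) =
      (fun k => complex.Re (f (rv (tshift (cshift i k) t))) * sin (- (2 * pi * dott (tshift (cshift i k) t) xi)) +
       complex.Im (f (rv (tshift (cshift i k) t))) * cos (- (2 * pi * dott (tshift (cshift i k) t) xi))).
      by apply/funext => k; rewrite cImM.
    rewrite E; apply: (is_derive_eq D).
    by rewrite cReM cImM /fker /w /u /=; ring.
have re1 : complex.Re (ft w xi) = c * complex.Im (ft u xi).
  move: re0; have -> := RintegralD measurableT iwe.1 (integrable_scale (- c) iue.2).
  have -> := RintegralZl (- c) measurableT iue.2.
  by move/eqP; rewrite mulNr subr_eq0 => /eqP.
have im1 : complex.Im (ft w xi) = - (c * complex.Re (ft u xi)).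
  move: im0; have -> := RintegralD measurableT iwe.2 (integrable_scale c iue.1).
  have -> := RintegralZl c measurableT iue.1.
  by move/eqP; rewrite addr_eq0 => /eqP.
rewrite -normrN -/c; apply/eqP; rewrite -(@eqrXn2 _ 2) ?mulr_ge0 ?nrm_ge0//.
rewrite exprMn !nrm_sqr re1 im1 real_normK ?num_real//.
by apply/eqP; ring.
Qed.

(** Differentiating [k] times in direction [i] multiplies the modulus of the transform by
    [|2 pi xi_i|^k], and the result is bounded by an L^1 norm; the factor [2 pi >= 1] is dropped. *)
Lemma ft_rapid f : schwartz f -> rapid (ft (fun t => f (rv t))).
Proof.
move=> sf; apply: rapid_coord.
  by exists (\int[mu]_t nrm (f (rv t))) => t; exact/nrm_ft_le/schwartz_cintegrable.
move=> i k.
have [g sg E] : exists2 g, schwartz g & forall xi, nrm (ft (fun t => g (rv t)) xi) =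
    `|2 * pi * tnth xi i| ^+ k * nrm (ft (fun t => f (rv t)) xi).
  elim: k => [|k [g sg E]]; first by exists f => // xi; rewrite expr0 mul1r.
  exists (partial i g) => [|xi]; first exact: schwartz_partial.
  by rewrite ft_partial// E exprS mulrA.
exists (\int[mu]_t nrm (g (rv t))) => t.
apply: le_trans (nrm_ft_le t (schwartz_cintegrable sg)).
rewrite E ler_wpM2r ?nrm_ge0// lerXn2r ?nnegrE// normrM ler_peMl//.
rewrite ger0_norm ?mulr_ge0 ?pi_ge0//.
by have := @pi_ge2 R; lra.
Qed.

(* Stable under (u, v) |-> (conj v, conj u), so that one-sided estimates apply in
   both directions. *)
Definition fourier_pair u v :=
  [/\ cmeas u, cmeas v, rapid u, rapid v & v = ft u /\ (fun t => conjc (u t)) = ft (fun t => conjc (v t))].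

Lemma fourier_pair_sym u v : fourier_pair u v ->
  fourier_pair (fun t => conjc (v t)) (fun t => conjc (u t)).
Proof.
move=> [mu' mv ru rv' [E1 E2]]; split; [exact: cmeas_conj|exact: cmeas_conj|exact: rapid_conj|exact: rapid_conj|].
split=> //; rewrite [LHS](_ : _ = v); last by apply/funext => t; rewrite conjcK.
by rewrite [X in _ = ft X](_ : _ = u)//; apply/funext => t; rewrite conjcK.
Qed.

(** The second identity of a pair is the complex conjugate of the inversion formula, which applies
    because the transform is rapidly decreasing, hence integrable. *)
Lemma schwartz_fourier_pair f : schwartz f ->
  fourier_pair (fun t => f (rv t)) (ft (fun t => f (rv t))).
Proof.
move=> sf; set u := fun t => f (rv t).
have mu' : cmeas u := schwartz_cmeas sf.
have ru : rapid u := schwartz_rapid sf.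
have rft : rapid (ft u) := ft_rapid sf.
have mft := cmeas_ft mu'.
have ift := rapid_cintegrable mft rft.
split => //; split => //; apply/funext => x.
have [B uB] := rapid_bounded ru.
have inv := @fourier_inversion _ _ u x B (schwartz_cintegrable sf) uB _ ift.
rewrite -inv => [|e e0].
  rewrite -cint_conj.
    by apply: eq_cint => xi; rewrite conjM conj_expi /fker /= dottC.
  apply: (@cintegrable_bounded_mul _ _ _ _ _ _ 1) => //.
    by apply: cmeas_expi; exact: measurable_dott2.
  by move=> xi; rewrite nrm_expi.
have [[c1 _] [c2 _]] := sf.1 [::].
have e2 : 0 < e / 2 by rewrite divr_gt0.
have [d1 d10 h1] := continuous_rv (c1 (rv x)) e2.
have [d2 d20 h2] := continuous_rv (c2 (rv x)) e2.
exists (Num.min d1 d2) => [|y yx]; first by rewrite lt_min d10.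
apply: le_trans (nrm_le_ReIm _) _.
have yx1 i : `|rv y 0 i - rv x 0 i| < d1 by rewrite !mxE; apply: lt_le_trans (yx i) _; rewrite ge_min lexx.
have yx2 i : `|rv y 0 i - rv x 0 i| < d2 by rewrite !mxE; apply: lt_le_trans (yx i) _; rewrite ge_min lexx orbT.
have := h1 _ yx1; have := h2 _ yx2; rewrite /= /u !raddfB /=; lra.
Qed.

End SchwartzPair.

(** * Lower bounds *)

Section PowerFacts.
Context {R : realType}.
Implicit Types x y p : R.

Lemma powR_add_le x y p : 0 <= x -> 0 <= y -> 0 <= p ->
  (x + y) `^ p <= 2 `^ p * (x `^ p + y `^ p).
Proof.
wlog xy : x y / x <= y => [h|] x0 y0 p0.
  have [/h|/ltW/h] := leP x y; first exact.
  by rewrite [x + y]addrC [x `^ p + _]addrC; apply.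
apply: (@le_trans _ _ ((2 * y) `^ p)).
  by apply: ge0_ler_powR => //; rewrite ?nnegrE ?addr_ge0 ?mulr_ge0//; lra.
rewrite powRM// ler_wpM2l ?powR_ge0// lerDr powR_ge0//.
Qed.

Lemma le_powR x y p : 0 <= p -> 0 <= x -> x <= y -> x `^ p <= y `^ p.
Proof. by move=> p0 x0 xy; apply: ge0_ler_powR => //; rewrite nnegrE// (le_trans x0). Qed.

Lemma powR_le_self x p : 0 <= x -> x <= 1 -> 1 <= p -> x `^ p <= x.
Proof.
move=> x0 x1 p1; have [->|xn] := eqVneq x 0; first by rewrite powR0// gt_eqF// (lt_le_trans ltr01).
by rewrite ge1r_powR// lt_neqAle eq_sym xn x0.
Qed.

Lemma powR_le1 x p : 0 <= x -> x <= 1 -> 0 <= p -> x `^ p <= 1.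
Proof. by move=> x0 x1 p0; have := le_powR p0 x0 x1; rewrite powR1. Qed.

End PowerFacts.

Section Tuples.
Context {R : realType} {d : nat}.
Local Notation mu := (lebesgue_tuple R d).
Local Notation T := (d.-tuple R).
Implicit Types (x y xi t : T) (u v : T -> R[i]).

Lemma measurable_powRT (f : T -> R) p : measurable_fun setT f ->
  measurable_fun setT (fun t => f t `^ p).
Proof. by move=> mf; exact: (measurableT_comp (measurable_powR p) mf). Qed.

(** As [Wt <= 1] and [1 <= p], [Wt^p <= Wt]: one weight serves all exponents. *)
Lemma integrable_powR_Wt (g : T -> R) (C p : R) : measurable_fun setT g -> 1 <= p ->
  (forall t, 0 <= g t) -> (forall t, g t <= C * Wt t) ->
  mu.-integrable setT (EFin \o (fun t => g t `^ p)).
Proof.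
move=> mg p1 g0 gC.
have p0 : 0 <= p by rewrite (le_trans ler01).
have C0 : 0 <= C.
  by have := le_trans (g0 [tuple 0 | i < d]) (gC _); rewrite pmulr_lge0// Wt_gt0.
apply: (@integrable_le_Wt _ _ _ (C `^ p)); first exact: measurable_powRT.
move=> t; rewrite ger0_norm ?powR_ge0//.
have W0 := ltW (Wt_gt0 t).
apply: (@le_trans _ _ ((C * Wt t) `^ p)); first exact: le_powR.
rewrite powRM// ler_wpM2l ?powR_ge0// powR_le_self//.
exact: Wt_le1.
Qed.

Lemma integrable_nrm_powR u p : 1 <= p -> cmeas u -> rapid u ->
  mu.-integrable setT (EFin \o (fun t => nrm (u t) `^ p)).
Proof.
move=> p1 mu' /rapid_Wt[C uC]; apply: (integrable_powR_Wt _ p1 _ uC) => [|t].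
  exact: cmeas_nrm.
exact: nrm_ge0.
Qed.

Lemma integrable_en_powR u p : 1 <= p -> cmeas u -> rapid u ->
  mu.-integrable setT (EFin \o (fun t => en t `^ p * nrm (u t) `^ p)).
Proof.
move=> p1 mu' /rapid_en_Wt[C uC].
under eq_fun do rewrite -powRM ?en_ge0 ?nrm_ge0//.
apply: (@integrable_powR_Wt (fun t => en t * nrm (u t)) C) => // [|t].
  by apply: measurable_funM; [exact: measurable_en|exact: cmeas_nrm].
by rewrite mulr_ge0 ?en_ge0 ?nrm_ge0.
Qed.

Lemma ft_eq0 u (p : R) : 0 < p -> cintegrable mu u ->
  mu.-integrable setT (EFin \o (fun t => nrm (u t) `^ p)) ->
  \int[mu]_t nrm (u t) `^ p = 0 -> forall xi, ft u xi = 0.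
Proof.
move=> p0 iu iup h xi; apply: nrm_eq0; apply/eqP; rewrite eq_le nrm_ge0 andbT.
apply: le_trans (nrm_ft_le xi iu) _.
rewrite /Rintegral (integral_powR_eq0 (q := p))//.
- by apply: cmeas_nrm; exact: cintegrable_meas iu.
- by move=> x; exact: nrm_ge0.
- by rewrite (integral_EFin_Rintegral iup) h.
Qed.

(** The norm of [v] is treated first: if it vanished, the transform of [conj v], that is [conj u],
    would vanish at every point, against [u t != 0]. If that of [u] vanished, so would [v].
    Inversion thus replaces an argument by continuity. *)
Lemma fourier_pair_Lp_gt0 u v (p : R) : 1 <= p -> fourier_pair u v -> (exists t, u t != 0) ->
  0 < \int[mu]_t nrm (u t) `^ p /\ 0 < \int[mu]_t nrm (v t) `^ p.
Proof.
move=> p1 [mu' mv ru rv' [E1 E2]] [t0 ut0].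
have p0 : 0 < p by rewrite (lt_le_trans ltr01).
have iu := rapid_cintegrable mu' ru.
have vn0 : \int[mu]_t nrm (v t) `^ p != 0.
  apply/eqP => h.
  have h' : \int[mu]_t nrm (conjc (v t)) `^ p = 0.
    by rewrite -[RHS]h; apply: eq_Rintegral => t _; rewrite nrm_conj.
  have := ft_eq0 p0 (rapid_cintegrable (cmeas_conj mv) (rapid_conj rv'))
    (integrable_nrm_powR p1 (cmeas_conj mv) (rapid_conj rv')) h' t0.
  rewrite -E2 => /(congr1 conjc); rewrite conjcK => h0.
  by move: ut0; rewrite h0 /= oppr0 eqxx.
have un0 : \int[mu]_t nrm (u t) `^ p != 0.
  apply/eqP => h; move/eqP : vn0; apply.
  have z := ft_eq0 p0 iu (integrable_nrm_powR p1 mu' ru) h.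
  rewrite E1; under eq_Rintegral do rewrite z Normc.normc0 powR0 ?gt_eqF//.
  by rewrite Rintegral_cst// mul0r.
by split; rewrite lt_neqAle eq_sym ?un0 ?vn0 Rintegral_ge0// => t _; exact: powR_ge0.
Qed.

Lemma measurable_ballb (r : R) : measurable_fun setT (fun t => en t <= r).
Proof. by apply: measurable_fun_ler => //; exact: measurable_en. Qed.

(** Not the volume of the ball but the exponential bound [(2 pi e r^2 / d)^(d / 2)]. In this form
    the product of two such bounds is a pure power [d]. *)
Definition ball_vol (r : R) : R := Num.sqrt (2 * pi * expR 1 * r ^+ 2 / d%:R) ^+ d.

(* Markov's inequality for exp (- l |t|^2) with the optimal l = d / (2 r^2). *)
Lemma ball_vol_le (r : R) : (0 < d)%N -> 0 < r ->
  (\int[mu]_t (if en t <= r then 1 else 0)%:E <= (ball_vol r)%:E)%E.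
Proof.
move=> d0 r0; pose l : R := d%:R / (2 * r ^+ 2).
have dR : 0 < d%:R :> R by rewrite ltr0n.
have r2 : 0 < r ^+ 2 by exact: exprn_gt0.
have l0 : 0 < l by rewrite divr_gt0 ?mulr_gt0.
have ig := integrable_gauss (fun=> 0) l0 (d := d).
have gE t : gauss l (fun=> 0) t = expR (- (l * en t ^+ 2)).
  by rewrite gaussE en_sqr; congr (expR (- (_ * _))); apply: eq_bigr => i _; rewrite subr0.
apply: (@le_trans _ _ (\int[mu]_t (expR (l * r ^+ 2) * gauss l (fun=> 0) t)%:E)%E).
  apply: ge0_le_integral => //.
  - by move=> t _; case: ifP.
  - by apply/measurable_EFinP; apply: measurable_fun_ifT => //; exact: measurable_ballb.
  - by apply/measurable_EFinP; apply: measurable_funM => //; exact: measurable_gauss.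
  move=> t _; rewrite lee_fin gE -expRD; case: ifP => [tr|_]; last exact: expR_ge0.
  rewrite -expR0 ler_expR -mulrBr mulr_ge0 ?(ltW l0)// subr_ge0.
  by rewrite lerXn2r ?nnegrE ?en_ge0// ltW.
have -> := integral_EFin_Rintegral (integrable_scale (expR (l * r ^+ 2)) ig).
rewrite RintegralZl// Rintegral_gauss// lee_fin le_eqVlt; apply/orP; left; apply/eqP.
have -> : expR (l * r ^+ 2) = Num.sqrt (expR 1) ^+ d.
  rewrite -powR12_sqrt ?expR_ge0// -[RHS]powR_mulrn ?powR_ge0// -powRrM -expRM.
  by congr expR; rewrite /l; field; rewrite gt_eqF.
rewrite -exprMn /ball_vol /gaussK -sqrtrM ?expR_ge0//; congr (Num.sqrt _ ^+ _).
by rewrite /l; move: (pi) (expR 1) => P E; field; rewrite !gt_eqF.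
Qed.

Lemma ball_vol_gt0 (r : R) : (0 < d)%N -> 0 < r -> 0 < ball_vol r.
Proof.
move=> d0 r0; rewrite exprn_gt0// sqrtr_gt0 divr_gt0 ?ltr0n// !mulr_gt0 ?expR_gt0 ?pi_gt0//.
Qed.

Lemma ball_volM (r s : R) : 0 < r -> 0 < s ->
  ball_vol r * ball_vol s = (2 * pi * expR 1 / d%:R * (r * s)) ^+ d.
Proof.
move=> r0 s0; rewrite /ball_vol -exprMn; congr (_ ^+ _).
have k0 : 0 <= 2 * pi * expR 1 / d%:R :> R by rewrite divr_ge0// !mulr_ge0 ?expR_ge0 ?pi_ge0.
have E (x : R) : 0 < x -> Num.sqrt (2 * pi * expR 1 * x ^+ 2 / d%:R) = Num.sqrt (2 * pi * expR 1 / d%:R) * x.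
  by move=> x0; rewrite mulrAC sqrtrM// sqrtr_sqr ger0_norm// ltW.
rewrite !E// mulrACA -expr2 sqr_sqrtr//.
Qed.

(* f <= c + c^(1-s) f^s pointwise, with c^s = I / beta. *)
Lemma set_integral_le (b : T -> bool) (f : T -> R) (s beta I : R) :
  measurable_fun setT b -> measurable_fun setT f -> (forall t, 0 <= f t) -> 1 <= s ->
  0 < beta -> 0 < I ->
  (\int[mu]_t (if b t then 1 else 0)%:E <= beta%:E)%E ->
  (\int[mu]_t (f t `^ s)%:E <= I%:E)%E ->
  (\int[mu]_t (if b t then f t else 0)%:E <= (2 * (beta `^ (1 - s^-1) * I `^ s^-1))%:E)%E.
Proof.
move=> mb mf f0 s1 b0 I0 hb hI.
have s0 : 0 < s by rewrite (lt_le_trans ltr01).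
pose c := (I / beta) `^ s^-1.
have Ib : 0 < I / beta by rewrite divr_gt0.
have c0 : 0 < c by rewrite powR_gt0.
have mi : measurable_fun setT (fun t => if b t then 1 else 0 : R) by exact: measurable_fun_ifT.
apply: (@le_trans _ _ (\int[mu]_t (c * (if b t then 1 else 0))%:E + \int[mu]_t (c `^ (1 - s) * f t `^ s)%:E)%E).
  rewrite -ge0_integralD//; first last.
  - by apply/measurable_EFinP; apply: measurable_funM => //; exact: measurable_powRT.
  - by move=> t _; rewrite lee_fin mulr_ge0 ?powR_ge0.
  - by apply/measurable_EFinP; apply: measurable_funM.
  - by move=> t _; rewrite lee_fin mulr_ge0 ?(ltW c0)//; case: ifP.
  apply: ge0_le_integral => //.
  - by move=> t _; rewrite lee_fin; case: ifP.
  - by apply/measurable_EFinP; exact: measurable_fun_ifT.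
  - apply: emeasurable_funD; apply/measurable_EFinP; apply: measurable_funM => //.
    exact: measurable_powRT.
  move=> t _; rewrite -EFinD lee_fin.
  have h0 : 0 <= c `^ (1 - s) * f t `^ s by rewrite mulr_ge0 ?powR_ge0.
  case: ifP => _; last by rewrite mulr0 add0r.
  rewrite mulr1; have [fc|cf] := leP (f t) c; first by rewrite (le_trans fc)// lerDl.
  apply: (@le_trans _ _ (c `^ (1 - s) * f t `^ s)); last by rewrite lerDr ltW.
  have ft0 : 0 < f t by rewrite (lt_trans c0).
  have -> : c `^ (1 - s) = (c `^ (s - 1))^-1 by rewrite -powRN opprB.
  rewrite -(mulr_powRB1 (f0 t) s0) mulrC -mulrA ler_peMr// ler_pdivlMr ?powR_gt0// mul1r.
  by apply: le_powR; rewrite ?subr_ge0// ltW.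
rewrite ge0_integral_scale//; last 2 first.
- by rewrite ltW.
- by move=> t; case: ifP.
rewrite ge0_integral_scale//; last 3 first.
- exact: measurable_powRT.
- exact: powR_ge0.
- by move=> t; exact: powR_ge0.
apply: (@le_trans _ _ (c%:E * beta%:E + (c `^ (1 - s))%:E * I%:E)%E).
  by apply: leeD; apply: lee_wpmul2l => //; rewrite lee_fin ?powR_ge0// ltW.
rewrite -!EFinM -EFinD lee_fin.
have e1 : c * beta = beta `^ (1 - s^-1) * I `^ s^-1.
  rewrite /c powRM ?invr_ge0 ?(ltW b0) ?(ltW I0)//.
  have -> : beta^-1 = beta `^ (-1) by rewrite powR_inv1// ltW.
  rewrite -powRrM mulN1r powRB ?(gt_eqF b0) ?implybT// powRr1 ?(ltW b0)// powRN.
  by move: (I `^ s^-1) ((beta `^ s^-1)^-1) => A B; ring.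
have e2 : c `^ (1 - s) * I = c * beta.
  rewrite powRB ?(gt_eqF c0) ?implybT// powRr1 ?(ltW c0)//.
  have -> : c `^ s = I / beta by rewrite /c -powRrM mulVf ?gt_eqF// powRr1 ?(ltW Ib).
  rewrite invf_div.
  by rewrite -!mulrA mulVf ?mulr1// gt_eqF.
by rewrite e2 e1 mulr_natl mulr2n.
Qed.

End Tuples.

(* In the product of the two hypotheses F and G cancel, and what remains bounds al * be. *)
Lemma small_p_arith {R : realType} (p K F G al be : R) : 1 < p -> p <= 2 -> 0 < F -> 0 < G ->
  0 < al -> 0 < be -> 1 <= K -> K = 32 * 32 ->
  G * (1 - K^-1) <= F * (4 `^ p * (be * al `^ (p - 1) + 2 * K^-1 * be `^ (2 - p))) ->
  F * (1 - K^-1) <= G * (4 `^ p * (al * be `^ (p - 1) + 2 * K^-1 * al `^ (2 - p))) ->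
  K^-1 <= al * be.
Proof.
move=> p1 p2 F0 G0 a0 b0 K1 KE I1 I2.
have K0 : 0 < K by rewrite (lt_le_trans ltr01).
have Ki0 : 0 < K^-1 by rewrite invr_gt0.
pose X := al * be; rewrite -/X.
have X0 : 0 < X by exact: mulr_gt0.
(* From here on [al * be < 1], so its powers [p - 1] and [2 - p] are at most 1; the second needs
   [p <= 2]. *)
have [X1|X1] := leP 1 X; first by apply: le_trans X1; rewrite invf_le1.
pose w : R := 4 `^ p; pose e := K^-1.
have w0 : 0 < w by rewrite powR_gt0.
have w16 : w <= 16.
  have -> : 16 = 4 `^ 2%:R :> R by rewrite powR_mulrn//; ring.
  apply: ler_powR; last exact: p2.
  by clear; lra.
(* As the exponents [p - 1] and [2 - p] add up to 1, the mixed terms of the product of the two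
   hypotheses become multiples of [al * be]. *)
have pw2 (x : R) : 0 < x -> x `^ (p - 1) * x `^ (2 - p) = x.
  move=> x0; rewrite -powRD ?(gt_eqF x0) ?implybT//.
  by have -> : p - 1 + (2 - p) = 1; [ring|rewrite powRr1// ltW].
have hab : al `^ (p - 1) * be `^ (p - 1) <= 1.
  by rewrite -powRM ?(ltW a0) ?(ltW b0)//; apply: powR_le1; rewrite ?subr_ge0// ltW.
have hab2 : al `^ (2 - p) * be `^ (2 - p) <= 1.
  by rewrite -powRM ?(ltW a0) ?(ltW b0)//; apply: powR_le1; rewrite ?subr_ge0// ltW.
have ha := pw2 _ a0; have hb := pw2 _ b0.
have q1 := powR_ge0 al (p - 1); have q2 := powR_ge0 al (2 - p).
have q3 := powR_ge0 be (p - 1); have q4 := powR_ge0 be (2 - p).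
move: I1 I2 hab hab2 ha hb q1 q2 q3 q4.
rewrite -/w -/e; move: (al `^ (p - 1)) (al `^ (2 - p)) (be `^ (p - 1)) (be `^ (2 - p)) => a a2 b b2.
move=> I1 I2 hab hab2 ha hb q1 q2 q3 q4.
have e0 : 0 < e by [].
have eE : e * (32 * 32) = 1 by rewrite -KE /e mulVf// gt_eqF.
have e1 : 0 <= 1 - e by rewrite subr_ge0 /e invf_le1.
have prod : (G * (1 - e)) * (F * (1 - e)) <=
   (F * (w * (be * a + 2 * e * b2))) * (G * (w * (al * b + 2 * e * a2))).
  by apply: ler_pM I1 I2; rewrite mulr_ge0// ltW.
have E1 : (G * (1 - e)) * (F * (1 - e)) = F * G * (1 - e) ^+ 2 by ring.
have E2 : (F * (w * (be * a + 2 * e * b2))) * (G * (w * (al * b + 2 * e * a2))) =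
   F * G * (w ^+ 2 * (X * (a * b) + 2 * e * (be * (a * a2) + al * (b * b2)) + 4 * e ^+ 2 * (a2 * b2))).
  by rewrite /X; ring.
rewrite E1 E2 ler_pM2l ?mulr_gt0// ha hb in prod.
have w2 : w ^+ 2 <= 16 ^+ 2.
  by rewrite lerXn2r ?nnegrE// ltW.
have h1 : X * (a * b) <= X by rewrite ler_piMr// ltW.
have h2 : e ^+ 2 * (a2 * b2) <= e ^+ 2 by rewrite ler_piMr// sqr_ge0.
have Y0 : 0 <= X * (a * b) + 2 * e * (be * al + al * be) + 4 * e ^+ 2 * (a2 * b2).
  by rewrite !addr_ge0 ?mulr_ge0 ?addr_ge0 ?mulr_ge0 ?sqr_ge0// ltW.
have h3 := ler_wpM2r Y0 w2.
have h4 := le_trans prod h3.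
have E3 : 2 * e * (be * al + al * be) = 4 * e * X by rewrite /X; ring.
rewrite E3 in h4.
(* The choice of [K]: with [e = 1 / 1024] the term [16^2 * 4 e^2] equals [e], and [X < e] would make
   the right-hand side less than [256 e (1 + 4 e) + e], about [1 / 4], while the left-hand side is
   close to 1. *)
have h5 : (1 - e) ^+ 2 <= 16 ^+ 2 * (X + 4 * e * X + 4 * e ^+ 2).
  apply: le_trans h4 _; rewrite ler_wpM2l//.
  by rewrite -[4 * e ^+ 2 * _]mulrA !lerD// ler_wpM2l.
rewrite -/e; have eX : 0 <= e * X by rewrite mulr_ge0// ltW.
have eX2 : (e * X) * (32 * 32) = X by rewrite mulrAC eE mul1r.
have ee2 : e ^+ 2 * (32 * 32) = e by rewrite expr2 -mulrA eE mulr1.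
move: h5 X0 eE eX2 ee2; clear; move: X => Y; set z := e * Y; set q := e ^+ 2.
have -> : (1 - e) ^+ 2 = 1 - 2 * e + q by rewrite /q; ring.
have -> : 4 * e * Y = 4 * z by rewrite /z; ring.
have -> : 16 ^+ 2 * (Y + 4 * z + 4 * q) = 8 * 32 * (Y + 4 * z + 4 * q) :> R by ring.
lra.
Qed.

(** * The range [1 < p <= 2]: concentration on balls *)

Section LowerSmallP.
Context {R : realType} {d : nat}.
Local Notation mu := (lebesgue_tuple R d).
Local Notation T := (d.-tuple R).
Implicit Types (x y xi t : T) (u v : T -> R[i]).

(** The part of [u] on [a] has a transform with p-th power at most a multiple of [alpha^(p - 1) F],
    integrated over [b] of measure at most [beta]; the rest contributes [del * beta^(2 - p)] by
    Hausdorff-Young and Hoelder on [b]. One factor [2^p] of [4^p] comes from splitting the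
    transform, the other from these two estimates. *)
Lemma concentration (a b : T -> bool) u v (p del alpha beta F G : R) :
  1 < p -> p <= 2 -> fourier_pair u v ->
  measurable_fun setT a -> measurable_fun setT b ->
  0 < del -> 0 < alpha -> 0 < beta -> 0 < F ->
  \int[mu]_t nrm (u t) `^ p = F -> \int[mu]_t nrm (v t) `^ p = G ->
  (\int[mu]_t (if a t then 1 else 0)%:E <= alpha%:E)%E ->
  (\int[mu]_t (if b t then 1 else 0)%:E <= beta%:E)%E ->
  \int[mu]_t (if a t then 0 else nrm (u t) `^ p) <= del * F ->
  \int[mu]_t (if b t then 0 else nrm (v t) `^ p) <= del * G ->
  G * (1 - del) <= F * (4 `^ p * (beta * alpha `^ (p - 1) + 2 * del * beta `^ (2 - p))).
Proof.
move=> p1 p2 [mu' mv ru rv' [E1 _]] ma mb del0 a0 b0 F0 hF hG hA hB tA tB.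
have p0 : 0 < p by rewrite (lt_trans ltr01).
have p10 : 0 < p - 1 by rewrite subr_gt0.
have p1' : 1 <= p by exact: ltW.
have iu := rapid_cintegrable mu' ru.
have [_ inu] := (cintegrableP mu u).1 iu.
have iup := integrable_nrm_powR p1' mu' ru.
have ivp := integrable_nrm_powR p1' mv rv'.
have mun := cmeas_nrm mu'.
have mvn := cmeas_nrm mv.
pose u1 t := if a t then u t else 0.
pose u2 t := if a t then 0 else u t.
have mu1 : cmeas u1 by exact: (cmeas_if ma mu' (@cmeas0 R d)).
have mu2 : cmeas u2 by exact: (cmeas_if ma (@cmeas0 R d) mu').
have iu1 : cintegrable mu u1.
  by apply: (cintegrable_le mu1 _ inu) => t; rewrite /u1; case: (a t); rewrite ?Normc.normc0 ?nrm_ge0.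
have iu2 : cintegrable mu u2.
  by apply: (cintegrable_le mu2 _ inu) => t; rewrite /u2; case: (a t); rewrite ?Normc.normc0 ?nrm_ge0.
have vE xi : v xi = ft u1 xi + ft u2 xi by rewrite E1; exact: ft_split.
have mf1 := cmeas_nrm (cmeas_ft mu1).
have mf2 := cmeas_nrm (cmeas_ft mu2).
(* The part of u on the concentration set has small L^1 norm, hence a bounded transform. *)
have bound1 xi : nrm (ft u1 xi) `^ p <= 2 `^ p * (alpha `^ (p - 1) * F).
  have [_ inu1] := (cintegrableP mu _).1 iu1.
  have h : \int[mu]_t nrm (u1 t) <= 2 * (alpha `^ (1 - p^-1) * F `^ p^-1).
    rewrite -lee_fin -(integral_EFin_Rintegral inu1).
    have -> : (\int[mu]_x (nrm (u1 x))%:E = \int[mu]_x (if a x then nrm (u x) else 0)%:E)%E.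
      by apply: eq_integral => t _; rewrite /u1; case: (a t); rewrite ?Normc.normc0.
    apply: set_integral_le => //; first by move=> t; exact: nrm_ge0.
    by rewrite (integral_EFin_Rintegral iup) hF.
  have h2 := le_trans (nrm_ft_le xi iu1) h.
  apply: le_trans (le_powR (ltW p0) (nrm_ge0 _) h2) _.
  rewrite powRM ?mulr_ge0 ?powR_ge0// powRM ?powR_ge0// -!powRrM mulVf ?gt_eqF// powRr1 ?(ltW F0)//.
  by rewrite mulrBl mulVf ?gt_eqF// mul1r.
(* The rest has small L^p norm, hence a small transform in L^P by Hausdorff-Young. *)
pose P := p / (p - 1).
have PE : P - 1 = (p - 1)^-1 by rewrite /P; field; rewrite gt_eqF.
have PP : P * (p - 1) = p by rewrite /P divfK// gt_eqF.
have i2p : mu.-integrable setT (EFin \o (fun t => nrm (u2 t) `^ p)).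
  apply: (integrable_le _ _ iup); first by apply: measurable_powRT; exact: cmeas_nrm.
  move=> t; rewrite ger0_norm ?powR_ge0// /u2; case: (a t) => //.
  by rewrite Normc.normc0 powR0 ?powR_ge0// gt_eqF.
have hy := hausdorff_young p1 p2 iu2 i2p erefl.
have S2 : \int[mu]_x nrm (u2 x) `^ p <= del * F.
  apply: le_trans tA; rewrite le_eqVlt; apply/orP; left; apply/eqP.
  apply: eq_Rintegral => t _; rewrite /u2; case: (a t) => //.
  by rewrite Normc.normc0 powR0// gt_eqF.
have dF0 : 0 < del * F by exact: mulr_gt0.
have hy2 : (\int[mu]_xi ((nrm (ft u2 xi) `^ p) `^ (p - 1)^-1)%:E <= (2 `^ P * (del * F) `^ (P - 1))%:E)%E.
  have -> : (\int[mu]_xi ((nrm (ft u2 xi) `^ p) `^ (p - 1)^-1)%:E = \int[mu]_xi (nrm (ft u2 xi) `^ P)%:E)%E.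
    by apply: eq_integral => xi _; rewrite -powRrM.
  apply: le_trans hy _; rewrite lee_fin ler_wpM2l ?powR_ge0//.
  apply: le_powR => //; first by rewrite -/P PE invr_ge0 ltW.
  by apply: Rintegral_ge0 => t _; exact: powR_ge0.
(* Here [set_integral_le] is used with exponent [s = 1 / (p - 1) >= 1], for which [p s = P] and
   [1 - 1 / s = 2 - p]. *)
have bound2 : (\int[mu]_t (if b t then nrm (ft u2 t) `^ p else 0)%:E <=
    (2 * (beta `^ (2 - p) * (2 `^ p * (del * F))))%:E)%E.
  have -> : 2 * (beta `^ (2 - p) * (2 `^ p * (del * F))) =
     2 * (beta `^ (1 - ((p - 1)^-1)^-1) * (2 `^ P * (del * F) `^ (P - 1)) `^ ((p - 1)^-1)^-1).
    rewrite invrK powRM ?powR_ge0// -!powRrM PP PE mulVf ?gt_eqF// powRr1 ?(ltW dF0)//.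
    by congr (_ * (_ `^ _ * _)); ring.
  apply: set_integral_le => //.
  - exact: measurable_powRT.
  - by move=> t; exact: powR_ge0.
  - by rewrite invf_ge1// lerBlDr.
  - by rewrite mulr_gt0 ?powR_gt0.
have Gsplit : (G%:E <= \int[mu]_t (if b t then nrm (v t) `^ p else 0)%:E + (del * G)%:E)%E.
  have mb1 : measurable_fun setT (fun t => if b t then nrm (v t) `^ p else 0 : R).
    by apply: measurable_fun_ifT => //; exact: measurable_powRT.
  have mb2 : measurable_fun setT (fun t => if b t then 0 else nrm (v t) `^ p : R).
    by apply: measurable_fun_ifT => //; exact: measurable_powRT.
  have i3 : mu.-integrable setT (EFin \o (fun t => if b t then 0 else nrm (v t) `^ p)).
    by apply: (integrable_le mb2 _ ivp) => t; case: (b t); rewrite ?normr0 ?powR_ge0// ger0_norm ?powR_ge0.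
  apply: (@le_trans _ _ (\int[mu]_t (if b t then nrm (v t) `^ p else 0)%:E +
     \int[mu]_t (if b t then 0 else nrm (v t) `^ p)%:E)%E).
    rewrite -ge0_integralD//; first last.
    - exact/measurable_EFinP.
    - by move=> t _; rewrite lee_fin; case: (b t); rewrite ?powR_ge0.
    - exact/measurable_EFinP.
    - by move=> t _; rewrite lee_fin; case: (b t); rewrite ?powR_ge0.
    rewrite -hG -(integral_EFin_Rintegral ivp) le_eqVlt; apply/orP; left; apply/eqP.
    by apply: eq_integral => t _; rewrite -EFinD; case: (b t); rewrite ?addr0 ?add0r.
  by apply: leeD => //; rewrite (integral_EFin_Rintegral i3) lee_fin.
have Bpart : (\int[mu]_t (if b t then nrm (v t) `^ p else 0)%:E <=
   (2 `^ p * (beta * (2 `^ p * (alpha `^ (p - 1) * F)) + 2 * (beta `^ (2 - p) * (2 `^ p * (del * F)))))%:E)%E.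
  pose k1 := 2 `^ p * (alpha `^ (p - 1) * F).
  have k10 : 0 <= k1 by rewrite mulr_ge0 ?mulr_ge0 ?powR_ge0// ltW.
  have m1 : measurable_fun setT (fun t => if b t then 1 else 0 : R) by exact: measurable_fun_ifT.
  have m2 : measurable_fun setT (fun t => if b t then nrm (ft u2 t) `^ p else 0 : R).
    by apply: measurable_fun_ifT => //; exact: measurable_powRT.
  have z1 t : 0 <= k1 * (if b t then 1 else 0 : R) by rewrite mulr_ge0//; case: (b t).
  have z2 t : 0 <= (if b t then nrm (ft u2 t) `^ p else 0 : R) by case: (b t); rewrite ?powR_ge0.
  apply: (@le_trans _ _ (\int[mu]_t (2 `^ p * (k1 * (if b t then 1 else 0) + (if b t then nrm (ft u2 t) `^ p else 0)))%:E)%E).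
    apply: ge0_le_integral => //.
    - by move=> t _; rewrite lee_fin; case: (b t); rewrite ?powR_ge0.
    - by apply/measurable_EFinP; apply: measurable_fun_ifT => //; exact: measurable_powRT.
    - apply/measurable_EFinP; apply: measurable_funM => //.
      by apply: measurable_funD => //; exact: measurable_funM.
    move=> t _; rewrite lee_fin; case: (b t); last by rewrite mulr0 addr0 mulr0.
    rewrite mulr1 vE.
    apply: (le_trans (le_powR (ltW p0) (nrm_ge0 _) (le_normcD _ _))).
    apply: (le_trans (powR_add_le (nrm_ge0 _) (nrm_ge0 _) (ltW p0))).
    by rewrite ler_wpM2l ?powR_ge0// lerD2r; exact: bound1.
  rewrite ge0_integral_scale ?powR_ge0//; last 2 first.
  - by apply: measurable_funD => //; exact: measurable_funM.
  - by move=> t; rewrite addr_ge0.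
  rewrite EFinM; apply: lee_wpmul2l; first by rewrite lee_fin powR_ge0.
  under eq_integral => t _ do rewrite EFinD.
  rewrite ge0_integralD//; first last.
  - exact/measurable_EFinP.
  - by move=> t _; rewrite lee_fin; exact: z2.
  - by apply/measurable_EFinP; exact: measurable_funM.
  - by move=> t _; rewrite lee_fin; exact: z1.
  rewrite EFinD; apply: leeD => //.
  rewrite ge0_integral_scale//; last by move=> t; case: (b t).
  by rewrite -/k1 [beta * k1]mulrC [leRHS]EFinM; apply: lee_wpmul2l; rewrite ?lee_fin.
have : (G%:E <= (2 `^ p * (beta * (2 `^ p * (alpha `^ (p - 1) * F)) + 2 * (beta `^ (2 - p) * (2 `^ p * (del * F)))) + del * G)%:E)%E.
  by apply: le_trans Gsplit _; rewrite EFinD leeD2r.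
rewrite lee_fin => h.
have -> : (4 : R) `^ p = 2 `^ p * 2 `^ p.
  by rewrite -powRM//; congr (_ `^ _); ring.
move: h; move: (2 `^ p) (alpha `^ (p - 1)) (beta `^ (2 - p)) => K A B h.
have -> : F * (K * K * (beta * A + 2 * del * B)) = K * (beta * (K * (A * F)) + 2 * (B * (K * (del * F)))) by ring.
by rewrite mulrBr mulr1 lerBlDr [G * del]mulrC.
Qed.

(** Markov's inequality gives the fraction [K^(-p)]; weakening it to [K^-1] makes the choice of [K]
    independent of [p]. *)
Lemma tail_le u (p r F : R) (K : R) : 1 <= p -> cmeas u -> rapid u -> 0 < r -> 1 <= K ->
  \int[mu]_t (en t `^ p * nrm (u t) `^ p) <= r `^ p * F ->
  \int[mu]_t (if en t <= K * r then 0 else nrm (u t) `^ p) <= K^-1 * F.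
Proof.
move=> p1 mu' ru r0 K1 hM.
have K0 : 0 < K by rewrite (lt_le_trans ltr01).
have p0 : 0 <= p by rewrite (le_trans ler01).
have Kr0 : 0 < K * r by exact: mulr_gt0.
have c0 : 0 < (K * r) `^ p by rewrite powR_gt0.
have iM := integrable_en_powR p1 mu' ru.
have mn := cmeas_nrm mu'.
have F0 : 0 <= r `^ p * F.
  by apply: le_trans hM; apply: Rintegral_ge0 => t _; rewrite mulr_ge0 ?powR_ge0.
have F0' : 0 <= F by move: F0; rewrite pmulr_rge0// powR_gt0.
have pw t : (if en t <= K * r then 0 else nrm (u t) `^ p) <=
    ((K * r) `^ p)^-1 * (en t `^ p * nrm (u t) `^ p).
  case: ifP => [_|/negbT]; first by rewrite !mulr_ge0 ?powR_ge0// invr_ge0 ltW.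
  rewrite -ltNge => h; rewrite mulrA ler_peMl ?powR_ge0// mulrC ler_pdivlMr// mul1r.
  by apply: le_powR => //; exact: ltW.
have z t : 0 <= (if en t <= K * r then 0 else nrm (u t) `^ p) by case: ifP; rewrite ?powR_ge0.
have iR := integrable_scale ((K * r) `^ p)^-1 iM.
apply: (@le_trans _ _ (\int[mu]_t (((K * r) `^ p)^-1 * (en t `^ p * nrm (u t) `^ p)))).
  apply: le_Rintegral => //.
  apply: (integrable_le _ _ iR) => [|t]; last by rewrite ger0_norm.
  by apply: measurable_fun_ifT => //; [exact: measurable_ballb|exact: measurable_powRT].
rewrite RintegralZl//; apply: (@le_trans _ _ (((K * r) `^ p)^-1 * (r `^ p * F))).
  by rewrite ler_wpM2l// invr_ge0 ltW.
have rp : r `^ p != 0 by rewrite gt_eqF// powR_gt0.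
rewrite powRM ?(ltW K0) ?(ltW r0)// invfM -mulrA mulKf// ler_wpM2r//.
by rewrite lef_pV2 ?posrE ?powR_gt0//; exact: le1r_powR.
Qed.

Lemma lower_small_p u v (p r s : R) : (0 < d)%N -> 1 < p -> p <= 2 -> fourier_pair u v ->
  (exists t, u t != 0) -> 0 < r -> 0 < s ->
  \int[mu]_t (en t `^ p * nrm (u t) `^ p) <= r `^ p * \int[mu]_t (nrm (u t) `^ p) ->
  \int[mu]_t (en t `^ p * nrm (v t) `^ p) <= s `^ p * \int[mu]_t (nrm (v t) `^ p) ->
  d%:R / (2 * pi * expR 1 * 32 ^+ 6) <= r * s.
Proof.
move=> d0 p1 p2 uv un0 r0 s0 hu hv.
have p1' := ltW p1.
have p0 : 0 < p by rewrite (lt_trans ltr01).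
have [F0 G0] := fourier_pair_Lp_gt0 p1' uv un0.
set F := \int[mu]_t nrm (u t) `^ p in hu F0; set G := \int[mu]_t nrm (v t) `^ p in hv G0.
have [mu' mv ru rv' _] := uv.
pose K : R := 32 * 32.
have K1 : 1 <= K by rewrite /K; clear; lra.
have K0 : 0 < K by rewrite (lt_le_trans ltr01).
have tu := tail_le p1' mu' ru r0 K1 hu.
have tv := tail_le p1' mv rv' s0 K1 hv.
have Kr0 : 0 < K * r by exact: mulr_gt0.
have Ks0 : 0 < K * s by exact: mulr_gt0.
have a0 := @ball_vol_gt0 R d _ d0 Kr0.
have b0 := @ball_vol_gt0 R d _ d0 Ks0.
have hA := @ball_vol_le R d _ d0 Kr0.
have hB := @ball_vol_le R d _ d0 Ks0.
have Ki0 : 0 < K^-1 by rewrite invr_gt0.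
have uv' := fourier_pair_sym uv.
have mba := @measurable_ballb R d (K * r); have mbb := @measurable_ballb R d (K * s).
have I1 := concentration p1 p2 uv mba mbb Ki0 a0 b0 F0 erefl erefl hA hB tu tv.
have I2 : F * (1 - K^-1) <= G * (4 `^ p * (ball_vol (d := d) (K * r) * ball_vol (d := d) (K * s) `^ (p - 1) +
    2 * K^-1 * ball_vol (d := d) (K * r) `^ (2 - p))).
  apply: (concentration p1 p2 uv' mbb mba Ki0 b0 a0 G0 _ _ hB hA).
  - by apply: eq_Rintegral => t _; rewrite nrm_conj.
  - by apply: eq_Rintegral => t _; rewrite nrm_conj.
  - by under eq_Rintegral do rewrite nrm_conj.
  - by under eq_Rintegral do rewrite nrm_conj.
set al := ball_vol (K * r) in I1 I2 a0; set be := ball_vol (K * s) in I1 I2 b0.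
pose X := al * be.
have X0 : 0 < X by exact: mulr_gt0.
have XE : X = (2 * pi * expR 1 / d%:R * (K * r * (K * s))) ^+ d by exact: ball_volM.
have Xlow : K^-1 <= X by exact: (small_p_arith p1 p2 F0 G0 a0 b0 K1 erefl I1 I2).
pose y := 2 * pi * expR 1 / d%:R * (K * r * (K * s)).
have dR : 0 < d%:R :> R by rewrite ltr0n.
have y0 : 0 < y by rewrite !mulr_gt0 ?invr_gt0 ?pi_gt0 ?expR_gt0.
(* The dimension drops out here: [y < 1 / K <= 1] would give [X = y^d <= y < 1 / K]. *)
have ylow : K^-1 <= y.
  rewrite leNgt; apply/negP => ylt.
  have y1 : y <= 1 by apply: le_trans (ltW ylt) _; rewrite invf_le1.
  have : X <= y.
    by rewrite XE -/y -[leRHS]expr1; apply: ler_wiXn2l => //; rewrite ltW.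
  by rewrite leNgt (lt_le_trans ylt Xlow).
rewrite ler_pdivrMr; last by rewrite !mulr_gt0 ?exprn_gt0 ?pi_gt0 ?expR_gt0.
have := ylow; rewrite -[X in X <= _]mul1r ler_pdivrMr//.
(* Two factors [K] come from the radii [K r] and [K s], one from the lower bound on [y]:
   [K^3 = 32^6]. *)
have -> : y * K = (r * s * (2 * pi * expR 1 * 32 ^+ 6)) / d%:R.
  by rewrite /y /K; move: (pi) (expR 1) (d%:R^-1) => P E D; ring.
by rewrite ler_pdivlMr// mul1r.
Qed.

End LowerSmallP.

(** * The range [2 < p < 2 d / (d - 1)]: a weighted Hoelder estimate *)

Section PowerWeight.
Context {R : realType}.
Local Notation leb := (@lebesgue_measure R).

Lemma continuous_at_powR (x a : R) : 0 < x -> {for x, continuous (fun y : R => y `^ a)}.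
Proof.
move=> x0; apply/differentiable_continuous/derivable1_diffP.
exact: (@ex_derive _ _ _ _ _ _ _ (is_derive1_powR a x0)).
Qed.

Lemma cvg_powR_shift_oppr (r a : R) : 0 < r -> 0 < a ->
  (r + x) `^ (- a) @[x --> +oo%R] --> (0 : R).
Proof.
move=> r0 a0; apply/cvgrPdist_le => e e0.
near=> x.
have x0 : 0 < x by near: x; exact: nbhs_pinfty_gt.
have xe : e `^ (- a^-1) <= x by near: x; apply: nbhs_pinfty_ge; exact: num_real.
have rx : 0 < r + x by rewrite addr_gt0.
rewrite sub0r normrN ger0_norm ?powR_ge0//.
rewrite powRN -[e]invrK lef_pV2 ?posrE ?invr_gt0 ?powR_gt0//.
have -> : e^-1 = (e `^ (- a^-1)) `^ a.
  by rewrite -powRrM mulNr mulVf ?gt_eqF// powR_inv1// ltW.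
apply: le_powR; [exact: ltW|exact: powR_ge0|].
by apply: le_trans xe _; rewrite lerDr ltW.
Unshelve. all: by end_near. Qed.

Lemma integral_powR_weight (r s : R) : 0 < r -> 1 < s ->
  (\int[leb]_x ((r + `|x|) `^ (- s))%:E = (2 * (r `^ (1 - s) / (s - 1)))%:E)%E.
Proof.
move=> r0 s1; have s10 : 0 < s - 1 by rewrite subr_gt0.
pose f (x : R) := (r + x) `^ (- s).
pose F (x : R) := - ((r + x) `^ (- (s - 1)) / (s - 1)).
have cnorm (x : R) : {for x, continuous (fun x : R => r + `|x|)}.
  by apply: cvgD; [exact: cvg_cst|exact: norm_continuous].
rewrite ge0_symfun_integralT.
- rewrite (_ : [set x | 0 <= x] = [set` Interval (BLeft 0) (BInfty _ false)]); last by rewrite set_itvcy.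
  rewrite (_ : (\int[leb]_(x in _) _)%E = (\int[leb]_(x in `[0%R, +oo[) (f x)%:E)%E); last first.
    apply: eq_integral => x; rewrite inE /= in_itv /= andbT => x0.
    by rewrite /f ger0_norm.
  have rx (x : R) : 0 <= x -> 0 < r + x by move=> x0; rewrite ltr_wpDr.
  have dshift (x : R) : is_derive x (1 : R) (fun x => r + x) 1.
    by under eq_fun do rewrite addrC -[X in X + _]mul1r; exact: is_derive_affine.
  have dF (x : R) : 0 <= x -> is_derive x (1 : R) F (f x).
    move=> x0; rewrite /F /f.
    have D := @is_derive_comp R (fun y => y `^ (- (s - 1))) (fun x => r + x) x _ _ (is_derive1_powR (- (s - 1)) (rx x x0)) (dshift x).
    have D2 := is_derive_mul (is_derive_const x (- (s - 1)^-1)) D.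
    have -> : (fun x => - ((r + x) `^ (- (s - 1)) / (s - 1))) =
       (fun x => - (s - 1)^-1 * (r + x) `^ (- (s - 1))).
      by apply/funext => z; rewrite mulNr mulrC.
    apply: (is_derive_eq D2).
    have -> : - (s - 1) - 1 = - s by ring.
    rewrite mul0r add0r mulr1 mulrA mulrNN mulVf ?mul1r// gt_eqF//.
  have cf (x : R) : 0 <= x -> {for x, continuous f}.
    move=> x0; apply: (@continuous_comp _ _ _ (fun x => r + x) (fun y => y `^ (- s))).
      by apply: cvgD; [exact: cvg_cst|exact: cvg_id].
    exact: continuous_at_powR (rx x x0).
  rewrite (@ge0_continuous_FTC2y _ f F 0 0).
  + rewrite /F addr0 sub0e -EFinN opprK; congr (_ * _%:E)%E.
    by have -> : 1 - s = - (s - 1) by ring.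
  + by move=> x x0; exact: powR_ge0.
  + apply/continuous_within_itvcyP; split.
      by move=> x; rewrite in_itv /= andbT => x0; apply: cf; exact: ltW.
    by apply: cvg_at_right_filter; exact: (cf 0).
  + rewrite /F -[X in _ --> X]oppr0; apply: cvgN.
    rewrite -[X in _ --> X](mul0r (s - 1)^-1); apply: cvgM; last exact: cvg_cst.
    exact: cvg_powR_shift_oppr.
  + by move=> x x0; have [] := dF x (ltW x0).
  + apply: cvg_at_right_filter; apply/differentiable_continuous/derivable1_diffP.
    by have [] := dF 0 (lexx _).
  + move=> x; rewrite in_itv /= andbT => x0; rewrite derive1E.
    by have [_ ->] := dF x (ltW x0).
- by move=> x; exact: powR_ge0.
- move=> x; apply: (@continuous_comp _ _ _ (fun x : R => r + `|x|) (fun y => y `^ (- s))); first exact: cnorm.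
  by apply: continuous_at_powR; rewrite ltr_wpDr.
- by move=> x /=; rewrite normrN.
Qed.

End PowerWeight.

Section LowerLargeP.
Context {R : realType} {d : nat}.
Local Notation leb := (@lebesgue_measure R).
Local Notation mu := (lebesgue_tuple R d).
Local Notation T := (d.-tuple R).
Implicit Types (x y xi t : T) (u v : T -> R[i]).

Lemma coord_le_en t i : `|tnth t i| <= en t.
Proof.
rewrite -sqrtr_sqr /en ler_wsqrtr// (bigD1 i)//= lerDl.
by apply: sumr_ge0 => j _; exact: sqr_ge0.
Qed.

(** Polar coordinates are avoided: as [|t_i| <= |t|], the radial weight is dominated by a product of
    one-dimensional weights of exponent [sg / d], integrable since [sg / d > 1]. The constant
    depends on [d], which is harmless in this range. *)
Lemma integral_en_weight (r sg : R) : (0 < d)%N -> 0 < r -> d%:R < sg ->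
  (\int[mu]_t ((r + en t) `^ (- sg))%:E <= ((2 / (sg / d%:R - 1)) ^+ d * r `^ (d%:R - sg))%:E)%E.
Proof.
move=> d0 r0 dsg; have dR : 0 < d%:R :> R by rewrite ltr0n.
pose s := sg / d%:R.
have s1 : 1 < s by rewrite ltr_pdivlMr// mul1r.
have ms : measurable_fun setT (fun x : R => (r + `|x|) `^ (- s)).
  apply: (measurableT_comp (measurable_powR (- s))).
  by apply: measurable_funD => //; exact: normr_measurable.
apply: (@le_trans _ _ (\int[mu]_t (\prod_(i < d) (r + `|tnth t i|) `^ (- s))%:E)%E).
  apply: ge0_le_integral => //.
  - by move=> t _; rewrite lee_fin powR_ge0.
  - apply/measurable_EFinP; apply: measurable_powRT; apply: measurable_funD => //.
    exact: measurable_en.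
  - by apply/measurable_EFinP; exact: (measurable_prod_tnth (fun=> ms)).
  move=> t _; rewrite lee_fin.
  have -> : (r + en t) `^ (- sg) = \prod_(i < d) (r + en t) `^ (- s).
    rewrite prodr_const card_ord -powR_mulrn ?powR_ge0// -powRrM; congr (_ `^ _).
    by rewrite mulNr /s divfK// gt_eqF.
  apply: ler_prod => i _; rewrite powR_ge0 /=.
  have h : 0 < r + `|tnth t i| by rewrite ltr_wpDr.
  rewrite !powRN lef_pV2 ?posrE ?powR_gt0//; last by rewrite ltr_wpDr// en_ge0.
  by apply: le_powR; [rewrite (le_trans ler01)// ltW|exact: ltW|rewrite lerD2l coord_le_en].
rewrite (integral_prod_tnth (fun=> ms)); last by move=> _ x; exact: powR_ge0.
under eq_bigr do rewrite integral_powR_weight//.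
rewrite prodEFin prodr_const card_ord lee_fin.
have -> : 2 * (r `^ (1 - s) / (s - 1)) = 2 / (s - 1) * r `^ (1 - s) by ring.
rewrite exprMn -[r `^ (1 - s) ^+ d]powR_mulrn ?powR_ge0// -powRrM.
by have -> : (1 - s) * d%:R = d%:R - sg by rewrite mulrBl mul1r /s divfK// gt_eqF.
Qed.

(* Young's inequality for the factorization U^q = (w U)^q w^(-q), up to constants. *)
Lemma weighted_young (p U w lam : R) : 2 < p -> 0 <= U -> 0 < w -> 0 < lam ->
  U `^ (p / (p - 1)) <= lam * (w * U) `^ p + lam `^ (- (p - 2)^-1) * w `^ (- (p / (p - 2))).
Proof.
move=> p2 U0 w0 l0; set q := p / (p - 1).
have p20 : 0 < p - 2 by rewrite subr_gt0.
have p10 : 0 < p - 1 by lra.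
have p0 : 0 < p by lra.
have q0 : 0 < q by rewrite divr_gt0.
have nonneg1 : 0 <= lam * (w * U) `^ p by rewrite mulr_ge0 ?powR_ge0// ltW.
have nonneg2 : 0 <= lam `^ (- (p - 2)^-1) * w `^ (- (p / (p - 2))) by rewrite mulr_ge0 ?powR_ge0.
have [U00|Un0] := eqVneq U 0; first by rewrite {1}U00 powR0 ?gt_eqF// addr_ge0.
have Upos : 0 < U by rewrite lt_neqAle eq_sym Un0.
have pq : p - q = q * (p - 2) by rewrite /q; field; rewrite gt_eqF.
(* This quantity is the ratio of the first term to [U^q]: if it is at least 1, the first term
   suffices; otherwise [U] is small enough for the second. *)
have [h|h] := leP 1 (lam * w `^ p * U `^ (p - q)).
  apply: (@le_trans _ _ (lam * (w * U) `^ p)); last by rewrite lerDl.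
  have -> : lam * (w * U) `^ p = U `^ q * (lam * w `^ p * U `^ (p - q)).
    rewrite powRM ?(ltW w0)//; have -> : U `^ p = U `^ q * U `^ (p - q).
      by rewrite -powRD ?subrKC// (gt_eqF Upos) implybT.
    by ring.
  by rewrite ler_peMr ?powR_ge0.
apply: (@le_trans _ _ (lam `^ (- (p - 2)^-1) * w `^ (- (p / (p - 2))))); last by rewrite lerDr.
have lw0 : 0 < lam * w `^ p by rewrite mulr_gt0// powR_gt0.
have h2 : U `^ (p - q) <= (lam * w `^ p)^-1.
  by rewrite -[leRHS]mul1r ler_pdivlMr// mulrC ltW.
have := le_powR (p := (p - 2)^-1) _ (powR_ge0 _ _) h2.
rewrite invr_ge0 (ltW p20) => /(_ isT).
rewrite pq -powRrM mulfK ?gt_eqF// => /le_trans; apply.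
have -> : (lam * w `^ p)^-1 = (lam * w `^ p) `^ (-1) by rewrite powR_inv1// ltW.
rewrite -powRrM mulN1r powRM ?powR_ge0 ?(ltW l0)// -powRrM mulrN.
by [].
Qed.

Lemma one_sided_large u v (p r F : R) (sg := p / (p - 2)) : (0 < d)%N -> 2 < p -> d%:R < sg ->
  fourier_pair u v -> 0 < r -> 0 < F ->
  \int[mu]_t nrm (u t) `^ p = F ->
  \int[mu]_t (en t `^ p * nrm (u t) `^ p) <= r `^ p * F ->
  \int[mu]_t nrm (v t) `^ p <=
  2 `^ p * (2 * 2 `^ p + (2 / (sg / d%:R - 1)) ^+ d) `^ (p - 1) * (r `^ (d%:R * (p - 2)) * F).
Proof.
move=> d0 p2 dsg [mu' mv ru rv' [E1 _]] r0 F0 hF hM.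
have p1 : 1 <= p by lra.
have p0 : 0 < p by lra.
have p20 : 0 < p - 2 by rewrite subr_gt0.
have p10 : 0 < p - 1 by lra.
pose q := p / (p - 1).
have q10 : 0 < q - 1 by rewrite subr_gt0 ltr_pdivlMr//; lra.
have q1 : 1 < q by rewrite -subr_gt0.
have q2 : q <= 2 by rewrite ler_pdivrMr//; lra.
have PE : q / (q - 1) = p by rewrite /q; field; rewrite !gt_eqF//; lra.
have iu := rapid_cintegrable mu' ru.
have iuq := integrable_nrm_powR (ltW q1) mu' ru.
have iup := integrable_nrm_powR p1 mu' ru.
have iM := integrable_en_powR p1 mu' ru.
have mun := cmeas_nrm mu'.
have hy := hausdorff_young q1 q2 iu iuq erefl.
rewrite PE -E1 in hy.
set S := \int[mu]_x nrm (u x) `^ q in hy.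
have ivp := integrable_nrm_powR p1 mv rv'.
rewrite (integral_EFin_Rintegral ivp) lee_fin in hy.
apply: (le_trans hy); rewrite -[leRHS]mulrA ler_wpM2l ?powR_ge0//.
(* The value of [lam] that balances the two terms of [weighted_young] after integration: by [kE]
   below, [k r^(d - sg) = lam r^p F]. *)
pose lam := (r `^ (d%:R - sg - p) / F) `^ ((p - 2) / (p - 1)).
have lam0 : 0 < lam by rewrite powR_gt0// divr_gt0// powR_gt0.
set c2 := (2 / (sg / d%:R - 1)) ^+ d.
have dR : 0 < d%:R :> R by rewrite ltr0n.
have c20 : 0 < c2.
  by rewrite exprn_gt0// divr_gt0// subr_gt0 ltr_pdivlMr// mul1r.
have SS : S <= (2 * 2 `^ p + c2) * (lam * (r `^ p * F)).
  rewrite -lee_fin -(integral_EFin_Rintegral iuq).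
  pose w t := r + en t.
  have w0 t : 0 < w t by rewrite ltr_wpDr// en_ge0.
  have mw : measurable_fun setT w by apply: measurable_funD => //; exact: measurable_en.
  pose k := lam `^ (- (p - 2)^-1).
  have k0 : 0 <= k by exact: powR_ge0.
  pose g t := 2 `^ p * (r `^ p * nrm (u t) `^ p + en t `^ p * nrm (u t) `^ p).
  have ig : mu.-integrable setT (EFin \o g).
    by apply: integrable_scale; apply: integrable_add => //; exact: integrable_scale.
  have g0 t : 0 <= g t by rewrite mulr_ge0 ?powR_ge0// addr_ge0// mulr_ge0 ?powR_ge0.
  have mg : measurable_fun setT g by have := measurable_int _ ig => /measurable_EFinP.
  have mws : measurable_fun setT (fun t => w t `^ (- sg)) by exact: measurable_powRT.
  apply: (@le_trans _ _ (\int[mu]_t (lam * g t)%:E + \int[mu]_t (k * w t `^ (- sg))%:E)%E).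
    rewrite -ge0_integralD//; first last.
    - by apply/measurable_EFinP; exact: measurable_funM.
    - by move=> t _; rewrite lee_fin mulr_ge0 ?powR_ge0.
    - by apply/measurable_EFinP; exact: measurable_funM.
    - by move=> t _; rewrite lee_fin mulr_ge0// ltW.
    apply: ge0_le_integral => //.
    - by move=> t _; rewrite lee_fin powR_ge0.
    - by apply/measurable_EFinP; exact: measurable_powRT.
    - by apply: emeasurable_funD; apply/measurable_EFinP; exact: measurable_funM.
    move=> t _; rewrite -EFinD lee_fin.
    apply: (le_trans (weighted_young p2 (nrm_ge0 _) (w0 t) lam0)).
    rewrite lerD2r ler_wpM2l ?(ltW lam0)// powRM ?nrm_ge0 ?(ltW (w0 t))// /g -mulrDl mulrA.
    rewrite ler_wpM2r ?powR_ge0//; apply: powR_add_le; rewrite ?en_ge0 ?ltW//.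
  have -> := ge0_integral_scale (m := mu) mg (ltW lam0) g0.
  have -> := ge0_integral_scale (m := mu) mws k0 (fun t => powR_ge0 (w t) (- sg)).
  have hg : (\int[mu]_t (g t)%:E <= (2 * 2 `^ p * (r `^ p * F))%:E)%E.
    rewrite (integral_EFin_Rintegral ig) lee_fin /g RintegralZl//; last first.
      by apply: integrable_add => //; exact: integrable_scale.
    rewrite RintegralD//; last exact: integrable_scale.
    have -> : 2 * 2 `^ p * (r `^ p * F) = 2 `^ p * (r `^ p * F + r `^ p * F) by ring.
    have -> := RintegralZl (mu := mu) (r `^ p) measurableT iup.
    by rewrite ler_wpM2l ?powR_ge0// hF lerD2l.
  have hw := integral_en_weight d0 r0 dsg.
  apply: (@le_trans _ _ (lam%:E * (2 * 2 `^ p * (r `^ p * F))%:E + k%:E * (c2 * r `^ (d%:R - sg))%:E)%E).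
    by apply: leeD; apply: lee_wpmul2l; rewrite ?lee_fin// ltW.
  rewrite -!EFinM -EFinD lee_fin.
  have kE : k * r `^ (d%:R - sg) = lam * (r `^ p * F).
    pose z := r `^ (d%:R - sg - p) / F.
    have z0 : 0 < z by rewrite divr_gt0// powR_gt0.
    have e1 : lam = z `^ ((p - 2) / (p - 1)) by [].
    have e2 : k = z `^ (- (p - 1)^-1).
      rewrite /k e1 -powRrM; congr (_ `^ _).
      by field; rewrite !gt_eqF.
    have e3 : r `^ (d%:R - sg) = z * (r `^ p * F).
      have -> : z * (r `^ p * F) = r `^ (d%:R - sg - p) * r `^ p by rewrite /z; field; rewrite gt_eqF.
      by rewrite -powRD ?subrK// (gt_eqF r0) implybT.
    rewrite e3 mulrA e2 e1; congr (_ * _).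
    rewrite -[X in _ * X = _]powRr1 ?(ltW z0)// -powRD ?(gt_eqF z0) ?implybT//.
    by congr (_ `^ _); field; rewrite gt_eqF.
  rewrite [X in _ + X]mulrCA kE le_eqVlt; apply/orP; left; apply/eqP; ring.
have S0 : 0 <= S by apply: Rintegral_ge0 => t _; exact: powR_ge0.
apply: (le_trans (le_powR (ltW p10) S0 SS)).
have rF0 : 0 <= lam * (r `^ p * F) by rewrite !mulr_ge0 ?powR_ge0// ltW.
have cc0 : 0 <= 2 * 2 `^ p + c2 by rewrite addr_ge0 ?mulr_ge0 ?powR_ge0// ltW.
rewrite powRM//; rewrite ler_wpM2l ?powR_ge0// le_eqVlt; apply/orP; left; apply/eqP.
rewrite powRM ?mulr_ge0 ?powR_ge0 ?(ltW F0) ?(ltW lam0)//.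
rewrite powRM ?powR_ge0 ?(ltW F0)// /lam -powRrM divfK ?gt_eqF//.
rewrite powRM ?powR_ge0 ?invr_ge0 ?(ltW F0)//.
have -> : F^-1 = F `^ (-1) by rewrite powR_inv1// ltW.
rewrite -!powRrM.
have Fn : F != 0 by rewrite gt_eqF.
have rn : r != 0 by rewrite gt_eqF.
have eF : F `^ (-1 * (p - 2)) * F `^ (p - 1) = F.
  rewrite -powRD ?Fn ?implybT//.
  by have -> : -1 * (p - 2) + (p - 1) = 1; [ring|rewrite powRr1// ltW].
(* The exponents add up because [sg (p - 2) = p]. *)
have er : r `^ ((d%:R - sg - p) * (p - 2)) * r `^ (p * (p - 1)) = r `^ (d%:R * (p - 2)).
  rewrite -powRD ?rn ?implybT//; congr (_ `^ _).
  by rewrite /sg; field; rewrite gt_eqF.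
move: eF er; move: (F `^ _) (F `^ _) (r `^ _) (r `^ _) (r `^ _) => a b c e g <- <-.
ring.
Qed.

End LowerLargeP.

(** * From one-sided estimates to the uncertainty quotient *)

Section LowerBounds.
Context {R : realType} {d : nat}.
Local Notation mu := (lebesgue_tuple R d).
Local Notation T := (d.-tuple R).
Local Notation rv := (@rv_of_tuple R d).
Implicit Types (t : T) (u v : T -> R[i]) (f : 'rV[R]_d -> R[i]).

Definition Npow (p : R) u : R := \int[mu]_t nrm (u t) `^ p.

Definition Mpow (p : R) u : R := \int[mu]_t (en t `^ p * nrm (u t) `^ p).

Lemma Lp_norm_rv (p : R) f : 1 <= p -> cmeas (fun t => f (rv t)) -> rapid (fun t => f (rv t)) ->
  (Lp_norm p f `^ p = (Npow p (fun t => f (rv t)))%:E)%E.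
Proof.
move=> p1 mf rf; rewrite /Lp_norm poweR_Lnorm ?gt_eqF// ?(lt_le_trans ltr01)//.
rewrite -(integral_EFin_Rintegral (integrable_nrm_powR p1 mf rf)).
by apply: eq_integral => t _; rewrite abse_EFin poweR_EFin ger0_norm ?nrm_ge0.
Qed.

Lemma moment_rv (p : R) f : 1 <= p -> cmeas (fun t => f (rv t)) -> rapid (fun t => f (rv t)) ->
  moment p f = (Mpow p (fun t => f (rv t)))%:E.
Proof.
move=> p1 mf rf; rewrite /moment -(integral_EFin_Rintegral (integrable_en_powR p1 mf rf)).
by apply: eq_integral => t _; rewrite eucl_norm_rv.
Qed.

Lemma rv_surj (x : 'rV[R]_d) : exists t, rv t = x.
Proof. by exists [tuple x 0 i | i < d]; apply/rowP => i; rewrite !mxE tnth_mktuple. Qed.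

Lemma neq0_rv f : f <> (fun=> 0) -> exists t, f (rv t) != 0.
Proof.
move=> fn; apply: contrapT => h; apply: fn; apply/funext => x.
have [t <-] := rv_surj x; apply/eqP; apply: contrapT => /negP ft0.
by apply: h; exists t.
Qed.

(** For a nonzero Schwartz function both norms are positive and finite and both moments finite, so
    the extended-real quotients are ordinary ones. *)
Lemma uncertaintyE (p : R) f (u := fun t => f (rv t)) : 1 <= p -> schwartz f -> f <> (fun=> 0) ->
  uncertainty p f = (Mpow p u / Npow p u * (Mpow p (ft u) / Npow p (ft u)))%:E.
Proof.
move=> p1 sf fn; have uv := schwartz_fourier_pair sf.
have [N0 N0'] := fourier_pair_Lp_gt0 p1 uv (neq0_rv fn).
have [mu' mv ru rv' _] := uv.
have E : (fun t => fourier f (rv t)) = ft u by apply/funext => t; rewrite fourier_rv.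
rewrite /uncertainty !moment_rv ?Lp_norm_rv ?E//.
rewrite -!/(Npow _ _) in N0 N0'.
move: (Npow p _) (Npow p _) (Mpow p _) (Mpow p _) N0 N0' => N N' M M' N0 N0'.
by rewrite !inver (gt_eqF N0) (gt_eqF N0') -!EFinM.
Qed.

Lemma Npow_ge0 p u : 0 <= Npow p u.
Proof. by apply: Rintegral_ge0 => t _; exact: powR_ge0. Qed.

Lemma Mpow_ge0 p u : 0 <= Mpow p u.
Proof. by apply: Rintegral_ge0 => t _; rewrite mulr_ge0 ?powR_ge0. Qed.

Lemma uncertainty_ge0 (p : R) f : 1 <= p -> schwartz f -> f <> (fun=> 0) -> (0 <= uncertainty p f)%E.
Proof.
move=> p1 sf fn; rewrite uncertaintyE// lee_fin.
by rewrite mulr_ge0 ?divr_ge0 ?Npow_ge0 ?Mpow_ge0.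
Qed.

Lemma mul_ge_of_add (x y c : R) : 0 <= x -> 0 <= y ->
  (forall e, 0 < e -> c <= (x + e) * (y + e)) -> c <= x * y.
Proof.
move=> x0 y0 h; rewrite leNgt; apply/negP => cxy.
have k0 : 0 < x + y + 1 by rewrite ltr_wpDl// addr_ge0.
(* As [e <= 1], [(x + e) (y + e) <= x y + e (x + y + 1)], which this [e] keeps below [c]. *)
pose e := Num.min 1 ((c - x * y) / (2 * (x + y + 1))).
have e0 : 0 < e by rewrite lt_min ltr01 divr_gt0 ?subr_gt0// mulr_gt0.
have e1 : e <= 1 by rewrite ge_min lexx.
have e2 : e * (x + y + 1) <= (c - x * y) / 2.
  rewrite -ler_pdivlMr// ge_min; apply/orP; right.
  by rewrite le_eqVlt; apply/orP; left; apply/eqP; field; rewrite !gt_eqF.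
have := h e e0.
have : e * e <= e by rewrite ler_piMl// ltW.
have : 0 < c - x * y by rewrite subr_gt0.
move: e2; clearbody e; nra.
Qed.

(** The radii are the p-th roots of [M / N + e] and [M' / N' + e], positive even if a moment were 0;
    then [e] tends to 0. *)
Lemma mul_ge_of_powR (M N M' N' p c : R) : 0 < p -> 0 <= M -> 0 < N -> 0 <= M' -> 0 < N' ->
  (forall r s, 0 < r -> 0 < s -> M <= r `^ p * N -> M' <= s `^ p * N' -> c <= (r * s) `^ p) ->
  c <= M / N * (M' / N').
Proof.
move=> p0 M0 N0 M0' N0' h.
have root (y : R) : 0 < y -> (y `^ p^-1) `^ p = y.
  by move=> y0; rewrite -powRrM mulVf ?gt_eqF// powRr1// ltW.
have q0 x y : 0 <= x -> 0 < y -> 0 <= x / y :> R by move=> ? ?; rewrite divr_ge0// ltW.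
have le_root x y e : 0 < e -> 0 <= x -> 0 < y -> x <= ((x / y + e) `^ p^-1) `^ p * y.
  move=> e0 x0 y0; rewrite root; last by rewrite ltr_wpDl// q0.
  by rewrite -ler_pdivrMr// lerDl ltW.
apply: mul_ge_of_add => [||e e0]; [exact: q0|exact: q0|].
have x0 : 0 < M / N + e by rewrite ltr_wpDl// q0.
have y0 : 0 < M' / N' + e by rewrite ltr_wpDl// q0.
have := h _ _ (powR_gt0 _ x0) (powR_gt0 _ y0) (le_root _ _ e e0 M0 N0) (le_root _ _ e e0 M0' N0').
by rewrite powRM ?powR_ge0// root// root.
Qed.

Lemma uncertainty_ge (p c : R) f (u := fun t => f (rv t)) : 1 <= p -> schwartz f -> f <> (fun=> 0) ->
  (forall r s, 0 < r -> 0 < s -> Mpow p u <= r `^ p * Npow p u ->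
     Mpow p (ft u) <= s `^ p * Npow p (ft u) -> c <= (r * s) `^ p) ->
  (c%:E <= uncertainty p f)%E.
Proof.
move=> p1 sf fn h; rewrite uncertaintyE// lee_fin.
have [N0 N0'] := fourier_pair_Lp_gt0 p1 (schwartz_fourier_pair sf) (neq0_rv fn).
exact: (mul_ge_of_powR (lt_le_trans ltr01 p1) (Mpow_ge0 _ _) N0 (Mpow_ge0 _ _) N0' h).
Qed.

Definition small_p_const : R := (2 * pi * expR 1 * 32 ^+ 6)^-1.

Lemma small_p_const_gt0 : 0 < small_p_const.
Proof. by rewrite invr_gt0 !mulr_gt0 ?pi_gt0 ?expR_gt0// exprn_gt0. Qed.

Lemma uncertainty_ge_small (p : R) f : (0 < d)%N -> 1 < p -> p <= 2 -> schwartz f -> f <> (fun=> 0) ->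
  ((small_p_const `^ p * d%:R `^ p)%:E <= uncertainty p f)%E.
Proof.
move=> d0 p1 p2 sf fn; apply: uncertainty_ge => //; first exact: ltW.
move=> r s r0 s0 hr hs.
have := lower_small_p d0 p1 p2 (schwartz_fourier_pair sf) (neq0_rv fn) r0 s0 hr hs.
have c0 := ltW small_p_const_gt0.
rewrite -powRM// => h; apply: le_powR; first by rewrite (le_trans ler01)// ltW.
  by rewrite mulr_ge0.
by rewrite mulrC.
Qed.

(** Chaining the estimate for the pair with the one for the conjugate pair bounds [Npow p u] by
    [C^2 (r s)^(d (p - 2))] times itself. Extracting the root of order [d (p - 2)] is possible
    because [p > 2]. *)
Lemma uncertainty_ge_large (p : R) f (sg := p / (p - 2))
  (C := 2 `^ p * (2 * 2 `^ p + (2 / (sg / d%:R - 1)) ^+ d) `^ (p - 1)) :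
  (0 < d)%N -> 2 < p -> d%:R < sg -> schwartz f -> f <> (fun=> 0) ->
  ((((C * C)^-1) `^ ((d%:R * (p - 2))^-1) `^ p)%:E <= uncertainty p f)%E.
Proof.
move=> d0 p2 dsg sf fn; have p1 : 1 <= p by lra.
apply: uncertainty_ge => // r s r0 s0 hr hs.
have uv := schwartz_fourier_pair sf.
have [N0 N0'] := fourier_pair_Lp_gt0 p1 uv (neq0_rv fn).
have dR : 0 < d%:R :> R by rewrite ltr0n.
have E0 : 0 < d%:R * (p - 2) by rewrite mulr_gt0// subr_gt0.
have C0 : 0 < C.
  rewrite mulr_gt0 ?powR_gt0// ltr_pwDl ?mulr_gt0 ?powR_gt0//.
  by rewrite exprn_ge0// divr_ge0// subr_ge0 ltW// ltr_pdivlMr// mul1r.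
have h1 := one_sided_large d0 p2 dsg uv r0 N0 erefl hr.
set u := fun t : T => f (rv t) in uv N0 N0' hr hs h1 *.
pose cj (w : T -> R[i]) t := conjc (w t).
have NE w : Npow p (cj w) = Npow p w by apply: eq_Rintegral => t _; rewrite nrm_conj.
have ME w : Mpow p (cj w) = Mpow p w by apply: eq_Rintegral => t _; rewrite nrm_conj.
have h2 : Npow p u <= C * (s `^ (d%:R * (p - 2)) * Npow p (ft u)).
  rewrite -[leLHS]NE; apply: (one_sided_large d0 p2 dsg (fourier_pair_sym uv) s0 N0').
    exact: (NE (ft u)).
  rewrite [leLHS](ME (ft u)); exact: hs.
move: h1; rewrite -/(Npow p _) -/C => h1.
move: N0 N0' h1 h2; rewrite -/(Npow p _) -/(Npow p (ft _)).
move: (Npow p _) (Npow p _) => G F F0 G0 h1 h2.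
have CC0 : 0 < C * C by exact: mulr_gt0.
clearbody C.
have h3 : (C * C)^-1 <= (r * s) `^ (d%:R * (p - 2)).
  rewrite powRM ?(ltW r0) ?(ltW s0)// -[leLHS]mul1r ler_pdivrMr//.
  set a := r `^ _; set b := s `^ _.
  have a0 : 0 < a by rewrite powR_gt0.
  have h : F <= C * (b * (C * (a * F))).
    by apply: le_trans h2 _; rewrite ler_wpM2l ?(ltW C0)// ler_wpM2l ?powR_ge0.
  rewrite -(ler_pM2r F0) mul1r; apply: le_trans h _.
  by rewrite le_eqVlt; apply/orP; left; apply/eqP; ring.
have p0 := le_trans ler01 p1.
apply: le_powR => //; first exact: powR_ge0.
have i0 : 0 <= (d%:R * (p - 2))^-1 by rewrite invr_ge0 ltW.
have CC : 0 <= (C * C)^-1 by rewrite invr_ge0 ltW.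
apply: le_trans (le_powR i0 CC h3) _.
by rewrite -powRrM divff ?gt_eqF// powRr1// mulr_ge0 ?(ltW r0) ?(ltW s0).
Qed.

End LowerBounds.

Section LowerConclusion.
Context {R : realType}.

Lemma crit_exponent_lt (d : nat) (p : R) : (0 < d)%N -> 2 < p -> (p%:E < crit_exponent R d)%E ->
  d%:R < p / (p - 2).
Proof.
move=> d0 p2; rewrite /crit_exponent; case: eqVneq => [->|d1] h.
  by rewrite ltr_pdivlMr ?subr_gt0//; lra.
have d1R : 0 < d%:R - 1 :> R by rewrite subr_gt0 ltr1n ltn_neqAle eq_sym d1.
move: h; rewrite lte_fin ltr_pdivlMr// ltr_pdivlMr ?subr_gt0//.
by move: (d%:R : R) => D; lra.
Qed.

Lemma crit_exponent_gt (d : nat) (p : R) : (0 < d)%N -> (crit_exponent R d < p%:E)%E ->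
  (1 < d)%N /\ 2 * d%:R < p * (d%:R - 1).
Proof.
move=> d0; rewrite /crit_exponent; case: eqVneq => [//|d1] h.
have dd : (1 < d)%N by rewrite ltn_neqAle eq_sym d1.
by split=> //; move: h; rewrite lte_fin ltr_pdivrMr// subr_gt0 ltr1n.
Qed.

Lemma uncertainty_lower (d : nat) (p : R) : (0 < d)%N -> 1 < p -> (p%:E < crit_exponent R d)%E ->
  exists C : R, 0 < C /\ forall f : 'rV[R]_d -> R[i], schwartz f -> f <> (fun=> 0) ->
    (C%:E <= uncertainty p f)%E.
Proof.
move=> d0 p1 pc; have dR : 0 < d%:R :> R by rewrite ltr0n.
have [p2|p2] := leP p 2.
  exists (@small_p_const R `^ p * d%:R `^ p); split.
    by rewrite mulr_gt0 ?powR_gt0// small_p_const_gt0.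
  by move=> f sf fn; exact: uncertainty_ge_small.
have dsg := crit_exponent_lt d0 p2 pc.
eexists; split; last by move=> f sf fn; exact: (uncertainty_ge_large d0 p2 dsg sf fn).
have C0 : 0 < 2 `^ p * (2 * 2 `^ p + (2 / (p / (p - 2) / d%:R - 1)) ^+ d) `^ (p - 1) :> R.
  rewrite mulr_gt0 ?powR_gt0// ltr_pwDl ?mulr_gt0 ?powR_gt0//.
  by rewrite exprn_ge0// divr_ge0// subr_ge0 ltW// ltr_pdivlMr// mul1r.
by rewrite !powR_gt0// invr_gt0 mulr_gt0.
Qed.

End LowerConclusion.

(** * Upper bounds from Gaussians *)

Section GaussianSchwartz.
Context {R : realType} {d : nat}.
Local Notation mu := (lebesgue_tuple R d).
Local Notation T := (d.-tuple R).
Local Notation rv := (@rv_of_tuple R d).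
Implicit Types (t : T) (x v : 'rV[R]_d) (g h : 'rV[R]_d -> R).

Definition gauss_rv (c : R) x : R := expR (- (c * dotrv x x)).

(** A class that is closed under partial derivatives and whose members are continuous and rapidly
    decreasing, so that its members are Schwartz without any formula for higher derivatives. Sums of
    Gaussians of different widths belong to it, as the two-scale examples require. *)
Inductive gauss_poly : ('rV[R]_d -> R) -> Prop :=
| gauss_poly_base c : 0 < c -> gauss_poly (gauss_rv c)
| gauss_poly_coord i g : gauss_poly g -> gauss_poly (fun x => x 0 i * g x)
| gauss_poly_add g h : gauss_poly g -> gauss_poly h -> gauss_poly (fun x => g x + h x)
| gauss_poly_scale a g : gauss_poly g -> gauss_poly (fun x => a * g x).

Lemma is_derive_of_line g x v l : is_derive (0 : R) (1 : R) (fun k => g (k *: v + x)) l ->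
  is_derive x v g l.
Proof.
move=> [dl El].
have E : (fun k : R => k^-1 *: (((fun k => g (k *: v + x)) \o shift 0) (k *: 1) - g (0 *: v + x))) =
         (fun k : R => k^-1 *: ((g \o shift x) (k *: v) - g x)).
  by apply/funext => k /=; rewrite scale0r add0r addr0 /GRing.scale /= mulr1.
by split; [move: dl|move: El]; rewrite /derivable /derive /= E.
Qed.

Lemma dotrv_delta i k x :
  dotrv (k *: delta_mx 0 i + x) (k *: delta_mx 0 i + x) = dotrv x x + 2 * x 0 i * k + k ^+ 2.
Proof.
rewrite /dotrv (bigD1 i)//= [in RHS](bigD1 i)//= !mxE !eqxx mulr1.
rewrite (eq_bigr (fun j => x 0 j * x 0 j)) => [|j ji]; first by ring.
by rewrite !mxE (negbTE ji) andbF mulr0 add0r.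
Qed.

Lemma gauss_poly_derive i g : gauss_poly g ->
  exists2 g', gauss_poly g' & forall x, is_derive x (delta_mx 0 i) g (g' x).
Proof.
elim => [c c0|j {}g gg [g' gg' dg]|{}g h gg [g' gg' dg] gh [h' gh' dh]|a {}g gg [g' gg' dg]].
- exists (fun x => (- (2 * c)) * (x 0 i * gauss_rv c x)).
    exact/gauss_poly_scale/gauss_poly_coord/gauss_poly_base.
  move=> x; apply: is_derive_of_line; rewrite /gauss_rv.
  under eq_fun do rewrite dotrv_delta.
  have D1 : is_derive (0 : R) (1 : R) (fun k => - (c * (dotrv x x + 2 * x 0 i * k + k ^+ 2))) (- (2 * c * x 0 i)).
    have D := is_derive_add (is_derive_affine 0 (- (c * (2 * x 0 i))) (- (c * dotrv x x))) (is_derive_sqr 0 (- c)).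
    rewrite (_ : (fun k => _) = (fun k => - (c * (2 * x 0 i)) * k + - (c * dotrv x x) + - c * k ^+ 2)); last by apply/funext => k; ring.
    by apply: (is_derive_eq D); ring.
  have D := @is_derive_comp _ expR _ 0 _ _ (is_derive_expR _) D1.
  by apply: (is_derive_eq D); rewrite mulr0 expr0n !addr0; ring.
- exists (fun x => (i == j)%:R * g x + x 0 j * g' x).
    by apply: gauss_poly_add; [exact: gauss_poly_scale|exact: gauss_poly_coord].
  move=> x; apply: is_derive_of_line.
  have D1 : is_derive (0 : R) (1 : R) (fun k => (k *: delta_mx 0 i + x) 0 j) (i == j)%:R.
    have D := is_derive_affine 0 ((i == j)%:R) (x 0 j).
    by under eq_fun do rewrite !mxE eqxx andTb eq_sym mulrC.
  have D2 : is_derive (0 : R) (1 : R) (fun k => g (k *: delta_mx 0 i + x)) (g' x).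
    rewrite -[X in g' X]add0r -[X in g' (X + _)](scale0r (delta_mx 0 i)).
    apply: is_derive_line; exact: dg.
  by have D := is_derive_mul D1 D2; apply: (is_derive_eq D); rewrite scale0r add0r.
- exists (fun x => g' x + h' x); first exact: gauss_poly_add.
  by move=> x; exact: is_deriveD.
- exists (fun x => a * g' x); first exact: gauss_poly_scale.
  by move=> x; exact: is_deriveZ.
Qed.

Lemma continuous_gauss_poly g : gauss_poly g -> continuous g.
Proof.
elim => [c c0|j {}g gg IH|{}g h gg IH gh IH'|a {}g gg IH] x.
- apply: (@continuous_comp _ _ _ (fun x => - (c * dotrv x x)) expR); last exact: continuous_expR.
  have cd : {for x, continuous (fun y : 'rV[R]_d => dotrv y y)}.
    rewrite /dotrv; elim: (index_enum _) => [|i r IH].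
      have -> : (fun y : 'rV[R]_d => \sum_(i <- [::]) y 0 i * y 0 i) = (fun=> 0).
        by apply/funext => y; rewrite big_nil.
      exact: cst_continuous.
    have -> : (fun y : 'rV[R]_d => \sum_(j <- i :: r) y 0 j * y 0 j) =
        (fun y => y 0 i * y 0 i) + (fun y => \sum_(j <- r) y 0 j * y 0 j).
      by apply/funext => y; rewrite big_cons.
    apply: (@continuousD _ R^o) => //.
    by apply: (@continuousM _ _ (fun y : 'rV[R]_d => y 0 i)); exact: coord_continuous.
  by apply: (@continuousN _ R^o); apply: (@continuousM _ _ (fun=> c)) => //; exact: cst_continuous.
- by apply: (@continuousM _ _ (fun y : 'rV[R]_d => y 0 j)); [exact: coord_continuous|exact: IH].
- by apply: (@continuousD _ R^o); [exact: IH|exact: IH'].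
- by apply: (@continuousM _ _ (fun=> a)); [exact: cst_continuous|exact: IH].
Qed.

Lemma coord_le_eucl_norm x i : `|x 0 i| <= eucl_norm x.
Proof.
have [t <-] := rv_surj x; rewrite eucl_norm_rv mxE; exact: coord_le_en.
Qed.

Lemma eucl_norm_ge0 x : 0 <= eucl_norm x. Proof. exact: sqrtr_ge0. Qed.

Lemma eucl_norm_sqr x : eucl_norm x ^+ 2 = dotrv x x.
Proof.
have [t <-] := rv_surj x; rewrite eucl_norm_rv en_sqr dotrv_rv.
by apply: eq_bigr => i _; rewrite expr2.
Qed.

Lemma gauss_poly_rapid g : gauss_poly g ->
  forall k : nat, exists M, forall x, eucl_norm x ^+ k * `|g x| <= M.
Proof.
elim => [c c0|j {}g gg IH|{}g h gg IH gh IH'|a {}g gg IH] k.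
- have [C C0 h] := poly_expR_bounded k c0; exists C => x.
  apply: le_trans (h (dotrv x x) _); last by rewrite -eucl_norm_sqr sqr_ge0.
  rewrite ger0_norm ?expR_ge0// ler_wpM2r ?expR_ge0//.
  apply: lerXn2r; rewrite ?nnegrE ?eucl_norm_ge0// -eucl_norm_sqr ?addr_ge0 ?sqr_ge0//.
  by have := eucl_norm_ge0 x; have := sqr_ge0 (eucl_norm x - 1); move: (eucl_norm x) => e; nra.
- have [M h] := IH k.+1; exists M => x; apply: le_trans (h x).
  by rewrite normrM mulrA exprSr ler_wpM2r// ler_wpM2l ?exprn_ge0 ?eucl_norm_ge0 ?coord_le_eucl_norm.
- have [M hM] := IH k; have [M' hM'] := IH' k; exists (M + M') => x.
  apply: le_trans (lerD (hM x) (hM' x)); rewrite -mulrDr.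
  by rewrite ler_wpM2l ?exprn_ge0 ?eucl_norm_ge0// ler_normD.
- have [M h] := IH k; exists (`|a| * M) => x.
  by rewrite normrM mulrCA ler_wpM2l.
Qed.

Lemma gauss_poly_partials g (s : seq 'I_d) : gauss_poly g ->
  exists2 g', gauss_poly g' & partials s (fun x => Complex (g x) 0) = (fun x => Complex (g' x) 0).
Proof.
move=> gg; elim: s => [|i s [g' gg' E]]; first by exists g.
have [g'' gg'' dg] := gauss_poly_derive i gg'.
exists g'' => //; rewrite /partials /= -/(partials s _) E.
apply/funext => x; rewrite /partial /=; congr Complex.
  by have [_ ->] := dg x.
exact: derive_cst.
Qed.

Lemma schwartz_gauss_poly g : gauss_poly g -> schwartz (fun x => Complex (g x) 0).
Proof.
move=> gg; split => [s|k s]; have [g' gg' ->] := gauss_poly_partials s gg.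
  split; split => //=.
  - exact: continuous_gauss_poly.
  - by move=> i x; have [h _ dh] := gauss_poly_derive i gg'; have [] := dh x.
  - by move=> x; exact: cst_continuous.
have [M h] := gauss_poly_rapid gg' k.
by exists M => x; rewrite nrm_real.
Qed.

Lemma gauss_rv_rv c t : gauss_rv c (rv t) = gauss c (fun=> 0) t.
Proof.
rewrite gaussE /gauss_rv dotrv_rv; congr (expR (- (_ * _))).
by apply: eq_bigr => i _; rewrite subr0 expr2.
Qed.

Lemma ft_gauss (a : R) xi : 0 < a ->
  ft (fun t => Complex (gauss (pi * a) (fun=> 0) t) 0) xi =
  Complex (Num.sqrt a ^- d * gauss (pi / a) (fun=> 0) xi) 0.
Proof.
move=> a0; have pa : 0 < pi * a by rewrite mulr_gt0 ?pi_gt0.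
rewrite /ft; rewrite (eq_cint _ (v := fun t => Complex (gauss (pi * a) (fun=> 0) t) 0 *
    expi (\sum_i (- (2 * pi * tnth xi i)) * tnth t i))); last first.
  move=> t; congr (_ * expi _); rewrite /= /dott mulr_sumr -sumrN.
  by apply: eq_bigr => i _; ring.
rewrite cint_gauss_expi//; congr (Complex (_ * _) 0).
  rewrite /gaussK invfM mulrA divff ?mul1r ?gt_eqF ?pi_gt0//.
  by rewrite sqrtrV ?(ltW a0)// exprVn.
rewrite gaussE; congr expR; congr (- _).
under eq_bigr do rewrite sqrrN exprMn; rewrite -mulr_sumr.
under [in RHS]eq_bigr do rewrite subr0.
have := pi_gt0 R; move: (\sum_i _) (pi) => S q q0.
by field; rewrite (gt_eqF q0) (gt_eqF a0).
Qed.

Lemma gauss_rv_neq0 (f : 'rV[R]_d -> R) : 0 < f 0 -> (fun x => Complex (f x) 0) <> (fun=> 0).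
Proof. by move=> f0 /(congr1 (fun F => complex.Re (F 0))) /= E; rewrite E ltxx in f0. Qed.

End GaussianSchwartz.

Section UpperBounds.
Context {R : realType} {d : nat}.
Local Notation mu := (lebesgue_tuple R d).
Local Notation T := (d.-tuple R).
Local Notation rv := (@rv_of_tuple R d).
Local Notation gau c := (@gauss R d c (fun=> 0)).
Implicit Types (t : T) (f : 'rV[R]_d -> R[i]).

Lemma gauss_powR (c p : R) t : gau c t `^ p = gau (p * c) t.
Proof. by rewrite !gaussE -expRM -mulNr mulrC mulrA mulrN -mulrA; congr expR; ring. Qed.

Lemma inf_uncertainty_le (p : R) f (u := fun t => f (rv t)) : 1 <= p -> schwartz f -> f <> (fun=> 0) ->
  ft u = u -> (inf_uncertainty d p <= ((Mpow p u / Npow p u) ^+ 2)%:E)%E.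
Proof.
move=> p1 sf fn fu; apply: (@le_trans _ _ (uncertainty p f)).
  by apply: ereal_inf_lbound; exists f.
by rewrite uncertaintyE// -/u fu expr2.
Qed.

(** With [w = |t|^2 / d], [w^(p / 2) <= 1 + w] because [p / 2 <= 1]. Taking out [d^(p / 2)] leaves a
    quantity whose Gaussian mean does not depend on [d], which yields the growth [d^p] after
    squaring. *)
Lemma powR_en_le (p : R) t : (0 < d)%N -> 0 <= p -> p <= 2 ->
  en t `^ p <= d%:R `^ (p / 2) * (1 + (\sum_i tnth t i ^+ 2) / d%:R).
Proof.
move=> d0 p0 p2; have dR : 0 < d%:R :> R by rewrite ltr0n.
rewrite -en_sqr; set w := en t ^+ 2 / d%:R.
have w0 : 0 <= w by rewrite divr_ge0 ?sqr_ge0// ltW.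
have -> : en t `^ p = d%:R `^ (p / 2) * w `^ (p / 2).
  have dw : d%:R * w = en t `^ 2 by rewrite /w mulrC divfK ?gt_eqF// powR_mulrn ?en_ge0.
  by rewrite -powRM ?(ltW dR)// dw -powRrM [2 * _]mulrC divfK.
rewrite ler_wpM2l ?powR_ge0//; have [w1|w1] := leP w 1.
  by apply: le_trans (powR_le1 w0 w1 _) _; [rewrite divr_ge0|rewrite lerDl].
apply: (@le_trans _ _ (w `^ 1)); last by rewrite powRr1// lerDr.
by rewrite ler_powR// ?(ltW w1)// ler_pdivrMr// mul1r.
Qed.

Lemma gaussian_moment_le (p : R) : (0 < d)%N -> 1 < p -> p <= 2 ->
  \int[mu]_t (en t `^ p * gau (p * pi) t) <=
  d%:R `^ (p / 2) * (1 + (2 * pi * p)^-1) * gaussK (p * pi) ^+ d.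
Proof.
move=> d0 p1 p2; have p0 : 0 < p by rewrite (lt_trans ltr01).
have dR : 0 < d%:R :> R by rewrite ltr0n.
have c0 : 0 < p * pi by rewrite mulr_gt0// pi_gt0.
have [im em] := gauss_moment2 (fun=> 0 : R) c0 (d := d).
pose h t := \sum_i (tnth t i - 0) ^+ 2 * gau (p * pi) t.
have ig := integrable_gauss (fun=> 0 : R) c0 (d := d).
pose D : R := d%:R `^ (p / 2).
have i1 : mu.-integrable setT (EFin \o (fun t => d%:R^-1 * h t)) by exact: integrable_scale.
have i2 : mu.-integrable setT (EFin \o (fun t => gau (p * pi) t + d%:R^-1 * h t)) by exact: integrable_add.
have i3 : mu.-integrable setT (EFin \o (fun t => D * (gau (p * pi) t + d%:R^-1 * h t))) by exact: integrable_scale.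
have le t : en t `^ p * gau (p * pi) t <= D * (gau (p * pi) t + d%:R^-1 * h t).
  have -> : h t = (\sum_i tnth t i ^+ 2) * gau (p * pi) t.
    by rewrite mulr_suml; apply: eq_bigr => i _; rewrite subr0.
  have G0 := gauss_gt0 (p * pi) (fun=> 0 : R) t.
  apply: le_trans (ler_wpM2r (ltW G0) (powR_en_le t d0 (ltW p0) p2)) _.
  by rewrite le_eqVlt; apply/orP; left; apply/eqP; rewrite /D; ring.
have E : \int[mu]_t (D * (gau (p * pi) t + d%:R^-1 * h t)) =
    D * (1 + (2 * pi * p)^-1) * gaussK (p * pi) ^+ d.
  have -> := RintegralZl (mu := mu) D measurableT i2.
  have -> := RintegralD (mu := mu) measurableT ig i1.
  have -> := RintegralZl (mu := mu) d%:R^-1 measurableT im.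
  rewrite em Rintegral_gauss//.
  have := pi_gt0 R; move: (pi) (gaussK _) => q K q0.
  by field; rewrite !gt_eqF.
rewrite -E; apply: le_Rintegral => //.
apply: (integrable_le _ _ i3).
  by apply: measurable_funM; [apply: measurable_powRT; exact: measurable_en|exact: measurable_gauss].
move=> t; rewrite ger0_norm ?le// mulr_ge0 ?powR_ge0//.
exact/ltW/gauss_gt0.
Qed.

Lemma nrm_gauss (c : R) t : nrm (Complex (gau c t) 0) = gau c t.
Proof. by rewrite nrm_real ger0_norm// ltW// gauss_gt0. Qed.

Lemma inf_uncertainty_upper (p : R) : (0 < d)%N -> 1 < p -> p <= 2 ->
  (inf_uncertainty d p <= ((1 + (2 * pi * p)^-1) ^+ 2 * d%:R `^ p)%:E)%E.
Proof.
move=> d0 p1 p2; have p0 : 0 < p by rewrite (lt_trans ltr01).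
have dR : 0 < d%:R :> R by rewrite ltr0n.
have pi0 := pi_gt0 R.
have c0 : 0 < p * pi by rewrite mulr_gt0.
pose f (x : 'rV[R]_d) := Complex (gauss_rv pi x) 0.
have fE t : f (rv t) = Complex (gau pi t) 0 by rewrite /f gauss_rv_rv.
have sf : schwartz f by exact/schwartz_gauss_poly/gauss_poly_base.
have fn : f <> (fun=> 0) by apply: gauss_rv_neq0; exact: expR_gt0.
have fu : ft (fun t => f (rv t)) = (fun t => f (rv t)).
  apply/funext => xi; rewrite fE (_ : (fun t => f (rv t)) = (fun t => Complex (gau (pi * 1) t) 0)).
    by rewrite ft_gauss// sqrtr1 expr1n invr1 mul1r mulr1.
  by apply/funext => t; rewrite mulr1.
apply: le_trans (inf_uncertainty_le (ltW p1) sf fn fu) _; rewrite lee_fin.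
have -> : Npow p (fun t => f (rv t)) = gaussK (p * pi) ^+ d.
  rewrite -(Rintegral_gauss (fun=> 0) c0); apply: eq_Rintegral => t _.
  by rewrite fE nrm_gauss gauss_powR.
have -> : Mpow p (fun t => f (rv t)) = \int[mu]_t (en t `^ p * gau (p * pi) t).
  by apply: eq_Rintegral => t _; rewrite fE nrm_gauss gauss_powR.
have K0 : 0 < gaussK (p * pi) ^+ d :> R by rewrite exprn_gt0// gaussK_gt0.
have b0 : 0 <= 1 + (2 * pi * p)^-1 :> R by rewrite addr_ge0// invr_ge0 !mulr_ge0// ltW.
have -> : (d%:R : R) `^ p = (d%:R `^ (p / 2)) ^+ 2.
  by rewrite -powR_mulrn ?powR_ge0// -powRrM divfK.
rewrite -exprMn; apply: lerXn2r; rewrite ?nnegrE; [|by apply: mulr_ge0; rewrite ?powR_ge0|].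
  rewrite divr_ge0 ?(ltW K0)//; apply: Rintegral_ge0 => t _.
  by rewrite mulr_ge0 ?powR_ge0// ltW// gauss_gt0.
by rewrite ler_pdivrMr// [(1 + _) * _ in leRHS]mulrC; exact: gaussian_moment_le.
Qed.

(** Instead of a change of variables, half of the exponent absorbs the power: with [w = k a |t|],
    [w^p * expR (- w^2 / 2)] is bounded uniformly in [a], and the remaining half has an explicit
    integral. *)
Lemma gaussian_moment_scale (p : R) : 1 <= p -> exists2 K : R, 0 < K & forall a : R, 0 < a ->
  mu.-integrable setT (EFin \o (fun t => en t `^ p * gau (p * (pi * a ^+ 2)) t)) /\
  \int[mu]_t (en t `^ p * gau (p * (pi * a ^+ 2)) t) <= K * (a `^ (- p) * a ^- d).
Proof.
move=> p1; have p0 : 0 < p by rewrite (lt_le_trans ltr01).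
have pi0 := pi_gt0 R.
(* [Num.bound p] is an integer exponent above [p], so that [w^p <= (1 + w^2)^p] is at most the
   corresponding integer power. *)
have [C C0 hC] := @poly_expR_bounded R (Num.bound p) (2^-1) (ltac:(by [])).
pose k := Num.sqrt (p * pi); have k0 : 0 < k by rewrite sqrtr_gt0 mulr_gt0.
exists (C * k `^ (- p) * Num.sqrt (2 / p) ^+ d) => [|a a0].
  by rewrite !mulr_gt0 ?powR_gt0// exprn_gt0// sqrtr_gt0 divr_gt0.
set c := p * (pi * a ^+ 2); have c0 : 0 < c by rewrite !mulr_gt0// exprn_gt0.
have c20 : 0 < c / 2 by rewrite divr_gt0.
have cE : c = (k * a) ^+ 2 by rewrite exprMn /k sqr_sqrtr /c ?mulrA// mulr_ge0 ?(ltW p0) ?(ltW pi0).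
have ka0 : 0 < k * a by rewrite mulr_gt0.
have le t : en t `^ p * gau c t <= C * (k * a) `^ (- p) * gau (c / 2) t.
  pose w := k * a * en t.
  have w0 : 0 <= w by rewrite mulr_ge0 ?en_ge0// ltW.
  have wE : c * en t ^+ 2 = w ^+ 2 by rewrite cE -exprMn.
  have -> : en t `^ p = (k * a) `^ (- p) * w `^ p.
    rewrite /w [(k * a * en t) `^ p]powRM ?en_ge0 ?(ltW ka0)// mulrA powRN mulVf ?mul1r//.
    by rewrite gt_eqF// powR_gt0.
  have gE c' : gau c' t = expR (- (c' * en t ^+ 2)).
    by rewrite gaussE en_sqr; under eq_bigr do rewrite subr0.
  rewrite !gE [c / 2]mulrC -[2^-1 * c * _]mulrA wE.
  have -> : expR (- w ^+ 2) = expR (- (2^-1 * w ^+ 2)) * expR (- (2^-1 * w ^+ 2)).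
    by rewrite -expRD; congr expR; field.
  have h : w `^ p * expR (- (2^-1 * w ^+ 2)) <= C.
    apply: le_trans (hC _ (sqr_ge0 w)); rewrite ler_wpM2r ?expR_ge0//.
    have w1 : 1 <= 1 + w ^+ 2 by rewrite lerDl sqr_ge0.
    have w2 : w <= 1 + w ^+ 2.
      by have := sqr_ge0 (w - 1); have := sqr_ge0 w; nra.
    apply: le_trans (le_powR (ltW p0) w0 w2) _.
    rewrite -[leRHS]powR_mulrn ?(le_trans ler01)// ler_powR//.
    by rewrite ltW// archi_boundP// ltW.
  move: h (expR_ge0 (- (2^-1 * w ^+ 2))) (powR_ge0 (k * a) (- p)).
  move: (w `^ p) (expR _) ((k * a) `^ _) => x y z h y0 z0.
  rewrite (_ : z * x * (y * y) = (x * y) * (z * y)); last by ring.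
  by rewrite -[leRHS]mulrA ler_wpM2r// mulr_ge0.
have ig := integrable_gauss (fun=> 0 : R) c20 (d := d).
have i2 : mu.-integrable setT (EFin \o (fun t => C * (k * a) `^ (- p) * gau (c / 2) t)).
  exact: integrable_scale.
have i1 : mu.-integrable setT (EFin \o (fun t => en t `^ p * gau c t)).
  apply: (integrable_le _ _ i2).
    by apply: measurable_funM; [apply: measurable_powRT; exact: measurable_en|exact: measurable_gauss].
  move=> t; rewrite ger0_norm ?le// mulr_ge0 ?powR_ge0//.
  exact/ltW/gauss_gt0.
split=> //; apply: (@le_trans _ _ (\int[mu]_t (C * (k * a) `^ (- p) * gau (c / 2) t))).
  by apply: le_Rintegral.
have -> := RintegralZl (mu := mu) (C * (k * a) `^ (- p)) measurableT ig.
rewrite Rintegral_gauss//.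
have -> : gaussK (c / 2) = Num.sqrt (2 / p) / a.
  rewrite /gaussK (_ : pi / (c / 2) = 2 / p * (a^-1) ^+ 2); last first.
    by rewrite /c; move: (pi) pi0 => q q0; field; rewrite !gt_eqF.
  by rewrite sqrtrM ?divr_ge0 ?(ltW p0)// sqrtr_sqr ger0_norm// invr_ge0 ltW.
rewrite powRM ?(ltW k0) ?(ltW a0)// exprMn exprVn le_eqVlt; apply/orP; left; apply/eqP; ring.
Qed.

(** The transform exchanges the two summands: it sends [gau (pi a^2)] to [a^-d gau (pi / a^2)], and
    the latter back to the former. *)
Lemma two_scale_gaussian_fixed (a : R) : 0 < a ->
  ft (fun t => Complex (gau (pi * a ^+ 2) t + a ^- d * gau (pi / a ^+ 2) t) 0) =
  (fun t => Complex (gau (pi * a ^+ 2) t + a ^- d * gau (pi / a ^+ 2) t) 0).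
Proof.
move=> a0; have pi0 := pi_gt0 R; have a20 : 0 < a ^+ 2 by rewrite exprn_gt0.
have ig c : 0 < c -> cintegrable mu (fun t => Complex (gau c t) 0).
  move=> c0; apply: (cintegrable_le _ _ (integrable_gauss (fun=> 0 : R) c0)).
    by apply: cmeas_real; exact: measurable_gauss.
  by move=> t; rewrite nrm_gauss.
apply/funext => xi; rewrite /ft.
pose u t := Complex (gau (pi * a ^+ 2) t) 0; pose v t := Complex (gau (pi * (a ^+ 2)^-1) t) 0.
have iu := ig _ (mulr_gt0 pi0 a20).
have iv : cintegrable mu v by apply: ig; rewrite mulr_gt0// invr_gt0.
rewrite (eq_cint _ (v := fun t => u t * fker (t, xi) + Complex (a ^- d) 0 * (v t * fker (t, xi)))).
  rewrite cintD; [|exact: cintegrable_fker|exact/cintegrable_scale/cintegrable_fker].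
  rewrite cintZ; last exact: cintegrable_fker.
  rewrite -/(ft u xi) -/(ft v xi) /u /v !ft_gauss ?invr_gt0//.
  rewrite sqrtrV ?(ltW a20)// sqrtr_sqr ger0_norm ?(ltW a0)// invrK.
  rewrite exprVn invrK.
  apply: complex_eqP; rewrite ?cReD ?cImD ?cReM ?cImM /=; rewrite ?mul0r ?mulr0 ?addr0 ?subr0//.
  by rewrite mulrA mulVf ?mul1r ?gt_eqF ?exprn_gt0// addrC.
move=> t; rewrite /u /v; apply: complex_eqP; rewrite ?cReD ?cImD ?cReM ?cImM /= ?cReM ?cImM /=; ring.
Qed.

End UpperBounds.

(** * Vanishing of the infimum above the critical exponent *)

Section SupercriticalExponent.
Context {R : realType} {d : nat}.
Local Notation mu := (lebesgue_tuple R d).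
Local Notation T := (d.-tuple R).
Local Notation rv := (@rv_of_tuple R d).
Local Notation gau c := (@gauss R d c (fun=> 0)).
Implicit Types (t : T) (f : 'rV[R]_d -> R[i]).

(** The first summand is the moment of the narrow bump, the second that of the wide one, and [a^n]
    comes from the norm of the narrow bump. The exponents become [- p] and [- (p (n - 1) - 2 n)],
    and [delta] is the slower of the two rates. *)
Lemma two_scale_powers (a p : R) (n : nat) (delta := Num.min p (p * (n%:R - 1) - 2 * n%:R)) :
  1 <= a ->
  (a `^ (- p) * a ^- n + (a ^- n) `^ p * (a^-1 `^ (- p) * a^-1 ^- n)) * a ^+ n <= 2 * a `^ (- delta).
Proof.
move=> a1; have a0 : 0 < a by rewrite (lt_le_trans ltr01).
have an : a != 0 by rewrite gt_eqF.
have E1 : a ^+ n = a `^ n%:R by rewrite powR_mulrn// ltW.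
have E2 : a ^- n = a `^ (- n%:R) by rewrite powRN E1.
have E3 : (a ^- n) `^ p = a `^ (- n%:R * p) by rewrite E2 -powRrM.
have E4 : a^-1 `^ (- p) = a `^ p.
  have -> : a^-1 = a `^ (- 1) by rewrite powR_inv1// ltW.
  by rewrite -powRrM mulrNN mul1r.
rewrite mulrDl divfK ?expf_neq0// E3 E4 exprVn invrK E1.
rewrite -!powRD ?an ?implybT// mulr_natl mulr2n lerD// ler_powR//.
  by rewrite lerN2 ge_min lexx.
rewrite lerNr ge_min; apply/orP; right.
by rewrite le_eqVlt; apply/orP; left; apply/eqP; ring.
Qed.

Lemma inf_uncertainty_two_scale (p : R) : 1 <= p -> exists2 A : R, 0 < A & forall a, 1 <= a ->
  (inf_uncertainty d p <=
    ((A * a `^ (- Num.min p (p * (d%:R - 1) - 2 * d%:R))) ^+ 2)%:E)%E.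
Proof.
move=> p1; have p0 : 0 < p by rewrite (lt_le_trans ltr01).
have pi0 := pi_gt0 R.
have [K K0 hK] := @gaussian_moment_scale R d p p1.
pose S : R := Num.sqrt p^-1 ^+ d; have S0 : 0 < S by rewrite exprn_gt0// sqrtr_gt0 invr_gt0.
have P0 : 0 < 2 `^ p :> R by rewrite powR_gt0.
exists (2 `^ p * K / S * 2) => [|a a1]; first by rewrite !mulr_gt0// invr_gt0.
have a0 : 0 < a by rewrite (lt_le_trans ltr01).
have a20 : 0 < a ^+ 2 by rewrite exprn_gt0.
have ad0 : 0 < a ^- d by rewrite invr_gt0 exprn_gt0.
pose f (x : 'rV[R]_d) := Complex (gauss_rv (pi * a ^+ 2) x + a ^- d * gauss_rv (pi / a ^+ 2) x) 0.
pose g t := gau (pi * a ^+ 2) t + a ^- d * gau (pi / a ^+ 2) t.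
have fE : (fun t => f (rv t)) = (fun t => Complex (g t) 0).
  by apply/funext => t; rewrite /f !gauss_rv_rv.
have c1 : 0 < pi * a ^+ 2 by rewrite mulr_gt0.
have c2 : 0 < pi / a ^+ 2 by rewrite divr_gt0.
have sf : schwartz f.
  apply: schwartz_gauss_poly; apply: gauss_poly_add; first exact: gauss_poly_base.
  exact/gauss_poly_scale/gauss_poly_base.
have fn : f <> (fun=> 0).
  by apply: gauss_rv_neq0; rewrite addr_gt0 ?mulr_gt0// expR_gt0.
have fu : ft (fun t => f (rv t)) = (fun t => f (rv t)) by rewrite fE two_scale_gaussian_fixed.
apply: le_trans (inf_uncertainty_le p1 sf fn fu) _; rewrite lee_fin fE.
have g1 t : 0 < gau (pi * a ^+ 2) t := gauss_gt0 _ _ _.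
have g2 t : 0 < gau (pi / a ^+ 2) t := gauss_gt0 _ _ _.
have g0 t : 0 < g t by rewrite addr_gt0 ?mulr_gt0.
have nE t : nrm (Complex (g t) 0) = g t by rewrite nrm_real ger0_norm// ltW.
have mg : measurable_fun setT g.
  by apply: measurable_funD; [|apply: measurable_funM => //]; exact: measurable_gauss.
have [uv1 uv2 uv3 _ _] := schwartz_fourier_pair sf.
rewrite fE in uv1 uv3.
have iN := integrable_nrm_powR p1 uv1 uv3.
have iM := integrable_en_powR p1 uv1 uv3.
(* Only the narrow bump is kept in the lower bound for the norm. *)
have Nge : S * a ^- d <= Npow p (fun t => Complex (g t) 0).
  have pc : 0 < p * (pi * a ^+ 2) by rewrite mulr_gt0.
  have <- : \int[mu]_t gau (p * (pi * a ^+ 2)) t = S * a ^- d.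
    rewrite Rintegral_gauss// /S -exprVn -exprMn; congr (_ ^+ _).
    rewrite /gaussK (_ : pi / _ = p^-1 * a^-1 ^+ 2); last first.
      by clear -pi0 p0 a0; move: (pi) pi0 => q q0; field; rewrite !gt_eqF.
    by rewrite sqrtrM ?invr_ge0 ?(ltW p0)// sqrtr_sqr ger0_norm// invr_ge0 ltW.
  apply: le_Rintegral => //; first exact: integrable_gauss.
  move=> t _; rewrite nE -gauss_powR; apply: le_powR; [exact: ltW|exact: ltW|].
  by rewrite lerDl mulr_ge0// ltW.
have [i1 h1] := hK a a0.
(* The wide bump is the narrow one at scale [a^-1]. *)
have [i2 h2] := hK a^-1 (ltac:(by rewrite invr_gt0)).
rewrite exprVn in i2 h2.
set G1 := fun t => en t `^ p * gau (p * (pi * a ^+ 2)) t in i1 h1.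
set G2 := fun t => en t `^ p * gau (p * (pi / a ^+ 2)) t in i2 h2.
pose b := (a ^- d) `^ p.
have i3 : mu.-integrable setT (EFin \o (fun t => b * G2 t)) by exact: integrable_scale.
have i4 : mu.-integrable setT (EFin \o (fun t => G1 t + b * G2 t)) by exact: integrable_add.
have i5 : mu.-integrable setT (EFin \o (fun t => 2 `^ p * (G1 t + b * G2 t))) by exact: integrable_scale.
have Mle : Mpow p (fun t => Complex (g t) 0) <=
    2 `^ p * (K * (a `^ (- p) * a ^- d) + b * (K * (a^-1 `^ (- p) * a^-1 ^- d))).
  apply: (@le_trans _ _ (\int[mu]_t (2 `^ p * (G1 t + b * G2 t)))).
    apply: le_Rintegral => // t _; rewrite nE.
    have e0 : 0 <= en t `^ p by exact: powR_ge0.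
    have h : g t `^ p <= 2 `^ p * (gau (p * (pi * a ^+ 2)) t + b * gau (p * (pi / a ^+ 2)) t).
      rewrite -[gau (p * (pi * a ^+ 2)) t]gauss_powR -[gau (p * (pi / a ^+ 2)) t]gauss_powR /b -powRM ?(ltW ad0) ?(ltW (g2 t))//.
      by apply: powR_add_le; rewrite ?mulr_ge0 ?(ltW (g1 t)) ?(ltW (g2 t)) ?(ltW p0) ?(ltW ad0).
    apply: le_trans (ler_wpM2l e0 h) _; rewrite /G1 /G2.
    by rewrite le_eqVlt; apply/orP; left; apply/eqP; ring.
  have -> := RintegralZl (mu := mu) (2 `^ p) measurableT i4.
  have -> := RintegralD (mu := mu) measurableT i1 i3.
  have -> := RintegralZl (mu := mu) b measurableT i2.
  by rewrite ler_wpM2l ?(ltW P0)// lerD// ler_wpM2l// powR_ge0.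
have N0 : 0 < Npow p (fun t => Complex (g t) 0) by apply: lt_le_trans Nge; rewrite mulr_gt0.
have M0 := Mpow_ge0 p (fun t => Complex (g t) 0).
have key := two_scale_powers p d a1.
have Z0 : 0 <= a `^ (- Num.min p (p * (d%:R - 1) - 2 * d%:R)) by exact: powR_ge0.
move: N0 M0 Nge Mle key Z0; rewrite -/b.
move: (Npow _ _) (Mpow _ _) (a `^ (- p) * a ^- d) (_ * a^-1 ^- d) (a `^ (- Num.min _ _)) => N M X Y Z N0 M0.
have w0 : 0 < a ^+ d by rewrite exprn_gt0.
move: w0; move: (a ^+ d) => w w0 Nge Mle key Z0.
have h : M / N <= 2 `^ p * K / S * 2 * Z.
  rewrite ler_pdivrMr//; apply: le_trans Mle _.
  have -> : 2 `^ p * (K * X + b * (K * Y)) = 2 `^ p * K * (X + b * Y) by ring.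
  apply: (@le_trans _ _ (2 `^ p * K / S * 2 * Z * (S / w))); last first.
    by apply: ler_wpM2l => //; rewrite !mulr_ge0 ?invr_ge0 ?(ltW P0) ?(ltW K0) ?(ltW S0).
  have -> : 2 `^ p * K / S * 2 * Z * (S / w) = 2 `^ p * K * (2 * Z / w).
    by field; rewrite !gt_eqF.
  by rewrite ler_wpM2l ?mulr_ge0 ?(ltW P0) ?(ltW K0)// ler_pdivlMr.
apply: lerXn2r; rewrite ?nnegrE ?divr_ge0// ?(ltW N0)//.
by apply: le_trans h; rewrite divr_ge0// ltW.
Qed.

Lemma inf_uncertainty_eq0 (p : R) : (1 < d)%N -> 2 * d%:R < p * (d%:R - 1) ->
  inf_uncertainty d p = 0%E.
Proof.
move=> d1 hp.
have d1R : 0 < d%:R - 1 :> R by rewrite subr_gt0 ltr1n.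
(* [p < 1] would give [2 d < d - 1]. *)
have p1 : 1 <= p.
  rewrite leNgt; apply/negP => p1.
  have : p * (d%:R - 1) <= 1 * (d%:R - 1) by rewrite ler_wpM2r ?(ltW d1R) ?(ltW p1).
  by move: (d%:R : R) d1R hp => D; lra.
have p0 : 0 < p by rewrite (lt_le_trans ltr01).
set dl := Num.min p (p * (d%:R - 1) - 2 * d%:R).
have dl0 : 0 < dl by rewrite lt_min p0 subr_gt0.
have [A A0 hA] := inf_uncertainty_two_scale p1.
apply/eqP; rewrite eq_le; apply/andP; split; last first.
  by apply: le_ereal_inf_tmp => _ [f [sf fn] <-]; exact: uncertainty_ge0.
apply/lee_addgt0Pr => e e0; rewrite add0e.
pose s := Num.sqrt e; have s0 : 0 < s by rewrite sqrtr_gt0.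
(* Large enough for [A a^(- dl) <= sqrt e], the bound being a square, and at least 1 for [hA]. *)
pose a := Num.max 1 ((A / s) `^ dl^-1).
have a1 : 1 <= a by rewrite le_max lexx.
apply: le_trans (hA a a1) _; rewrite lee_fin -/dl -[leRHS]sqr_sqrtr ?(ltW e0)//.
apply: lerXn2r; rewrite ?nnegrE ?mulr_ge0 ?powR_ge0 ?(ltW A0) ?(ltW s0)//.
rewrite powRN ler_pdivrMr ?powR_gt0 ?(lt_le_trans ltr01)// mulrC -ler_pdivrMr// -/s.
have As : 0 < A / s by rewrite divr_gt0.
have -> : A / s = ((A / s) `^ dl^-1) `^ dl by rewrite -powRrM mulVf ?gt_eqF// powRr1// ltW.
by apply: le_powR; [exact: ltW|exact: powR_ge0|rewrite le_max lexx orbT].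
Qed.

End SupercriticalExponent.

Theorem theorem2 (R : realType) :
  (forall (d : nat) (p : R), (1 <= d)%N -> 1 < p ->
     (p%:E < crit_exponent R d)%E ->
     exists C : R, 0 < C /\
       forall f : 'rV[R]_d -> R[i], schwartz f -> f <> (fun=> 0) ->
         (C%:E <= uncertainty p f)%E) /\
  (forall p : R, 1 < p -> p <= 2 ->
     exists C1 C2 : R, 0 < C1 /\ 0 < C2 /\
       \forall d \near \oo,
         ((C1 * d%:R `^ p)%:E <= inf_uncertainty d p)%E /\
         (inf_uncertainty d p <= (C2 * d%:R `^ p)%:E)%E) /\
  (forall (d : nat) (p : R), (1 <= d)%N ->
     (crit_exponent R d < p%:E)%E ->
     inf_uncertainty d p = 0%E).
Proof.
split; last split.
- by move=> d p; exact: uncertainty_lower.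
- move=> p p1 p2; exists (@small_p_const R `^ p), ((1 + (2 * pi * p)^-1) ^+ 2).
  have p0 : 0 < p by rewrite (lt_trans ltr01).
  split; first by rewrite powR_gt0// small_p_const_gt0.
  split.
    by rewrite exprn_gt0// ltr_wpDr// invr_ge0 !mulr_ge0 ?pi_ge0// ltW.
  (* Both bounds hold from [d = 1] on. *)
  exists 1%N => // d /= d0; split; last exact: inf_uncertainty_upper.
  by apply: le_ereal_inf_tmp => _ [f [sf fn] <-]; exact: uncertainty_ge_small.
- move=> d p d0 /(crit_exponent_gt d0)[d1 hp]; exact: inf_uncertainty_eq0.
Qed.
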